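(* The simplicial complexes $T_1,T_2,T_3$, and $T_{j,n}$ ($1\le j\le 9$, $n\ge 0$) defined in the context satisfy the following. (i) $T_i\cup T_{j,n}$, $T_{i,m}\cup T_{j,n}$, $T_{k,m}\cup T_{\ell,n}$ triangulate the $3$-sphere $S^3$ for $m,n\ge 0$, $(i,j)\in\{(1,7),(1,8),(2,8),(2,9),(3,7),(3,9)\}$ and $(k,\ell)\in\{(4,7),(5,8),(6,9)\}$. (ii) $T_i\cup T_{j,n}$, $T_{i,m}\cup T_{j,n}$ triangulate the projective space $\mathbb{RP}^3$ for $m,n\ge 0$ and $(i,j)\in\{(1,9),(2,7),(3,8)\}$. (iii) $T_{4,m}\cup T_{8,n}$, $T_{5,m}\cup T_{9,n}$, $T_{6,m}\cup T_{7,n}$ triangulate the lens space $L(4,1)$ for $m,n\ge 0$. (iv) $T_{4,m}\cup T_{9,n}$, $T_{5,m}\cup T_{7,n}$, $T_{6,m}\cup T_{8,n}$ triangulate the lens space $L(5,2)$ for $m,n\ge 0$. (v) $T_{7,m}\cup T_{8,n}$, $T_{8,m}\cup T_{9,n}$, $T_{9,m}\cup T_{7,n}$ triangulate the lens space $L(3,1)$ for $m,n\ge 0$. (vi) $T_{j,m}\cup T_{j,n}$ triangulates $S^2\times S^1$ for $7\le j\le 9$ and $m\ne n$, $m,n\ge 0$.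
   Context: All simplicial complexes are finite abstract complexes; a pure complex is identified with the set of its facets (maximal faces). A string such as $0123$ denotes the simplex $\{0,1,2,3\}$. $X$ triangulates a space $M$ if $|X|$ is homeomorphic to $M$. For coprime $p,q$, $L(p,q)$ is the quotient of $S^3\subset\mathbb{C}^2$ by the $\mathbb{Z}_p$-action generated by $(z_1,z_2)\mapsto(e^{2\pi i/p}z_1,e^{2\pi i q/p}z_2)$. All vertices $u_{j,n},v_{j,n},w_{j,n}$ ($1\le j\le 9$, $n\ge0$), $q_{n,i},r_{n,i},s_{n,i}$ ($n\ge 0$, $i\in\mathbb{Z}_7$), $a_{n,i},b_{n,i},c_{n,i}$ ($n\ge 0$, $1\le i\le 3$) are pairwise distinct and not in $\mathbb{Z}_7=\{0,\dots,6\}$. On the vertex set $\mathbb{Z}_7$: $T_1=\{0123,1234,2345,3456,0456,0156,0126\}$, $T_2=\{0246,1246,1346,1356,0135,0235,0245\}$, $T_3=\{0145,1245,1256,2356,0236,0346,0134\}$. Writing $u=u_{1,0}$, $v=v_{1,0}$, $w=w_{1,0}$, $T_{1,0}$ has facets $u012,u013,u023,u124,u134,u235,u245$; $v346,v356,v045,v046,v015,v156,v012,v026,v126$; $uv34,uv35,uv45$; and $T'_{1,0}$ is obtained from $T_{1,0}$ by replacing the facets $u012,v012$ with $uw01,uw02,uw12,vw01,vw02,vw12$. For $1\le j\le 3$ and $n\ge 0$, $T_{j,n}$ is the image of $T_{1,0}$ if $0\le n\le 6$, and of $T'_{1,0}$ if $n\ge 7$, under the relabelling $x\mapsto 2^{j-1}x+n\pmod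 7$ for $x\in\mathbb{Z}_7$, $u_{1,0}\mapsto u_{j,n}$, $v_{1,0}\mapsto v_{j,n}$, $w_{1,0}\mapsto w_{j,n}$. For $n\ge 0$, $T_{4,n}$ is the pure $3$-dimensional complex on $\mathbb{Z}_7\cup\{q_{n,i}:i\in\mathbb{Z}_7\}\cup\{u_{4,n},v_{4,n},w_{4,n}\}$ whose facets, with $u=u_{4,n}$, $v=v_{4,n}$, $w=w_{4,n}$, $q_i=q_{n,i}$ and $i$ running over $\mathbb{Z}_7$ (indices and integer vertices modulo 7), are: $\{w,u,i,i+1\}$, $\{w,i,i+1,q_{i+2}\}$, $\{w,i-1,q_i,q_{i+1}\}$, $\{v,w,q_i,q_{i+1}\}$, $\{v,q_i,i+1,i+2\}$, $\{v,q_i,q_{i+1},i+2\}$, $\{u,v,i,i+1\}$, $\{i-1,q_i,q_{i+1},i+2\}$, $\{i-2,i-1,q_i,i+1\}$, $\{i-1,q_i,i+1,i+2\}$. $T_{5,n}$ is the image of $T_{4,0}$ under $x\mapsto 2x+n\pmod 7$ ($x\in\mathbb{Z}_7$), $q_{0,i}\mapsto r_{n,i}$, $u_{4,0}\mapsto u_{5,n}$, $v_{4,0}\mapsto v_{5,n}$, $w_{4,0}\mapsto w_{5,n}$; $T_{6,n}$ is the image of $T_{4,0}$ under $x\mapsto 4x+n\pmod 7$, $q_{0,i}\mapsto s_{n,i}$, $u_{4,0}\mapsto u_{6,n}$, $v_{4,0}\mapsto v_{6,n}$, $w_{4,0}\mapsto w_{6,n}$. For $n\ge 0$, $T_{7,n}$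 is the pure $3$-dimensional complex on $\mathbb{Z}_7\cup\{a_{n,1},a_{n,2},a_{n,3}\}\cup\{u_{7,n},v_{7,n},w_{7,n}\}$ whose facets, with $u=u_{7,n}$, $v=v_{7,n}$, $w=w_{7,n}$, $a=a_{n,1}$, $b=a_{n,2}$, $c=a_{n,3}$, are: $uw01,uw12,uw23,uw34,uw04,wb01,wc12,w235,w346,w046,wab0,wbc1,wc25,w356,wa06,vwab,vwbc,vwc5,vw56,vwa6,va23,vb34,v045,v015,v126,vab3,vbc4,vc45,v156,va26,uv01,uv12,uv23,uv34,uv04,ab03,bc14,a023,a026,b013,b134,c124,c245.$ $T_{8,n}$ is the image of $T_{7,0}$ under $x\mapsto 2x+n\pmod 7$ ($x\in\mathbb{Z}_7$), $a_{0,i}\mapsto b_{n,i}$, $u_{7,0}\mapsto u_{8,n}$, $v_{7,0}\mapsto v_{8,n}$, $w_{7,0}\mapsto w_{8,n}$; $T_{9,n}$ is the image of $T_{7,0}$ under $x\mapsto 4x+n\pmod 7$, $a_{0,i}\mapsto c_{n,i}$, $u_{7,0}\mapsto u_{9,n}$, $v_{7,0}\mapsto v_{9,n}$, $w_{7,0}\mapsto w_{9,n}$. *)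

(* Defs.v *)
From HB Require Import structures.
From mathcomp Require Import all_boot all_order all_algebra.
From mathcomp Require Import finmap generic_quotient complex.
From mathcomp Require Import all_classical all_reals all_analysis.

Set Implicit Arguments.
Unset Strict Implicit.
Unset Printing Implicit Defensive.

Import Order.TTheory GRing.Theory Num.Theory.
Import numFieldNormedType.Exports.

Local Open Scope classical_set_scope.
Local Open Scope ring_scope.

(** * Topological spaces *)

Definition homeomorphic (X Y : topologicalType) : Prop :=
  exists (f : X -> Y) (g : Y -> X),
    [/\ continuous f, continuous g, cancel f g & cancel g f].

Section Spheres.
Variable R : realType.

Definition sphere_set (n : nat) : set 'rV[R]_n.+1 :=
  [set x | \sum_i x 0 i ^+ 2 = 1].

(* The topology on the type [set_type A] is the subspace topology. *)
Definition sphere (n : nat) : topologicalType := set_type (@sphere_set n).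

Definition antipodal (n : nat) : rel (sphere n) :=
  fun x y => (\val y == \val x) || (\val y == - \val x).

Lemma antipodal_refl n : reflexive (@antipodal n).
Proof. by move=> x; rewrite /antipodal eqxx. Qed.

Lemma antipodal_sym n : symmetric (@antipodal n).
Proof.
move=> x y; rewrite /antipodal eq_sym; congr (_ || _).
by rewrite eq_sym eqr_oppLR.
Qed.

Lemma antipodal_trans n : transitive (@antipodal n).
Proof.
move=> y x z; rewrite /antipodal.
by case/orP=> /eqP -> /orP[] /eqP ->; rewrite ?opprK eqxx ?orbT.
Qed.

Canonical antipodal_equiv n :=
  EquivRel (@antipodal n) (@antipodal_refl n) (@antipodal_sym n)
           (@antipodal_trans n).

Definition projective_space (n : nat) : topologicalType :=
  quotient_topology {eq_quot (antipodal_equiv n)}%qT.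

(* [^o] selects the topology of the complex norm; its balls have positive,
   hence real, radii. *)
Definition sphereC2_set : set (R[i]^o * R[i]^o)%type :=
  [set z | `|z.1| ^+ 2 + `|z.2| ^+ 2 = 1].

Definition sphereC2 : topologicalType := set_type sphereC2_set.

Definition expi (t : R) : R[i] := (cos t +i* sin t)%C.

(* Orbit relation of the group generated by
   (z1, z2) |-> (e^(2 pi i / p) z1, e^(2 pi i q / p) z2);
   [w ^ k] is the power with exponent k : int. *)
Definition lens_rel (p q : nat) : rel sphereC2 := fun z z' =>
  `[< exists k : int,
        (\val z').1 = expi (2 * pi / p%:R) ^ k * (\val z).1 :> R[i] /\
        (\val z').2 = expi (2 * pi * q%:R / p%:R) ^ k * (\val z).2 :> R[i] >].

Lemma expi_neq0 t : expi t != 0.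
Proof.
apply/eqP => -[c0 s0]; have := cos2Dsin2 t.
by rewrite c0 s0 expr0n addr0 => /eqP; rewrite eq_sym oner_eq0.
Qed.

Lemma lens_refl p q : reflexive (@lens_rel p q).
Proof. by move=> z; apply/asboolP; exists 0; rewrite !expr0z !mul1r. Qed.

Lemma mul_exprzN (F : fieldType) (x y z : F) (k : int) :
  x != 0 -> y = x ^ k * z -> z = x ^ (- k) * y.
Proof. by move=> x0 ->; rewrite mulrA -expfzDr // addNr expr0z mul1r. Qed.

Lemma mul_exprzD (F : fieldType) (x y z t : F) (k l : int) :
  x != 0 -> y = x ^ k * z -> t = x ^ l * y -> t = x ^ (l + k) * z.
Proof. by move=> x0 -> ->; rewrite mulrA -expfzDr. Qed.

Lemma lens_imp p q z z' : lens_rel p q z z' -> lens_rel p q z' z.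
Proof.
move=> /asboolP[k [e1 e2]]; apply/asboolP; exists (- k).
by split; apply: mul_exprzN => //; exact: expi_neq0.
Qed.

Lemma lens_sym p q : symmetric (@lens_rel p q).
Proof. by move=> z z'; apply/idP/idP; exact: lens_imp. Qed.

Lemma lens_trans p q : transitive (@lens_rel p q).
Proof.
move=> y x z /asboolP[k [e1 e2]] /asboolP[l [f1 f2]].
apply/asboolP; exists (l + k).
by split; [exact: mul_exprzD (expi_neq0 _) e1 f1|exact: mul_exprzD (expi_neq0 _) e2 f2].
Qed.

Canonical lens_equiv p q :=
  EquivRel (@lens_rel p q) (@lens_refl p q) (@lens_sym p q) (@lens_trans p q).

Definition lens_space (p q : nat) : topologicalType :=
  quotient_topology {eq_quot (lens_equiv p q)}%qT.

End Spheres.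

(** * Pure simplicial complexes, given by their sets of facets *)

Section Complexes.
Local Open Scope fset_scope.
Variable V : choiceType.

Definition pure_complex := {fset {fset V}}.

Definition face (X : pure_complex) (s : {fset V}) : Prop :=
  s != fset0 /\ exists2 f, f \in X & s `<=` f.

(* Barycentric coordinates, as a subspace of the product space R^V.  As X is
   finite, this is a subspace of R^W for the finite set W of vertices of X. *)
Definition realization_set (R : realType) (X : pure_complex) :
    set {ptws V -> R} :=
  [set t | exists s : {fset V},
     [/\ face X s, forall x, x \in s -> 0 < t x,
         forall x, x \notin s -> t x = 0 & \sum_(x <- s) t x = 1]].

Definition realization (R : realType) (X : pure_complex) : topologicalType :=
  set_type (@realization_set R X).

Definition triangulates (R : realType) (X : pure_complex)
    (M : topologicalType) : Prop :=
  homeomorphic (realization R X) M.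

End Complexes.

Definition relabel (V V' : choiceType) (h : V -> V') (X : pure_complex V) :
    pure_complex V' :=
  ((fun f : {fset V} => h @` f) @` X)%fset.

(** * The vertices *)

(* [Z7 i] is the vertex i of Z_7; [Vu j n] is u_{j,n}, [Vq n i] is q_{n,i},
   [Va n i] is a_{n,i}, and likewise for the other letters.  The labels outside
   the ranges used below (for instance [Vu 0 n]) occur in no complex. *)
Inductive vertex : Type :=
| Z7 of 'Z_7
| Vu of nat & nat | Vv of nat & nat | Vw of nat & nat
| Vq of nat & 'Z_7 | Vr of nat & 'Z_7 | Vs of nat & 'Z_7
| Va of nat & nat | Vb of nat & nat | Vc of nat & nat.

Definition vertex_encode (x : vertex) : nat * nat * nat :=
  match x with
  | Z7 i => (0, val i, 0)
  | Vu j n => (1, j, n) | Vv j n => (2, j, n) | Vw j n => (3, j, n)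
  | Vq n i => (4, n, val i) | Vr n i => (5, n, val i) | Vs n i => (6, n, val i)
  | Va n i => (7, n, i) | Vb n i => (8, n, i) | Vc n i => (9, n, i)
  end%N.

Definition vertex_decode (c : nat * nat * nat) : vertex :=
  let: (k, m, n) := c in
  match k with
  | 0 => Z7 (inZp m)
  | 1 => Vu m n | 2 => Vv m n | 3 => Vw m n
  | 4 => Vq m (inZp n) | 5 => Vr m (inZp n) | 6 => Vs m (inZp n)
  | 7 => Va m n | 8 => Vb m n | _ => Vc m n
  end%N.

Lemma vertex_encodeK : cancel vertex_encode vertex_decode.
Proof. by case=> //= *; rewrite valZpK. Qed.

HB.instance Definition _ := Countable.copy vertex (can_type vertex_encodeK).

(* Allows the digits 0, ..., 6 to be used as vertices. *)
Definition digit (i : nat) : vertex := Z7 (inZp i).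
Coercion digit : nat >-> vertex.

(** * The complexes *)

Section Facets.
Local Open Scope fset_scope.
Local Open Scope nat_scope.

Definition simplex (a b c d : vertex) : {fset vertex} := [fset a; b; c; d].

Definition complex_of (s : seq {fset vertex}) : pure_complex vertex :=
  [fset f in s].

Definition T_1 := complex_of
  [:: simplex 0 1 2 3; simplex 1 2 3 4; simplex 2 3 4 5; simplex 3 4 5 6;
      simplex 0 4 5 6; simplex 0 1 5 6; simplex 0 1 2 6].

Definition T_2 := complex_of
  [:: simplex 0 2 4 6; simplex 1 2 4 6; simplex 1 3 4 6; simplex 1 3 5 6;
      simplex 0 1 3 5; simplex 0 2 3 5; simplex 0 2 4 5].

Definition T_3 := complex_of
  [:: simplex 0 1 4 5; simplex 1 2 4 5; simplex 1 2 5 6; simplex 2 3 5 6;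
      simplex 0 2 3 6; simplex 0 3 4 6; simplex 0 1 3 4].

Definition T10 := let u := Vu 1 0 in let v := Vv 1 0 in complex_of
  [:: simplex u 0 1 2; simplex u 0 1 3; simplex u 0 2 3; simplex u 1 2 4;
      simplex u 1 3 4; simplex u 2 3 5; simplex u 2 4 5;
      simplex v 3 4 6; simplex v 3 5 6; simplex v 0 4 5; simplex v 0 4 6;
      simplex v 0 1 5; simplex v 1 5 6; simplex v 0 1 2; simplex v 0 2 6;
      simplex v 1 2 6;
      simplex u v 3 4; simplex u v 3 5; simplex u v 4 5].

Definition T10' := let u := Vu 1 0 in let v := Vv 1 0 in let w := Vw 1 0 in
  (T10 `\` complex_of [:: simplex u 0 1 2; simplex v 0 1 2]) `|`
  complex_of
    [:: simplex u w 0 1; simplex u w 0 2; simplex u w 1 2;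
        simplex v w 0 1; simplex v w 0 2; simplex v w 1 2].

Definition T4 (n : nat) :=
  let u := Vu 4 n in let v := Vv 4 n in let w := Vw 4 n in
  complex_of (flatten
    [seq (let z (k : 'Z_7) := Z7 (i + k)%R in
          let q (k : 'Z_7) := Vq n (i + k)%R in
          [:: simplex w u (z 0) (z 1);
              simplex w (z 0) (z 1) (q 2);
              simplex w (z (-1)) (q 0) (q 1);
              simplex v w (q 0) (q 1);
              simplex v (q 0) (z 1) (z 2);
              simplex v (q 0) (q 1) (z 2);
              simplex u v (z 0) (z 1);
              simplex (z (-1)) (q 0) (q 1) (z 2);
              simplex (z (-2)) (z (-1)) (q 0) (z 1);
              simplex (z (-1)) (q 0) (z 1) (z 2)]%R)
    | i : 'Z_7 <- enum 'Z_7]).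

Definition T7 (n : nat) :=
  let u := Vu 7 n in let v := Vv 7 n in let w := Vw 7 n in
  let a := Va n 1 in let b := Va n 2 in let c := Va n 3 in
  complex_of
  [:: simplex u w 0 1; simplex u w 1 2; simplex u w 2 3; simplex u w 3 4;
      simplex u w 0 4; simplex w b 0 1; simplex w c 1 2; simplex w 2 3 5;
      simplex w 3 4 6; simplex w 0 4 6; simplex w a b 0; simplex w b c 1;
      simplex w c 2 5; simplex w 3 5 6; simplex w a 0 6; simplex v w a b;
      simplex v w b c; simplex v w c 5; simplex v w 5 6; simplex v w a 6;
      simplex v a 2 3; simplex v b 3 4; simplex v 0 4 5; simplex v 0 1 5;
      simplex v 1 2 6; simplex v a b 3; simplex v b c 4; simplex v c 4 5;
      simplex v 1 5 6; simplex v a 2 6; simplex u v 0 1; simplex u v 1 2;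
      simplex u v 2 3; simplex u v 3 4; simplex u v 0 4; simplex a b 0 3;
      simplex b c 1 4; simplex a 0 2 3; simplex a 0 2 6; simplex b 0 1 3;
      simplex b 1 3 4; simplex c 1 2 4; simplex c 2 4 5].

(* x |-> k x + n on Z_7, any u, v, w to u_{j,n}, v_{j,n}, w_{j,n}, and the
   remaining letters according to h. *)
Definition relabeling (k : 'Z_7) (j n : nat) (h : vertex -> vertex)
    (x : vertex) : vertex :=
  match x with
  | Z7 i => Z7 (k * i + n%:R)%R
  | Vu _ _ => Vu j n
  | Vv _ _ => Vv j n
  | Vw _ _ => Vw j n
  | y => h y
  end.

Definition QtoR (n : nat) (x : vertex) := if x is Vq _ i then Vr n i else x.
Definition QtoS (n : nat) (x : vertex) := if x is Vq _ i then Vs n i else x.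
Definition AtoB (n : nat) (x : vertex) := if x is Va _ i then Vb n i else x.
Definition AtoC (n : nat) (x : vertex) := if x is Va _ i then Vc n i else x.

Definition Tbase (i : nat) : pure_complex vertex :=
  match i with 1 => T_1 | 2 => T_2 | 3 => T_3 | _ => fset0 end.

(* T_{4,n} and T_{7,n} are defined directly, without the shift by n on Z_7. *)
Definition Tfam (j n : nat) : pure_complex vertex :=
  match j with
  | 1 | 2 | 3 =>
      relabel (relabeling (2 ^+ j.-1)%R j n id) (if n <= 6 then T10 else T10')
  | 4 => T4 n
  | 5 => relabel (relabeling 2%R 5 n (QtoR n)) (T4 0)
  | 6 => relabel (relabeling 4%R 6 n (QtoS n)) (T4 0)
  | 7 => T7 n
  | 8 => relabel (relabeling 2%R 8 n (AtoB n)) (T7 0)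
  | 9 => relabel (relabeling 4%R 9 n (AtoC n)) (T7 0)
  | _ => fset0
  end.

End Facets.

(* Main.v *)
Require Import Defs.
From HB Require Import structures.
From Stdlib Require Import NArith ZArith Lia.
From mathcomp Require Import all_boot all_order all_algebra.
From mathcomp Require Import finmap generic_quotient complex.
From mathcomp Require Import all_classical all_reals all_analysis.
From mathcomp Require Import ring lra.

(** Every complex [T_i], [T_{j,n}] is a solid torus bounded by the torus with the
    vertices Z_7, and the union of two of them is a 3-manifold with a splitting of
    genus 1. The homeomorphism types are found by simplifying the unions with
    bistellar moves, and the whole argument rests on a formula for such moves.

    A move replaces a face [A], whose link is the boundary of a simplex [B], by [B].
    In barycentric coordinates it is realized by pushing the point [t] by the
    minimum of [t] over [A] in the direction [|A|/|B| 1_B - 1_A]; the same formula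
    with [A] and [B] exchanged is the inverse ([push_into]). The formula is global
    and continuous, moves that do not interfere can be made at once, and a symmetry
    that permutes them commutes with their push. So a list of moves whose validity
    is checked by computation yields a homeomorphism of the realizations
    ([reduces_homeo]).

    There are finitely many gluings to consider. Moves in the interior of a solid
    torus reduce [T_7] to a complex with four interior vertices, and that complex to
    its translate by 5, up to names; so translations do not affect the result of a
    gluing ([exchangeable_shift]). The multiplications by 2 and 4 act on both sides
    of the torus, so only the ratio of the two multipliers matters ([amalgam_abc]),
    and on the first side [T_{1,0}] and [T'_{1,0}] reduce to [T_1]. This leaves
    eight complexes: the shapes [T_1] and [T_4] glued to the reduced [T_7] with the
    ratios 1, 2, 4, and the reduced [T_7] glued to itself with the ratios 1, 2.

    Three of the eight reduce to the boundary of a 4-simplex. For the projective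
    space and the lens spaces, the complex is presented as the quotient of a [p]-fold
    cyclic covering; moves made in whole orbits reduce the covering to a join of
    boundaries of simplices, permuted by the rotation of the sheets. Such a join is
    the boundary of a star-shaped neighbourhood of 0 in the space of functions on
    its vertices modulo those constant on the blocks, and linear forms identify it
    equivariantly with the unit sphere ([linear_join_param]): the cross polytope
    with the antipode, a join of two squares or of two triangles, or the boundary
    of a 4-simplex on which the rotation acts linearly by a fifth root of unity and
    its square. The moves being equivariant, this parametrization passes to the
    quotient ([spin_quotient]).

    The last complex reduces to the staircase triangulation of the product of the
    boundaries of a tetrahedron and of a triangle. Its points are probability
    distributions on a grid supported on chains, and such a distribution is the
    monotone coupling of its two marginals ([product_homeo]). *)

Set Implicit Arguments.
Unset Strict Implicit.
Unset Printing Implicit Defensive.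

Import Order.TTheory GRing.Theory Num.Theory.
Import numFieldNormedType.Exports.

Local Open Scope classical_set_scope.
Local Open Scope ring_scope.

(** * Homeomorphisms *)

Lemma homeo_refl (X : topologicalType) : homeomorphic X X.
Proof. by exists idfun, idfun; split=> // x; exact: cvg_id. Qed.

Lemma homeo_sym (X Y : topologicalType) : homeomorphic X Y -> homeomorphic Y X.
Proof. by case=> f [g [cf cg fK gK]]; exists g, f; split. Qed.

Lemma homeo_trans (X Y Z : topologicalType) :
  homeomorphic X Y -> homeomorphic Y Z -> homeomorphic X Z.
Proof.
move=> [f [g [cf cg fK gK]]] [f' [g' [cf' cg' fK' gK']]].
exists (f' \o f), (g \o g'); split.
- by move=> x; apply: continuous_comp; [exact: cf|exact: cf'].
- by move=> x; apply: continuous_comp; [exact: cg'|exact: cg].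
- exact: can_comp.
- exact: can_comp.
Qed.

Lemma continuous_to_subtype (X Y : topologicalType) (B : set Y) (f : X -> B) :
  continuous (fun x => val (f x)) -> continuous f.
Proof. by move=> cf; apply: (@continuous_comp_initial _ X Y set_val f); exact: cf. Qed.

Lemma continuous_val (Y : topologicalType) (B : set Y) :
  continuous (val : B -> Y).
Proof. exact: initial_continuous. Qed.

Lemma homeo_subsets (X Y : topologicalType) (A : set X) (B : set Y)
    (f : X -> Y) (g : Y -> X) :
  continuous f -> continuous g ->
  (forall x, A x -> B (f x) /\ g (f x) = x) ->
  (forall y, B y -> A (g y) /\ f (g y) = y) ->
  homeomorphic A B.
Proof.
move=> cf cg fAB gBA.
have fP (x : A) : f (val x) \in B by apply/mem_set; case: (fAB _ (set_valP x)).
have gP (y : B) : g (val y) \in A by apply/mem_set; case: (gBA _ (set_valP y)).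
exists (fun x => SigSub (fP x)), (fun y => SigSub (gP y)); split.
- apply: continuous_to_subtype => x /=.
  exact: (@continuous_comp A X Y val f x (@continuous_val X A x) (cf _)).
- apply: continuous_to_subtype => x /=.
  exact: (@continuous_comp B Y X val g x (@continuous_val Y B x) (cg _)).
- by move=> x; apply: val_inj => /=; case: (fAB _ (set_valP x)).
- by move=> y; apply: val_inj => /=; case: (gBA _ (set_valP y)).
Qed.

(** A closed set of the compact space [X] is compact, so its image is closed:
    the inverse of [f] is continuous. *)
Lemma compact_bij_homeo (X Y : topologicalType) (f : X -> Y) :
  compact [set: X] -> hausdorff_space Y -> continuous f -> injective f ->
  (forall y, exists x, f x = y) -> homeomorphic Y X.
Proof.
move=> cX hY cf fI fS.
have [g gK] : {g : Y -> X | cancel g f}.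
  by exists (fun y => projT1 (cid (fS y))) => y; case: cid.
have fK : cancel f g by move=> x; apply: fI; rewrite gK.
exists g, f; split=> //.
apply/continuous_closedP => C cC.
suff -> : g @^-1` C = f @` C.
  apply: compact_closed => //.
  apply: continuous_compact.
    by apply: continuous_subspaceT.
  by apply: subclosed_compact cC cX _.
rewrite eqEsubset; split=> [y /= Cg|_ [x Cx <-]] /=; first by exists (g y).
by rewrite fK.
Qed.

Lemma hausdorff_injective (X Y : topologicalType) (f : X -> Y) :
  hausdorff_space Y -> continuous f -> injective f -> hausdorff_space X.
Proof.
rewrite !open_hausdorff => hY cf fI x y xy.
have /hY[[A B] /= [xA yB] [oA oB AB]] : f x != f y.
  by apply: contraNneq xy => /fI ->.
exists (f @^-1` A, f @^-1` B) => /=.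
  by split; apply/mem_set; rewrite /= -in_setE.
split; [exact: open_comp|exact: open_comp|].
by rewrite -preimage_setI (eqP AB) preimage_set0.
Qed.

Lemma compact_image_space (X Y : topologicalType) (f : X -> Y) :
  compact [set: X] -> continuous f -> (forall y, exists x, f x = y) ->
  compact [set: Y].
Proof.
move=> cX cf fS.
have -> : [set: Y] = f @` [set: X].
  by rewrite eqEsubset; split=> y // _; have [x <-] := fS y; exists x.
by apply: continuous_compact => //; apply: continuous_subspaceT.
Qed.

Lemma compact_subtype (X : topologicalType) (A : set X) :
  compact A -> compact [set: A].
Proof.
move=> cA F PF _.
have FA : (val @ F) A.
  by apply: (@filterS _ F _ setT); [move=> x _; exact: set_valP|exact: filterT].
have [p [Ap clp]] := [elaborate cA (val @ F) _ FA].
exists (SigSub (mem_set Ap)); split=> // U V FU.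
case=> O [[W oW <-] Wp] WV.
have FU' : (val @ F) (val @` U) by apply: (@filterS _ F _ U) => // x Ux; exists x.
have [_ [[x Ux <-] Wx]] := clp _ W FU' (open_nbhs_nbhs (conj oW Wp)).
by exists x; split=> //; apply: WV.
Qed.

Section Pointwise.
Variables (R : realType) (T : choiceType).

Lemma continuous_ptws (X : topologicalType) (f : X -> {ptws T -> R}) :
  (forall i, continuous (fun x => f x i)) -> continuous f.
Proof.
move=> cf x; apply/cvg_sup => i U /= [_ [[W oW <-] Wx] WU].
apply: (@filterS _ (nbhs x) _ ((fun y => f y i) @^-1` W)); last first.
  exact: cf (open_nbhs_nbhs (conj oW Wx)).
by move=> y /= Wy; apply: WU.
Qed.

Lemma continuous_coord (i : T) : continuous (fun t : {ptws T -> R} => t i).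
Proof. exact: (@proj_continuous T (fun _ => R) i). Qed.

Lemma hausdorff_ptws : hausdorff_space {ptws T -> R}.
Proof.
exact: (@hausdorff_product T (fun _ => R) (fun _ => @Rhausdorff R)).
Qed.

End Pointwise.

Section RealMaps.
Variables (R : realType) (X : topologicalType).
Implicit Types f g : X -> R.

Lemma cont_cst (c : R) : continuous (fun _ : X => c).
Proof. exact: cst_continuous. Qed.

Lemma cont_min f g : continuous f -> continuous g ->
  continuous (fun x => Num.min (f x) (g x)).
Proof. by move=> cf cg x; apply: (@continuous_min R X f g x); [exact: cf|exact: cg]. Qed.

Lemma cont_add f g : continuous f -> continuous g ->
  continuous (fun x => f x + g x).
Proof. by move=> cf cg x; apply: (@continuousD R R^o X f g x); [exact: cf|exact: cg]. Qed.

Lemma cont_opp f : continuous f -> continuous (fun x => - f x).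
Proof. by move=> cf x; apply: (@continuousN R R^o X f x); exact: cf. Qed.

Lemma cont_mul f g : continuous f -> continuous g ->
  continuous (fun x => f x * g x).
Proof. by move=> cf cg x; apply: (@continuousM R X f g x); [exact: cf|exact: cg]. Qed.

Lemma cont_inv f : (forall x, f x != 0) -> continuous f ->
  continuous (fun x => (f x)^-1).
Proof. by move=> f0 cf x; apply: (@continuousV R X f x); [exact: f0|exact: cf]. Qed.

Lemma cont_sum (I : Type) (r : seq I) (F : I -> X -> R) :
  (forall i, continuous (F i)) -> continuous (fun x => \sum_(i <- r) F i x).
Proof.
move=> cF; elim: r => [|i r IH].
  by under eq_fun do rewrite big_nil; exact: cont_cst.
by under eq_fun do rewrite big_cons; apply: cont_add.
Qed.

End RealMaps.

(** * Realizations and bistellar moves *)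

Section Geom.
Variables (R : realType) (T : choiceType).
Implicit Types (f g A B s : seq T) (X Y : seq (seq T)) (t : T -> R).

Definition sub A f := all (mem f) A.

Lemma subP A f : reflect {subset A <= f} (sub A f).
Proof. exact: allP. Qed.

(** A complex is a list of facets and a facet is a list of vertices, so that
    complexes can be computed with; the barycentric coordinates of a point only
    see the set of entries of a facet, whence [undup]. *)
Definition in_simplex f t :=
  [/\ forall x, 0 <= t x, forall x, x \notin f -> t x = 0
    & \sum_(x <- undup f) t x = 1].

Definition geom X : set {ptws T -> R} :=
  [set t | exists2 f, f \in X & in_simplex f t].

Lemma sum_supp s s' t : uniq s -> uniq s' ->
  (forall x, x \notin s -> t x = 0) -> (forall x, x \notin s' -> t x = 0) ->
  \sum_(x <- s) t x = \sum_(x <- s') t x.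
Proof.
move=> us us' ts ts'.
have E (r r' : seq T) : (forall x, x \notin r' -> t x = 0) ->
    \sum_(x <- r) t x = \sum_(x <- [seq x <- r | x \in r']) t x.
  move=> tr; rewrite big_filter [RHS]big_mkcond /=; apply: eq_bigr => x _.
  by case: ifPn => // /tr.
rewrite (E s s' ts') (E s' s ts); apply: perm_big.
apply: uniq_perm; rewrite ?filter_uniq // => x.
by rewrite !mem_filter andbC.
Qed.

Lemma in_simplexP f s t : uniq s -> {subset f <= s} ->
  (forall x, x \notin f -> t x = 0) ->
  \sum_(x <- undup f) t x = \sum_(x <- s) t x.
Proof.
move=> us fs tf; apply: sum_supp; rewrite ?undup_uniq //.
  by move=> x; rewrite mem_undup; exact: tf.
by move=> x xs; apply: tf; apply: contra xs; exact: fs.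
Qed.

Lemma in_simplex_sub f g t : {subset f <= g} -> in_simplex f t -> in_simplex g t.
Proof.
move=> fg [t0 tf t1].
have tg x : x \notin g -> t x = 0 by move=> xg; apply: tf; apply: contra xg; exact: fg.
split=> //; rewrite -t1; apply/esym/in_simplexP => //; first exact: undup_uniq.
by move=> x /fg; rewrite mem_undup.
Qed.

Lemma geom_sub X X' : all (fun f => has (sub f) X') X -> geom X `<=` geom X'.
Proof.
move=> /allP XX' t [f /XX' /hasP[g gX' /subP fg] ft].
by exists g => //; exact: in_simplex_sub ft.
Qed.

Lemma geomU X Y : geom (X ++ Y) = geom X `|` geom Y.
Proof.
apply/seteqP; split=> t.
  by move=> [f]; rewrite mem_cat => /orP[fX|fY] ft; [left|right]; exists f.
by case=> -[f fX ft]; exists f; rewrite // mem_cat fX ?orbT.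
Qed.

Definition same X X' := all (fun f => has (sub f) X') X && all (fun f => has (sub f) X) X'.

Lemma same_geom X X' : same X X' -> geom X = geom X'.
Proof. by case/andP=> /geom_sub a /geom_sub b; rewrite eqEsubset. Qed.

Definition minl t A : R :=
  if A is a :: A' then foldr (fun x m => Num.min (t x) m) (t a) A' else 0.

Lemma minl_le t A a : a \in A -> minl t A <= t a.
Proof.
case: A => // b A; rewrite inE /=; elim: A => [|c A IH] /=.
  by rewrite orbF => /eqP ->.
rewrite inE ge_min orbCA => /orP[/eqP ->|/IH ->]; first by rewrite lexx.
by rewrite orbT.
Qed.

Lemma minl_attained t A : A != [::] -> exists2 a, a \in A & minl t A = t a.
Proof.
case: A => // b A _ /=; elim: A => [|c A [a aA /= E]] /=; first by exists b; rewrite ?mem_head.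
rewrite E minElt; case: ifP => _; [exists c|exists a] => //.
  by rewrite !inE eqxx orbT.
by move: aA; rewrite !inE => /orP[->|->]; rewrite ?orbT.
Qed.

Lemma minl_ge0 t A : (forall x, 0 <= t x) -> 0 <= minl t A.
Proof.
move=> t0; case: (eqVneq A [::]) => [-> //|/(minl_attained t)[a _ ->]].
exact: t0.
Qed.

Lemma minl_eq0 t A f : (forall x, 0 <= t x) -> (forall x, x \notin f -> t x = 0) ->
  ~~ sub A f -> minl t A = 0.
Proof.
move=> t0 tf /allPn[a aA af]; apply/eqP; rewrite eq_le minl_ge0 // andbT.
by rewrite -(tf a af); exact: minl_le.
Qed.

Lemma minl_continuous A : continuous (fun t : {ptws T -> R} => minl t A).
Proof.
case: A => [|a A]; first exact: cont_cst.
rewrite /minl; elim: A => [|b A IH]; first exact: continuous_coord.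
by apply: cont_min => //; exact: continuous_coord.
Qed.

(** A move [m] replaces the simplex [m.1 = A] by the simplex [m.2 = B]. A point
    is pushed in the direction [|A|/|B| 1_B - 1_A], which keeps the total mass,
    until one of its coordinates on [A] vanishes. *)
Definition flow (m : seq T * seq T) (t : T -> R) : T -> R := fun x =>
  minl t m.1 * ((size m.1)%:R / (size m.2)%:R * (x \in m.2)%:R - (x \in m.1)%:R).

Definition push (ms : seq (seq T * seq T)) (t : T -> R) : T -> R := fun x =>
  t x + \sum_(m <- ms) flow m t x.

Lemma push_continuous ms : continuous (push ms : {ptws T -> R} -> {ptws T -> R}).
Proof.
apply: continuous_ptws => x; apply: cont_add; first exact: continuous_coord.
apply: cont_sum => m; apply: cont_mul; last exact: cont_cst.
exact: minl_continuous.
Qed.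

Lemma big_only (I : eqType) (r : seq I) (m : I) (F : I -> R) :
  m \in r -> uniq r -> (forall i, i \in r -> i != m -> F i = 0) ->
  \sum_(i <- r) F i = F m.
Proof.
move=> mr ur F0; rewrite (bigD1_seq m) //= big_seq_cond big1 ?addr0 // => i.
by case/andP => ir im; exact: F0.
Qed.

Lemma sum_mem s A : uniq s -> uniq A -> {subset A <= s} ->
  \sum_(x <- s) (x \in A)%:R = (size A)%:R :> R.
Proof.
move=> us uA As; rewrite -sum1_size natr_sum.
rewrite -(@in_simplexP A s (fun x => (x \in A)%:R)) //; last by move=> x /negPf ->.
by rewrite undup_id // big_seq [RHS]big_seq; apply: eq_bigr => x ->.
Qed.

Definition swap (m : seq T * seq T) := (m.2, m.1).

Definition wf_move (m : seq T * seq T) :=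
  [&& uniq m.1, uniq m.2, m.1 != [::], m.2 != [::] & ~~ has (mem m.2) m.1].

(** The situation in which [push ms] sends [X] to [X']. No facet of [X] contains
    a [B]; a facet containing some [A] contains only that one, lies in [A ++ B],
    and the simplices [(A \ a) ++ B] which replace it are in [X'] and contain the
    [B] of no other move. *)
Definition moves_into X X' (ms : seq (seq T * seq T)) :=
  forall f, f \in X ->
  (forall m, m \in ms -> ~~ sub m.2 f) /\
  ((forall m, m \in ms -> ~~ sub m.1 f) /\ f \in X' \/
   exists m, [/\ m \in ms, sub m.1 f, sub f (m.1 ++ m.2),
     forall m', m' \in ms -> sub m'.1 f -> m' = m &
     forall a, a \in m.1 -> has (sub (rem a m.1 ++ m.2)) X' /\
       forall m', m' \in ms -> sub m'.2 (rem a m.1 ++ m.2) -> m' = m]).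

Lemma flow0 m t : minl t m.1 = 0 -> flow m t = fun=> 0.
Proof. by move=> t0; apply: funext => x; rewrite /flow t0 mul0r. Qed.

Lemma push_id ms t : (forall m, m \in ms -> minl t m.1 = 0) -> push ms t = t.
Proof.
move=> t0; apply: funext => x; rewrite /push big_seq big1 ?addr0 // => m /t0 E.
by rewrite flow0.
Qed.

Lemma sub_catl a A B : sub (rem a A ++ B) (A ++ B).
Proof.
apply/subP => x; rewrite !mem_cat => /orP[|->]; last by rewrite orbT.
by move/mem_rem ->.
Qed.

(** On a facet containing [A], the push removes the vertices where the minimum
    over [A] is attained. The facet does not contain [B], so some coordinate on [B]
    vanishes before the push and the minimum over [B] after it is the amount that
    was added: the swapped move pushes it back. *)
Lemma push_into X X' ms t : uniq ms -> all wf_move ms -> moves_into X X' ms ->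
  geom X t -> geom X' (push ms t) /\ push (map swap ms) (push ms t) = t.
Proof.
move=> ums wf XX' [f fX ft]; have [t0 tf t1] := ft.
have [noB [[noA fX']|[m [mms /subP Af /subP fAB only_m new]]]] := XX' f fX.
  have -> : push ms t = t.
    by apply: push_id => m mms; apply: (@minl_eq0 t m.1 f) => //; exact: noA.
  split; first by exists f.
  apply: push_id => _ /mapP[m mms ->].
  by apply: (@minl_eq0 t m.2 f) => //; exact: noB.
have /and5P[uA uB A0 B0 /hasPn AB'] := allP wf _ mms.
have AB x : x \in m.1 -> x \notin m.2 by exact: AB'.
have [a aA ta] := minl_attained t A0.
set c := minl t m.1 in ta; have c0 : 0 <= c by exact: minl_ge0.
have push1 x : push ms t x = t x + flow m t x.
  congr (_ + _); apply: (big_only (F := fun m => flow m t x)) => // m' m'ms m'm.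
  rewrite flow0 //; apply: (@minl_eq0 t m'.1 f) => //.
  by apply: contra m'm => /(only_m _ m'ms) ->.
have sA0 : (size m.1)%:R != 0 :> R by rewrite pnatr_eq0 size_eq0.
have sB0 : (size m.2)%:R != 0 :> R by rewrite pnatr_eq0 size_eq0.
set t' := push ms t.
have t'0 x : 0 <= t' x.
  rewrite /t' push1 /flow -/c; have [xA|xA] := boolP (x \in m.1).
    rewrite (negPf (AB _ xA)) mulr0 sub0r mulrN1 subr_ge0; exact: minl_le.
  by rewrite subr0 addr_ge0 // mulr_ge0 // mulr_ge0 // divr_ge0.
have [/hasP[g gX' /subP gsub] newB] := new _ aA.
have t'G x : x \notin rem a m.1 ++ m.2 -> t' x = 0.
  rewrite mem_cat negb_or => /andP[xa xB].
  rewrite /t' push1 /flow -/c (negPf xB) mulr0 sub0r.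
  have [->|xna] := eqVneq x a; first by rewrite aA ta mulrN1 subrr.
  have xA : x \notin m.1 by move: xa; rewrite mem_rem_uniq // inE xna.
  rewrite (negPf xA) oppr0 mulr0 addr0 tf //.
  by apply/negP => /fAB; rewrite mem_cat (negPf xA) (negPf xB).
have t'G1 : in_simplex (rem a m.1 ++ m.2) t'.
  split=> //.
  pose s := undup (m.1 ++ m.2).
  have us : uniq s by exact: undup_uniq.
  rewrite (@in_simplexP _ s) //; last first.
    by move=> x; rewrite /s mem_undup; move: x; apply/subP; exact: sub_catl.
  rewrite (eq_bigr _ (fun x _ => push1 x)) big_split /=.
  rewrite -(@in_simplexP f s) //; last by move=> x /fAB; rewrite /s mem_undup.
  rewrite t1 /flow -big_distrr /= big_split /= -big_distrr /= sumrN.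
  rewrite !sum_mem //; last 2 first.
  - by move=> x xA; rewrite /s mem_undup mem_cat xA.
  - by move=> x xB; rewrite /s mem_undup mem_cat xB orbT.
  by rewrite divfK // subrr mulr0 addr0.
split; first by exists g => //; exact: in_simplex_sub t'G1.
have minB : minl t' m.2 = c * ((size m.1)%:R / (size m.2)%:R).
  have val b : b \in m.2 -> t' b = t b + c * ((size m.1)%:R / (size m.2)%:R).
    move=> bB; rewrite /t' push1 /flow -/c bB.
    have /negPf -> : b \notin m.1 by apply: contraL bB => /AB.
    by rewrite subr0 mulr1.
  have [b bB E] := minl_attained t' B0.
  have /allPn[b' b'B b'f] := noB _ mms.
  apply/eqP; rewrite eq_le; apply/andP; split.
    by apply: (le_trans (minl_le t' b'B)); rewrite val // tf // add0r.
  by rewrite E val // lerDr.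
apply: funext => x; rewrite /push big_map.
rewrite (@big_only _ ms m (fun m => flow (swap m) t' x)) //; last first.
  move=> m' m'ms m'm; rewrite flow0 //.
  apply: (@minl_eq0 t' m'.2 (rem a m.1 ++ m.2)) => //.
  by apply: contra m'm => /(newB _ m'ms) ->.
rewrite -/t' /t' push1 /flow /= -/c minB.
have e : (size m.1)%:R / (size m.2)%:R * ((size m.2)%:R / (size m.1)%:R) = 1 :> R.
  by rewrite mulrA divfK // divff.
(* [p] and [q] are the ratios [|A|/|B|] and [|B|/|A|]. *)
have cancel_flow (p q u v w : R) : p * q = 1 ->
    w + c * (p * u - v) + c * p * (q * v - u) = w.
  move=> pq; have -> : w + c * (p * u - v) + c * p * (q * v - u) = w + c * v * (p * q - 1).
    by ring.
  by rewrite pq subrr mulr0 addr0.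
exact: cancel_flow.
Qed.

Lemma swapK : cancel swap swap. Proof. by case. Qed.

Lemma map_swapK ms : map swap (map swap ms) = ms.
Proof. by rewrite -map_comp map_id_in // => m _; exact: swapK. Qed.

Lemma uniq_swap ms : uniq (map swap ms) = uniq ms.
Proof. by rewrite map_inj_uniq //; exact: can_inj swapK. Qed.

Lemma wf_swap ms : all wf_move ms -> all wf_move (map swap ms).
Proof.
rewrite all_map; apply: sub_all => m /= /and5P[uA uB A0 B0 AB].
rewrite /wf_move /= uA uB A0 B0 /=; apply: contra AB => /hasP[x xB xA].
by apply/hasP; exists x.
Qed.

Definition exchange X X' ms :=
  [/\ uniq ms, all wf_move ms, moves_into X X' ms & moves_into X' X (map swap ms)].

Lemma exchange_push X X' ms t : exchange X X' ms -> geom X t ->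
  geom X' (push ms t) /\ push (map swap ms) (push ms t) = t.
Proof. by case=> ums wf XX' _; exact: push_into. Qed.

Lemma exchange_sym X X' ms : exchange X X' ms -> exchange X' X (map swap ms).
Proof.
by case=> ums wf XX' X'X; split; rewrite ?uniq_swap ?map_swapK //; exact: wf_swap.
Qed.

Lemma exchange_homeo X X' ms : exchange X X' ms -> homeomorphic (geom X) (geom X').
Proof.
move=> ex; apply: (@homeo_subsets {ptws T -> R} {ptws T -> R} (geom X) (geom X')
  (push ms) (push (map swap ms))).
- exact: push_continuous.
- exact: push_continuous.
- by move=> t; exact: exchange_push.
- by move=> t /(exchange_push (exchange_sym ex)); rewrite map_swapK.
Qed.

Definition new_facets (ms : seq (seq T * seq T)) : seq (seq T) :=
  flatten [seq [seq rem a m.1 ++ m.2 | a <- m.1] | m <- ms].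

Definition hit (ms : seq (seq T * seq T)) f := has (fun m => sub m.1 f) ms.

(** Decides that [ms] can be performed on [X], giving [step X ms]. By the
    last clause every [A ++ (B \ b)] is a face of [X], so that the link of [A] is the
    whole boundary of [B]. *)
Definition valid_moves X (ms : seq (seq T * seq T)) :=
  let old := [seq f <- X | hit ms f] in
  let sm := map swap ms in
  [&& uniq ms, all wf_move ms,
    all (fun f => ~~ hit sm f) X,
    all (fun f => (count (fun m => sub m.1 f) ms <= 1)%N &&
                  all (fun m => sub m.1 f ==> sub f (m.1 ++ m.2)) ms) old,
    all (fun g => ~~ hit ms g && (count (fun m => sub m.1 g) sm <= 1)%N) (new_facets ms)
  & all (fun m => all (fun b => has (sub (rem b m.2 ++ m.1)) old) m.2) ms].

Definition step X ms := new_facets ms ++ [seq f <- X | ~~ hit ms f].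

Lemma count_le1 (I : eqType) (r : seq I) (p : pred I) i j :
  (count p r <= 1)%N -> uniq r -> i \in r -> j \in r -> p i -> p j -> i = j.
Proof.
move=> c ur ir jr pi pj; apply/eqP; apply: contraTT c => ij; rewrite -ltnNge.
have : {subset [:: i; j] <= [seq x <- r | p x]}.
  by move=> x; rewrite !inE mem_filter => /orP[]/eqP ->; apply/andP.
rewrite -size_filter => /uniq_leq_size; apply.
by rewrite /= inE ij.
Qed.

Lemma new_facetsP ms g : reflect
  (exists2 m, m \in ms & exists2 a, a \in m.1 & g = rem a m.1 ++ m.2)
  (g \in new_facets ms).
Proof.
apply: (iffP flattenP) => [[_ /mapP[m mms ->] /mapP[a aA ->]]|[m mms [a aA ->]]].
  by exists m => //; exists a.
exists [seq rem a m.1 ++ m.2 | a <- m.1]; first exact: map_f.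
exact: map_f.
Qed.

Lemma step_exchange X ms : valid_moves X ms -> exchange X (step X ms) ms.
Proof.
case/and5P => ums wf /allP noB /allP oldP /andP[/allP newP /allP backP].
have usms : uniq (map swap ms) by rewrite uniq_swap.
split=> // f.
  move=> fX; split.
    move=> m mms; have /hasPn/(_ (swap m)) := noB f fX.
    by apply; exact: map_f.
  have [/hasP[m mms mf]|fno] := boolP (hit ms f); last first.
    left; split; last by rewrite mem_cat mem_filter fno fX orbT.
    by move=> m mms; move/hasPn: fno; apply.
  have fold : f \in [seq f <- X | hit ms f] by rewrite mem_filter fX andbT; apply/hasP; exists m.
  have /andP[cf /allP fAB] := oldP f fold.
  right; exists m; split=> //; first by have := fAB m mms; rewrite mf.
    by move=> m' m'ms m'f; exact: (count_le1 cf ums m'ms mms m'f mf).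
  move=> a aA.
  have Gnew : rem a m.1 ++ m.2 \in new_facets ms.
    by apply/new_facetsP; exists m => //; exists a.
  split.
    apply/hasP; exists (rem a m.1 ++ m.2); last exact/subP.
    by rewrite mem_cat Gnew.
  have /andP[_ cG] := newP _ Gnew.
  move=> m' m'ms m'G; apply: (can_inj swapK).
  apply: (count_le1 cG usms) => //; try exact: map_f.
  by apply/subP => x /= xB; rewrite mem_cat xB orbT.
rewrite mem_cat => /orP[/new_facetsP[m mms [a aA Ef]]|]; last first.
  rewrite mem_filter => /andP[fno fX]; split.
    by move=> _ /mapP[m mms ->]; move/hasPn: fno; apply.
  left; split=> // m' m'ms; move: (noB f fX) => /hasPn; exact.
have fnew : f \in new_facets ms by apply/new_facetsP; exists m => //; exists a.
have /andP[fno cf] := newP _ fnew.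
split.
  by move=> _ /mapP[m' mms' ->]; move/hasPn: fno; apply.
right; exists (swap m); split.
- exact: map_f.
- by rewrite Ef; apply/subP => x /= xB; rewrite mem_cat xB orbT.
- rewrite Ef; apply/subP => x /=; rewrite !mem_cat => /orP[/mem_rem ->|-> //].
  by rewrite orbT.
- move=> m' m'ms m'f; apply: (count_le1 cf) => //; first exact: map_f.
  by rewrite Ef; apply/subP => x /= xB; rewrite mem_cat xB orbT.
move=> b /= bB.
have /hasP[g gold gsub] := allP (backP m mms) b bB.
have /andP[cg _] := oldP _ gold; have /subP gs := gsub.
split; first by apply/hasP; exists g => //; move: gold; rewrite mem_filter => /andP[].
move=> _ /mapP[m' m'ms ->] /= /subP m'g; congr swap.
apply: (count_le1 cg) => //.
  by apply/subP => x /m'g /gs.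
by apply/subP => x xA; apply: gs; rewrite mem_cat xA orbT.
Qed.

End Geom.
(** Complexes with binary codes as vertices need [N] to be a choice type. *)
HB.instance Definition _ := CanIsCountable nat_of_binK.

(** * Relabelling and sequences of moves *)

Section Relabel.
Variables (R : realType) (T T' : choiceType).

(** Transport of coordinates along a relabelling [h] with inverse [g] on the
    relevant vertices; the labels outside the image of [h] get the coordinate 0. *)
Definition transport (U U' : choiceType) (h : U -> U') (g : U' -> U) (t : U -> R) : U' -> R :=
  fun y => if h (g y) == y then t (g y) else 0.

Lemma transport_continuous (U U' : choiceType) (h : U -> U') (g : U' -> U) :
  continuous (transport h g : {ptws U -> R} -> {ptws U' -> R}).
Proof.
apply: continuous_ptws => y; rewrite /transport; case: eqP => _.
  exact: continuous_coord.
exact: cont_cst.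
Qed.

Lemma transport_geom (U U' : choiceType) (h : U -> U') (g : U' -> U)
    (X : seq (seq U)) (t : {ptws U -> R}) :
  (forall f x, f \in X -> x \in f -> g (h x) = x) -> geom X t ->
  geom (map (map h) X) (transport h g t) /\ transport g h (transport h g t) = t.
Proof.
move=> gh [f fX [t0 tf t1]]; split; last first.
  apply: funext => x; rewrite /transport; case: eqP => [->|xn]; first by rewrite eqxx.
  by rewrite tf //; apply/negP => /(gh _ _ fX) /xn.
have hI : {in f &, injective h}.
  by move=> x y xf yf /(congr1 g); rewrite !(gh _ _ fX).
exists (map h f); first exact: map_f.
split.
- by move=> y; rewrite /transport; case: ifP.
- move=> y yf; rewrite /transport; case: eqP => // E; rewrite tf //.
  by apply: contra yf => gf; rewrite -E; exact: map_f.
- rewrite -t1 (@sum_supp _ _ _ (map h (undup f))); last 1 first.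
  + move=> y yf; rewrite /transport; case: eqP => // E; rewrite tf //.
    by apply: contra yf => gf; rewrite -E map_f // mem_undup.
  + rewrite big_map big_seq [RHS]big_seq; apply: eq_bigr => x.
    by rewrite mem_undup => xf; rewrite /transport (gh _ _ fX xf) eqxx.
  + exact: undup_uniq.
  + rewrite map_inj_in_uniq ?undup_uniq // => x y; rewrite !mem_undup; exact: hI.
  + move=> y yf; rewrite /transport; case: eqP => // E; rewrite tf //.
    by apply: contra yf => gf; rewrite mem_undup -E map_f.
Qed.

Lemma relabel_homeo (h : T -> T') (g : T' -> T) (X : seq (seq T)) :
  (forall f x, f \in X -> x \in f -> g (h x) = x) ->
  homeomorphic (@geom R T X) (@geom R T' (map (map h) X)).
Proof.
move=> gh.
have hg f y : f \in map (map h) X -> y \in f -> h (g y) = y.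
  by move=> /mapP[f' f'X ->] /mapP[x xf' ->]; rewrite (gh _ _ f'X).
have Xgh : map (map g) (map (map h) X) = X.
  rewrite -map_comp map_id_in // => f fX /=.
  by rewrite -map_comp map_id_in // => x xf /=; rewrite (gh _ _ fX).
apply: (@homeo_subsets {ptws T -> R} {ptws T' -> R} _ _ (transport h g) (transport g h)).
- exact: transport_continuous.
- exact: transport_continuous.
- by move=> t; exact: transport_geom.
- by move=> t Xt; have := transport_geom hg Xt; rewrite Xgh.
Qed.

End Relabel.

Section Run.
Variables (R : realType) (T : choiceType).
Implicit Types (X Y Z : seq (seq T)) (orb : seq T * seq T -> seq (seq T * seq T)).

(** The moves are performed in groups: [orb m] is the set of moves made
    simultaneously with [m], either [m] alone or its orbit under a symmetry. *)
Fixpoint run orb ms X :=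
  if ms is m :: ms' then
    if valid_moves X (orb m) then run orb ms' (step X (orb m)) else None
  else Some X.

Definition reduces orb ms X Y := if run orb ms X is Some X' then same X' Y else false.

Lemma reduces_homeo orb ms X Y : reduces orb ms X Y ->
  homeomorphic (@geom R T X) (@geom R T Y).
Proof.
elim: ms X => [|m ms IH] X /=; rewrite /reduces /=.
  by move=> /same_geom ->; exact: homeo_refl.
by case: ifP => // vX /IH; apply: homeo_trans; exact: exchange_homeo (step_exchange vX).
Qed.

Definition single_move (m : seq T * seq T) := [:: m].

Definition avoids (ms : seq (seq T * seq T)) Z :=
  all (fun f => all (fun m => ~~ sub m.1 f && ~~ sub m.2 f) ms) Z.

Lemma step_cat X Z m : avoids [:: m] Z -> step (X ++ Z) (single_move m) = step X (single_move m) ++ Z.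
Proof.
move=> /allP mZ; rewrite /step filter_cat -catA; congr (_ ++ (_ ++ _)).
apply/all_filterP/allP => f fZ; rewrite /hit /= orbF.
by have := mZ f fZ; rewrite /= andbT => /andP[].
Qed.

Lemma valid_cat X Z m : avoids [:: m] Z -> valid_moves X (single_move m) -> valid_moves (X ++ Z) (single_move m).
Proof.
move=> /allP mZ /and5P[a b c d e].
have oldZ : [seq f <- X ++ Z | hit (single_move m) f] = [seq f <- X | hit (single_move m) f].
  rewrite filter_cat (_ : [seq f <- Z | _] = [::]) ?cats0 //.
  apply/eqP; rewrite -[_ == _]negbK -has_filter; apply/hasPn => f fZ.
  by rewrite /hit /= orbF; have := mZ f fZ; rewrite /= andbT => /andP[].
rewrite /valid_moves oldZ a b d e all_cat c /= andbT.
apply/allP => f fZ; rewrite /hit /= orbF.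
by have := mZ f fZ; rewrite /= andbT => /andP[].
Qed.

(** The validity and the effect of a move only involve the facets that contain
    one of its sides, so facets without such faces may be added. *)
Lemma reduces_cat ms X Y Z : avoids ms Z -> reduces single_move ms X Y -> reduces single_move ms (X ++ Z) (Y ++ Z).
Proof.
rewrite /reduces; elim: ms X => [|m ms IH] X /= av.
  move=> /andP[/allP a /allP b]; rewrite /same !all_cat; apply/andP; split; apply/andP; split;
  apply/allP => f fX; rewrite has_cat ?(a _ fX) ?(b _ fX) // orbC.
    by apply/orP; left; apply/hasP; exists f => //; apply/subP.
  by apply/orP; left; apply/hasP; exists f => //; apply/subP.
have av1 : avoids [:: m] Z by apply: sub_all av => f /= /andP[-> _].
have av2 : avoids ms Z by apply: sub_all av => f /= /andP[].
case: ifP => // vX; rewrite valid_cat // step_cat //; exact: IH.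
Qed.

End Run.

(** * Rotation of the sheets of a cyclic covering *)

(** In a [p]-fold cyclic covering, [p * v + k] is the code of the vertex over [v]
    on the sheet [k]; [spin p i] adds [i] to the sheet modulo [p]. *)
Definition spin (p i : nat) (c : N) : N :=
  (c / N.of_nat p * N.of_nat p + (c + N.of_nat i) mod N.of_nat p)%num.

Definition spin_orbit (p : nat) (m : seq N * seq N) :=
  [seq (map (spin p i) m.1, map (spin p i) m.2) | i <- iota 0 p].

Section Rot.
Variable p : nat.
Hypothesis p0 : (0 < p)%N.
Let P := N.of_nat p.

Let P0 : P <> 0%num.
Proof. by rewrite /P; case: p p0. Qed.

Lemma spin_div i c : (spin p i c / P = c / P)%num.
Proof.
rewrite /spin -/P N.div_add_l // (N.div_small (_ mod _)) ?N.add_0_r //.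
exact: N.mod_lt.
Qed.

Lemma spin_mod i c : (spin p i c mod P = (c + N.of_nat i) mod P)%num.
Proof.
by rewrite /spin -/P N.add_comm N.Div0.mod_add N.Div0.mod_mod.
Qed.

Lemma divmod_eq c d : (c / P = d / P -> c mod P = d mod P -> c = d)%num.
Proof.
by move=> e1 e2; rewrite (N.div_mod c P) // (N.div_mod d P) // e1 e2.
Qed.

Lemma spin_rot i j c : spin p i (spin p j c) = spin p (i + j) c.
Proof.
apply: divmod_eq; rewrite ?spin_div // !spin_mod.
rewrite N.Div0.add_mod spin_mod -N.Div0.add_mod Nnat.Nat2N.inj_add.
by rewrite -N.add_assoc [(N.of_nat j + _)%num]N.add_comm.
Qed.

Lemma spin_modn i : spin p (i %% p) =1 spin p i.
Proof.
move=> c; apply: divmod_eq; rewrite ?spin_div // !spin_mod.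
rewrite {2}(divn_eq i p) -(multE) -plusE Nnat.Nat2N.inj_add Nnat.Nat2N.inj_mul -/P.
by rewrite [(N.of_nat (i %/ p) * P + _)%num]N.add_comm N.add_assoc N.Div0.mod_add.
Qed.

Lemma spin0 : spin p 0 =1 id.
Proof.
move=> c; apply: divmod_eq; first exact: spin_div.
by rewrite spin_mod N.add_0_r.
Qed.

Lemma spin_inj i : injective (spin p i).
Proof.
apply: (can_inj (g := spin p (i * p.-1))) => c; rewrite spin_rot -spin_modn.
by rewrite addnC -mulnS prednK // modnMl spin0.
Qed.

Lemma perm_spin_orbit i m :
  perm_eq [seq (map (spin p i) x.1, map (spin p i) x.2) | x <- spin_orbit p m] (spin_orbit p m).
Proof.
rewrite /spin_orbit -map_comp.
have -> : [seq ((fun x => (map (spin p i) x.1, map (spin p i) x.2)) \o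
    (fun i => (map (spin p i) m.1, map (spin p i) m.2))) j | j <- iota 0 p] =
    [seq (map (spin p j) m.1, map (spin p j) m.2) | j <- [seq ((i + j) %% p)%N | j <- iota 0 p]].
  rewrite -map_comp; apply: eq_map => j /=; rewrite -!map_comp.
  by congr pair; apply: eq_map => c /=; rewrite spin_rot spin_modn.
have U : uniq [seq ((i + j) %% p)%N | j <- iota 0 p].
  rewrite map_inj_in_uniq ?iota_uniq // => j k; rewrite !mem_iota /= add0n => jp kp /eqP.
  by rewrite eqn_modDl !modn_small // => /eqP.
have S : {subset [seq ((i + j) %% p)%N | j <- iota 0 p] <= iota 0 p}.
  by move=> _ /mapP[j _ ->]; rewrite mem_iota /= add0n ltn_mod.
apply: perm_map; apply: uniq_perm; rewrite ?iota_uniq //.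
by have [|_] := uniq_min_size U S; rewrite ?size_map.
Qed.

End Rot.

(** * Equivariant parametrizations and quotients *)

Section Param.
Variables (R : realType) (S : topologicalType).

(** For a compact [S] this amounts to a homeomorphism, but it is given by explicit
    global formulas, which compose with the pushes. *)
Definition param (T : choiceType) (X : seq (seq T)) (h : S -> {ptws T -> R}) :=
  [/\ continuous h, injective h, forall z, geom X (h z) &
      forall t, geom X t -> exists z, h z = t].

Lemma param_homeo (T : choiceType) (X : seq (seq T)) h :
  compact [set: S] -> param X h -> homeomorphic (@geom R T X) S.
Proof.
move=> cS [ch hI hX hS].
have hP z : h z \in geom X by exact/mem_set.
apply: (@compact_bij_homeo _ _ (fun z => SigSub (hP z) : geom X)) => //.
- exact: (hausdorff_injective (@hausdorff_ptws R T) (@continuous_val _ (geom X)) val_inj).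
- exact: continuous_to_subtype.
- by move=> z z' /(congr1 val) /= /hI.
- move=> y; have [z zy] := hS _ (set_valP y); exists z.
  exact: val_inj.
Qed.

(** A symmetry permuting the moves commutes with their simultaneous push. *)
Lemma push_comp (T : choiceType) (s : T -> T) ms (t : T -> R) : injective s ->
  perm_eq [seq (map s m.1, map s m.2) | m <- ms] ms ->
  push ms (t \o s) = push ms t \o s.
Proof.
move=> sI pms; apply: funext => x; rewrite /push /=; congr (_ + _).
rewrite -[RHS](perm_big _ pms) /= big_map; apply: eq_bigr => m _.
rewrite /flow /= !size_map !(mem_map sI); congr (_ * _).
case: m.1 => //= a A; elim: A => //= b A ->.
by rewrite /= .
Qed.

Lemma exchange_param (T : choiceType) (X X' : seq (seq T)) ms h :
  exchange X X' ms -> param X' h -> param X (push (map (@swap T) ms) \o h).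
Proof.
move=> ex [ch hI hX hS].
have K t : geom X' t -> push ms (push (map (@swap T) ms) t) = t.
  by move=> /(exchange_push (exchange_sym ex))[_]; rewrite map_swapK.
split.
- move=> z; apply: (@continuous_comp S {ptws T -> R} {ptws T -> R} h (push (map (@swap T) ms))).
    exact: ch.
  exact: push_continuous.
- by move=> z z' /= /(congr1 (push ms)); rewrite !K // => /hI.
- by move=> z /=; case: (exchange_push (exchange_sym ex) (hX z)).
- move=> t Xt; have [X't E] := exchange_push ex Xt.
  by have [z zt] := hS _ X't; exists z; rewrite /= zt.
Qed.

(** The relation between points of [S] that [s] induces through the coordinates
    is the same for [h] and [h']. This avoids naming the action on [S]. *)
Definition covariant (T : choiceType) (s : T -> T) (h h' : S -> {ptws T -> R}) :=
  forall z z', h z' = h z \o s <-> h' z' = h' z \o s.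

Lemma exchange_covariant (T : choiceType) (X X' : seq (seq T)) ms h s :
  injective s -> perm_eq [seq (map s m.1, map s m.2) | m <- ms] ms ->
  exchange X X' ms -> param X' h -> covariant s h (push (map (@swap T) ms) \o h).
Proof.
move=> sI pms ex [_ _ hX _] z z'.
have pms' : perm_eq [seq (map s m.1, map s m.2) | m <- map (@swap T) ms] (map (@swap T) ms).
  by rewrite -map_comp; move/(perm_map (@swap T)): pms; rewrite -map_comp.
have K t : geom X' t -> push ms (push (map (@swap T) ms) t) = t.
  by move=> /(exchange_push (exchange_sym ex))[_]; rewrite map_swapK.
split=> /= [->|/(congr1 (push ms))]; first by rewrite push_comp.
by rewrite (push_comp _ sI pms) !K // => ->.
Qed.

(** A parametrization of the end of a sequence of equivariant moves is carried back
    to its beginning, together with the action of the rotation. *)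
Lemma reduces_param p ms X Y (h : S -> {ptws N -> R}) : (0 < p)%N ->
  reduces (spin_orbit p) ms X Y -> param Y h ->
  exists2 h', param X h' & forall i, covariant (spin p i) h h'.
Proof.
move=> p0; elim: ms X => [|m ms IH] X; rewrite /reduces /=.
  move=> /(same_geom R) XY hY; exists h => //.
  by rewrite /param XY.
case: ifP => // vX r /(IH _ r)[h' h'X cov].
have ex := step_exchange vX.
exists (push (map (@swap N) (spin_orbit p m)) \o h'); first exact: exchange_param ex h'X.
move=> i z z'; rewrite cov.
apply: (exchange_covariant _ _ ex h'X); first exact: spin_inj.
exact: perm_spin_orbit.
Qed.

(** [L] lists one facet from each orbit of facets of the covering complex;
    [spin_base p L] is the complex of the images of these facets. *)
Definition spin_cover (p : nat) (L : seq (seq N)) :=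
  flatten [seq [seq map (spin p i) f | i <- iota 0 p] | f <- L].

Definition spin_base (p : nat) (L : seq (seq N)) :=
  [seq [seq (c / N.of_nat p)%num | c <- f] | f <- L].

(** Facets embed into the base, and any two facets agree, up to one common
    rotation, over all the vertices that their images share. By the second
    condition, points with the same projection to the base are in one orbit. *)
Definition covering (p : nat) (L : seq (seq N)) :=
  all (fun f => uniq [seq (c / N.of_nat p)%num | c <- f]) L &&
  let L' := [seq [seq ((c / N.of_nat p)%num, c) | c <- f] | f <- L] in
  all (fun f => all (fun f' => has (fun i =>
    all (fun x => all (fun y => (x.1 == y.1) ==> (y.2 == spin p i x.2)) f') f)
    (iota 0 p)) L') L'.

(** The simplicial projection of the covering, in barycentric coordinates. *)
Definition fold_fiber (p : nat) (t : N -> R) : N -> R := fun v =>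
  \sum_(k <- iota 0 p) t (N.of_nat p * v + N.of_nat k)%num.

Lemma fold_fiber_continuous p :
  continuous (fold_fiber p : {ptws N -> R} -> {ptws N -> R}).
Proof.
apply: continuous_ptws => v; apply: cont_sum => k; exact: continuous_coord.
Qed.

Section Descent.
Local Open Scope quotient_scope.
Variables (p : nat) (L : seq (seq N)).
Hypotheses (p0 : (0 < p)%N) (Lcov : covering p L).
Let P := N.of_nat p.
Implicit Types (f : seq N) (t : N -> R) (c x y v : N).

Let P0 : P <> 0%num.
Proof. by rewrite /P; case: p p0. Qed.

Let fiberP c v : (c / P = v)%num -> exists2 k, (k < p)%N & c = (P * v + N.of_nat k)%num.
Proof.
move=> <-; exists (N.to_nat (c mod P)%num).
  apply/ssrnat.ltP; have := N.mod_lt c P P0; rewrite /P; lia.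
by rewrite Nnat.N2Nat.id -N.div_mod.
Qed.

Let fiber_div v k : (k < p)%N -> ((P * v + N.of_nat k) / P = v)%num.
Proof.
move=> /ssrnat.ltP kp; rewrite N.mul_comm N.div_add_l // N.div_small ?N.add_0_r //.
rewrite /P; lia.
Qed.

Lemma fold_fiber_in f t x : uniq [seq (c / P)%num | c <- f] ->
  (forall y, y \notin f -> t y = 0) -> x \in f -> fold_fiber p t (x / P)%num = t x.
Proof.
move=> uf tf xf; have [k kp xk] := fiberP (erefl (x / P)%num).
rewrite /fold_fiber -/P (@big_only _ _ _ k) ?iota_uniq ?mem_iota ?add0n // -?xk // => j.
rewrite mem_iota add0n => /= jp jk; apply: tf; apply: contra jk => yf.
have e := fiber_div (x / P)%num jp; move: yf; set y := (P * _ + _)%num => yf.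
have : y = x.
  have := uniqP 0%num uf; set n := size f => I.
  have := I (index y f) (index x f); rewrite !inE size_map !index_mem => /(_ yf xf).
  rewrite !(nth_map 0%num) ?index_mem // !nth_index // e => /(_ erefl) E.
  by rewrite -(nth_index 0%num yf) E nth_index.
rewrite {1}xk /y => /N.add_cancel_l /Nnat.Nat2N.inj ->.
exact: eqxx.
Qed.

Lemma fold_fiber_out f t v : (forall y, y \notin f -> t y = 0) ->
  v \notin [seq (c / P)%num | c <- f] -> fold_fiber p t v = 0.
Proof.
move=> tf vf; rewrite /fold_fiber big_seq big1 // => k; rewrite mem_iota add0n => /= kp.
apply: tf; apply: contra vf => yf; apply/mapP.
by exists (N.of_nat p * v + N.of_nat k)%num => //; rewrite fiber_div.
Qed.

Lemma fold_fiber_ge0 t v : (forall x, 0 <= t x) -> 0 <= fold_fiber p t v.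
Proof. by move=> t0; apply: sumr_ge0. Qed.

Lemma fold_fiber_simplex f t : uniq [seq (c / P)%num | c <- f] ->
  in_simplex f t -> in_simplex [seq (c / P)%num | c <- f] (fold_fiber p t).
Proof.
move=> uf [t0 tf t1]; split.
- by move=> v; exact: fold_fiber_ge0.
- by move=> v; exact: fold_fiber_out.
rewrite undup_id // big_map -t1 undup_id; last exact: map_uniq uf.
by rewrite big_seq [RHS]big_seq; apply: eq_bigr => x xf; exact: (fold_fiber_in uf tf xf).
Qed.

Lemma spin_coverP g : reflect
  (exists2 f, f \in L & exists2 i, (i < p)%N & g = map (spin p i) f) (g \in spin_cover p L).
Proof.
apply: (iffP flattenP) => [[_ /mapP[f fL ->] /mapP[i ip ->]]|[f fL [i ip ->]]].
  by exists f => //; exists i => //; move: ip; rewrite mem_iota add0n.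
exists [seq map (spin p j) f | j <- iota 0 p].
  by apply/mapP; exists f.
by apply/mapP; exists i; rewrite // mem_iota add0n.
Qed.

Let div_spin i f : [seq (c / P)%num | c <- map (spin p i) f] = [seq (c / P)%num | c <- f].
Proof. by rewrite -map_comp; apply: eq_map => c /=; exact: spin_div. Qed.

Lemma covering_uniq f : f \in L -> uniq [seq (c / P)%num | c <- f].
Proof. by case/andP: Lcov => /allP uL _ /uL. Qed.

Let cover_uniq g : g \in spin_cover p L -> uniq [seq (c / P)%num | c <- g].
Proof. by move=> /spin_coverP[f fL [j _ ->]]; rewrite div_spin; exact: covering_uniq. Qed.

Lemma covering_spin g g' : g \in spin_cover p L -> g' \in spin_cover p L ->
  exists2 i, (i < p)%N & forall x y, x \in g -> y \in g' -> (x / P = y / P)%num ->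
    y = spin p i x.
Proof.
move=> /spin_coverP[f fL [j jp ->]] /spin_coverP[f' f'L [k kp ->]].
case/andP: Lcov => _ /allP/(_ _ (map_f _ fL))/allP/(_ _ (map_f _ f'L))/hasP[i _ /allP H].
exists ((k + (i + (p - j))) %% p)%N; first by rewrite ltn_mod.
move=> _ _ /mapP[x xf ->] /mapP[y yf' ->]; rewrite !spin_div // => xy.
have /allP/(_ _ (map_f _ yf')) := H _ (map_f (fun c => ((c / N.of_nat p)%num, c)) xf).
rewrite /= xy eqxx /= => /eqP ->.
rewrite spin_modn // !spin_rot // -[RHS]spin_modn // -addnA.
have -> : (i + (p - j) + j = i + p)%N by rewrite -addnA subnK // ltnW.
by rewrite addnA modnDr spin_modn.
Qed.

Variables (e : equiv_rel S) (h : S -> {ptws N -> R}).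
Hypotheses (cS : compact [set: S]) (hL : param (spin_cover p L) h).
Hypothesis eP : forall z z', e z z' <-> exists i, h z' = h z \o spin p i.

(** If two points have the same projection, a rotation matching their facets over
    the support of the projection carries one to the other. *)
Let fold_eq z z' : e z z' <-> fold_fiber p (h z) = fold_fiber p (h z').
Proof.
have [_ _ hX _] := hL.
rewrite eP; split=> [[i ->]|E].
  apply: funext => v.
  have [g gL [t0 tg _]] := hX z; have ug := cover_uniq gL.
  pose si := spin p (i * p.-1).
  have siK : cancel si (spin p i).
    move=> c; rewrite /si spin_rot // -spin_modn //.
    by rewrite -mulnS prednK // modnMl spin0.
  have iK : cancel (spin p i) si by move=> c; apply: (spin_inj p0 (i := i)); rewrite siK.
  have sg y : y \notin map si g -> (h z \o spin p i) y = 0.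
    move=> yg; apply: tg; apply: contra yg => yg; apply/mapP.
    by exists (spin p i y) => //; rewrite iK.
  have [/mapP[x xg ->]|vg] := boolP (v \in [seq (c / P)%num | c <- g]).
    rewrite (fold_fiber_in ug) // -(@spin_div p p0 (i * p.-1) x) -/P.
    rewrite (@fold_fiber_in (map si g)) //=; first by rewrite siK.
      by rewrite div_spin.
    exact: map_f.
  by rewrite (fold_fiber_out tg vg) (fold_fiber_out sg) // div_spin.
have [g gL [t0 tg _]] := hX z; have [g' gL' [t0' tg' _]] := hX z'.
have ug := cover_uniq gL; have ug' := cover_uniq gL'.
have [i ip gg'] := covering_spin gL' gL.
exists i; apply: funext => y /=.
have [yg'|yg'] := boolP (y \in g').
  rewrite -(fold_fiber_in ug' tg' yg') -E.
  have [/mapP[x xg yx]|yg] := boolP ((y / P)%num \in [seq (c / P)%num | c <- g]).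
    by rewrite yx (fold_fiber_in ug) // (gg' y x).
  rewrite (fold_fiber_out tg yg) tg //; apply: contra yg => yg.
  by rewrite -(@spin_div p p0 i y); exact: map_f.
rewrite tg' //; have [yg|yg] := boolP (spin p i y \in g); last by rewrite tg.
rewrite -(fold_fiber_in ug tg yg) E spin_div //.
have [/mapP[x xg' yx]|xg'] := boolP ((y / P)%num \in [seq (c / P)%num | c <- g']).
  have E' : spin p i y = spin p i x by apply: gg' => //; rewrite -yx spin_div.
  by move: yg'; rewrite (spin_inj p0 E') xg'.
by rewrite (fold_fiber_out tg' xg').
Qed.

(** The projection of the covering, composed with [h], is constant exactly on the
    classes of [e], and the quotient of [S] is compact. *)
Lemma quotient_homeo :
  homeomorphic (@geom R N (spin_base p L)) (quotient_topology {eq_quot e}%qT).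
Proof.
have [ch hI hX hS] := hL.
pose F z : {ptws N -> R} := fold_fiber p (h z).
have Fgeom z : geom (spin_base p L) (F z).
  have [g gL gt] := hX z; have [f fL [j jp gE]] := spin_coverP _ gL.
  exists [seq (c / P)%num | c <- f]; first exact: map_f.
  by rewrite -(div_spin j f) -gE; apply: fold_fiber_simplex => //; exact: cover_uniq.
have cF : continuous F.
  move=> z; apply: (@continuous_comp S {ptws N -> R} {ptws N -> R} h (fold_fiber p)); first exact: ch.
  exact: fold_fiber_continuous.
pose Q : topologicalType := quotient_topology {eq_quot e}%qT.
have piE z z' : \pi_({eq_quot e}%qT) z = \pi_({eq_quot e}%qT) z' <-> F z = F z'.
  by rewrite -fold_eq; split=> [/eqmodP//|zz']; apply/eqmodP.
have Frepr z : F (repr (\pi_({eq_quot e}%qT) z)) = F z.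
  by apply/piE; rewrite reprK.
have gP (q : Q) : F (repr q) \in geom (spin_base p L) by exact/mem_set.
apply: (@compact_bij_homeo Q _ (fun q => SigSub (gP q) : geom (spin_base p L))).
- apply: (@compact_image_space S Q (\pi_({eq_quot e}%qT))) => //.
    exact: pi_continuous.
  by move=> q; exists (repr q); rewrite reprK.
- exact: (hausdorff_injective (@hausdorff_ptws R N) (@continuous_val _ (geom (spin_base p L))) val_inj).
- apply: continuous_to_subtype.
  apply: (@repr_comp_continuous S {eq_quot e}%qT {ptws N -> R} F cF) => z z' /eqP zz'.
  exact/eqP/piE.
- move=> q q' /(congr1 val) /= /piE; by rewrite !reprK.
- move=> y; have [_ /mapP[f fL ->] [t0 tf t1]] := set_valP y.
  have uf := covering_uniq fL.
  pose t c := if c \in f then val y (c / P)%num else 0.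
  have t_simp : in_simplex f t.
    split; first by move=> c; rewrite /t; case: ifP.
      by move=> c /negPf cf; rewrite /t cf.
    rewrite -t1 undup_id ?(map_uniq uf) // (undup_id uf) big_map.
    by rewrite big_seq [RHS]big_seq; apply: eq_bigr => c cf; rewrite /t cf.
  have [z zt] : exists z, h z = t.
    apply: hS; exists f => //; apply/spin_coverP; exists f => //; exists 0%N => //.
    by rewrite map_id_in // => c _; rewrite spin0.
  exists (\pi_({eq_quot e}%qT) z); apply: val_inj => /=; rewrite Frepr /F zt.
  apply: funext => v; have [_ tf' _] := t_simp.
  have [/mapP[c cf ->]|vf] := boolP (v \in [seq (c / P)%num | c <- f]).
    by rewrite (fold_fiber_in uf) // /t cf.
  by rewrite (fold_fiber_out tf' vf) tf.
Qed.

End Descent.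

End Param.

(** * Joins of boundaries of simplices *)

Section Join.
Variables (T : choiceType).

(** The join of the boundaries of the simplices in [bs]. *)
Fixpoint join (bs : seq (seq T)) : seq (seq T) :=
  if bs is b :: bs' then [seq rem x b ++ f | x <- b, f <- join bs'] else [:: [::]].

Lemma join_sub bs f : f \in join bs -> {subset f <= flatten bs}.
Proof.
elim: bs f => [|b bs IH] f /=; first by rewrite inE => /eqP ->.
move=> /allpairsP[[x g] /= [xb gbs ->]] y; rewrite !mem_cat => /orP[/mem_rem ->//|].
by move/(IH _ gbs) ->; rewrite orbT.
Qed.

Lemma join_miss bs f b : uniq (flatten bs) -> f \in join bs -> b \in bs ->
  exists2 x, x \in b & x \notin f.
Proof.
elim: bs f => // b' bs IH f /=; rewrite cat_uniq => /and3P[ub' /hasPn dis ubs].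
move=> /allpairsP[[x g] /= [xb gbs ->]]; rewrite inE => /orP[/eqP ->|bbs].
  exists x => //; rewrite mem_cat mem_rem_uniq // inE eqxx /=.
  by apply: contraL xb => /(join_sub gbs) /dis.
have [y yb yg] := IH _ ubs gbs bbs; exists y => //.
rewrite mem_cat negb_or yg andbT.
have /dis yb' : y \in flatten bs by apply/flattenP; exists b.
by apply: contra yb' => /mem_rem.
Qed.

Lemma join_support (R : realType) bs (t : T -> R) : uniq (flatten bs) ->
  (forall b, b \in bs -> exists2 x, x \in b & t x = 0) ->
  exists2 f, f \in join bs & forall x, x \in flatten bs -> x \notin f -> t x = 0.
Proof.
elim: bs => [|b bs IH] /=; first by exists [::].
rewrite cat_uniq => /and3P[ub _ ubs] H.
have [x xb tx] := H b (mem_head _ _).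
have [|g gbs tg] := IH ubs; first by move=> b' b'bs; apply: H; rewrite inE b'bs orbT.
exists (rem x b ++ g); first by apply/allpairsP; exists (x, g).
move=> y; rewrite !mem_cat negb_or => ybs /andP[yx yg].
have [->//|yNx] := eqVneq y x.
move: yx; rewrite mem_rem_uniq // inE yNx /= => yb.
by apply: tg => //; move: ybs; rewrite (negPf yb).
Qed.

End Join.

Section JoinParam.
Variables (R : realType) (T : choiceType) (S : topologicalType).
Variables (bs : seq (seq T)) (c : S -> T -> R).
Hypothesis ubs : uniq (flatten bs).
Implicit Types (y t : T -> R).

(** The functions on the vertices modulo the span of the indicators of the blocks
    form a vector space in which the join is the boundary of a star-shaped
    neighbourhood of 0: each class has a unique representative that is nonnegative
    and vanishes somewhere on each block, namely [reduced]. The class of [y] is 0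
    when [block_const y]. *)
Definition block_const y := forall b u v, b \in bs -> u \in b -> v \in b -> y u = y v.

(** The class of [y] is [r] times the class of [y']. *)
Definition block_prop (r : R) y y' :=
  forall b u v, b \in bs -> u \in b -> v \in b -> y u - y v = r * (y' u - y' v).

Definition reduced y : T -> R := fun x => \sum_(b <- bs) (x \in b)%:R * (y x - minl y b).

Let ubs1 : uniq [seq b <- bs | b != [::]].
Proof.
move: ubs; elim: bs => //= b l IH; rewrite cat_uniq => /and3P[ub dis ul].
case: ifP => //= b0; last exact: IH.
rewrite IH // andbT mem_filter b0 /=; apply: contra dis => bl.
have /hasP[x xb _] : has predT b by case: b b0 {ub bl}.
by apply/hasP; exists x => //; apply/flattenP; exists b.
Qed.

Let block_uniq b b' x : b \in bs -> b' \in bs -> x \in b -> x \in b' -> b = b'.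
Proof.
move: ubs; elim: bs => //= d l IH; rewrite cat_uniq !inE => /and3P[_ /hasPn dis ul].
have E b1 b2 : b1 \in l -> x \in b1 -> x \in d -> b1 = b2.
  move=> b1l xb1 xd; have /dis : x \in flatten l by apply/flattenP; exists b1.
  by rewrite /= xd.
case/orP=> [/eqP ->|bl]; case/orP=> [/eqP ->|b'l] // xb xb'; last exact: IH.
  by apply/esym; exact: E b'l xb' xb.
exact: E bl xb xb'.
Qed.

Lemma reducedE y b x : b \in bs -> x \in b -> reduced y x = y x - minl y b.
Proof.
move=> bbs xb; rewrite /reduced.
have -> : \sum_(b <- bs) (x \in b)%:R * (y x - minl y b) =
    \sum_(b <- [seq b <- bs | b != [::]]) (x \in b)%:R * (y x - minl y b).
  rewrite big_filter [RHS]big_mkcond /=; apply: eq_bigr => d _.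
  by case: eqP => // ->; rewrite in_nil mul0r.
rewrite (@big_only _ _ _ b) //; first by rewrite xb mul1r.
  by rewrite mem_filter bbs andbT; case: b xb {bbs}.
move=> d; rewrite mem_filter => /andP[_ dbs] db.
case: (boolP (x \in d)) => [xd|_]; last by rewrite mul0r.
by rewrite (block_uniq dbs bbs xd xb) eqxx in db.
Qed.

Lemma reduced_out y x : x \notin flatten bs -> reduced y x = 0.
Proof.
move=> xbs; rewrite /reduced big_seq big1 // => b bbs.
case: (boolP (x \in b)) => [xb|_]; last by rewrite mul0r.
by case/negP: xbs; apply/flattenP; exists b.
Qed.

Lemma reduced_ge0 y x : 0 <= reduced y x.
Proof.
have [/flattenP[b bbs xb]|xbs] := boolP (x \in flatten bs); last by rewrite reduced_out.
by rewrite (reducedE _ bbs xb) subr_ge0; exact: minl_le.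
Qed.

Lemma reduced_zero y b : b \in bs -> b != [::] -> exists2 x, x \in b & reduced y x = 0.
Proof.
move=> bbs b0; have [x xb E] := minl_attained y b0.
by exists x => //; rewrite (reducedE _ bbs xb) E subrr.
Qed.

Lemma reduced_diff y b u v : b \in bs -> u \in b -> v \in b ->
  reduced y u - reduced y v = y u - y v.
Proof. by move=> bbs ub vb; rewrite !(reducedE y bbs) //; ring. Qed.

Lemma reduced_prop r y y' : 0 <= r -> block_prop r y y' ->
  reduced y = fun x => r * reduced y' x.
Proof.
move=> r0 yy'; apply: funext => x.
have [/flattenP[b bbs xb]|xbs] := boolP (x \in flatten bs); last first.
  by rewrite !reduced_out // mulr0.
rewrite !(reducedE _ bbs xb).
have b0 : b != [::] by case: b xb {bbs}.
have [a ab ya] := minl_attained y b0; have [a' a'b ya'] := minl_attained y' b0.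
apply/eqP; rewrite eq_le ya ya'; apply/andP; split.
  rewrite (yy' b) // ler_wpM2l // lerD2l lerN2 -ya'; exact: minl_le.
rewrite -(yy' b) // lerD2l lerN2 -ya; exact: minl_le.
Qed.

Lemma reduced_id t : (forall x, 0 <= t x) -> (forall x, x \notin flatten bs -> t x = 0) ->
  (forall b, b \in bs -> exists2 x, x \in b & t x = 0) -> reduced t = t.
Proof.
move=> t0 tV tb; apply: funext => x.
have [/flattenP[b bbs xb]|xbs] := boolP (x \in flatten bs); last by rewrite reduced_out // tV.
have [a ab ta] := tb b bbs; rewrite (reducedE _ bbs xb).
have -> : minl t b = 0; last by rewrite subr0.
by apply/eqP; rewrite eq_le minl_ge0 // andbT -ta; exact: minl_le.
Qed.

Definition total y := \sum_(x <- flatten bs) reduced y x.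

Lemma total_eq0 y : total y = 0 -> block_const y.
Proof.
move=> /eqP; rewrite psumr_eq0; last by move=> x _; exact: reduced_ge0.
move=> /allP z b u v bbs ub vb.
have zb x : x \in b -> reduced y x = 0.
  by move=> xb; apply/eqP; apply: z; apply/flattenP; exists b.
by apply/eqP; rewrite -subr_eq0 -(reduced_diff y bbs ub vb) !zb // subrr.
Qed.

Lemma total_ge0 y : 0 <= total y.
Proof. by apply: sumr_ge0 => x _; exact: reduced_ge0. Qed.

Hypothesis bs0 : all (fun b => b != [::]) bs.
Hypothesis c_cont : forall x, continuous (fun z => c z x).
Hypothesis c_nonconst : forall z, ~ block_const (c z).
Hypothesis c_inj : forall z z' r, 0 < r -> block_prop r (c z) (c z') -> z = z'.
Hypothesis c_surj : forall y, ~ block_const y -> exists z, exists2 r, 0 < r & block_prop r (c z) y.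

Definition join_map (z : S) : {ptws T -> R} := fun x => reduced (c z) x / total (c z).

Let tot0 z : 0 < total (c z).
Proof.
rewrite lt_def total_ge0 andbT; apply/eqP => /total_eq0; exact: c_nonconst.
Qed.

(** If [c] maps [S] bijectively to the rays of the space of classes, rescaling the
    reduced representatives to mass 1 maps [S] bijectively to the join. *)
Lemma join_param : param (join bs) join_map.
Proof.
have cc : continuous (c : S -> {ptws T -> R}) by exact: continuous_ptws.
have cm b : continuous (fun z => minl (c z) b).
  move=> z; exact: (@continuous_comp S {ptws T -> R} R c (fun t => minl t b) z
    (cc z) (@minl_continuous R T b (c z))).
have cred x : continuous (fun z => reduced (c z) x).
  apply: cont_sum => b; apply: cont_mul; first exact: cont_cst.
  by apply: cont_add => //; apply: cont_opp.
split.
- apply: continuous_ptws => x; apply: cont_mul => //.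
  apply: cont_inv; first by move=> z; rewrite gt_eqF.
  exact: cont_sum.
- move=> z z' E; apply: (@c_inj _ _ (total (c z) / total (c z'))); first exact: divr_gt0.
  move=> b u v bbs ub vb; rewrite -(reduced_diff (c z) bbs ub vb) -(reduced_diff (c z') bbs ub vb).
  have Ex x : reduced (c z) x = total (c z) / total (c z') * reduced (c z') x.
    have := congr1 (fun t : T -> R => t x) E; rewrite /join_map => Ex.
    by rewrite mulrAC -mulrA -Ex [RHS]mulrC divfK // gt_eqF.
  by rewrite !Ex mulrBr.
- move=> z.
  have h0 x : 0 <= join_map z x by apply: divr_ge0; [exact: reduced_ge0|exact: ltW].
  have hV x : x \notin flatten bs -> join_map z x = 0.
    by move=> xV; rewrite /join_map reduced_out // mul0r.
  have [|f fbs hf] := @join_support _ _ bs (join_map z) ubs.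
    move=> b bbs; have [x xb E] := reduced_zero (c z) bbs (allP bs0 b bbs).
    by exists x => //; rewrite /join_map E mul0r.
  exists f => //; split=> //.
    move=> x xf; have [xV|xV] := boolP (x \in flatten bs); [exact: hf|exact: hV].
  rewrite (@in_simplexP _ _ f (flatten bs)) //.
  + by rewrite /join_map -mulr_suml -/(total (c z)) divff // gt_eqF.
  + exact: join_sub.
  + by move=> x xf; have [xV|xV] := boolP (x \in flatten bs); [exact: hf|exact: hV].
- move=> t [f fbs [t0 tf t1]].
  have tV x : x \notin flatten bs -> t x = 0.
    by move=> xV; apply: tf; apply: contra xV; exact: join_sub.
  have tb b : b \in bs -> exists2 x, x \in b & t x = 0.
    by move=> bbs; have [x xb xf] := join_miss ubs fbs bbs; exists x => //; exact: tf.
  have tr := reduced_id t0 tV tb.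
  have t1V : total t = 1.
    by rewrite /total tr -t1; apply/esym/in_simplexP => //; exact: join_sub.
  have [|z [r r0 zt]] := c_surj (y := t).
    move=> tc; suff : total t = 0 by rewrite t1V => /eqP; rewrite oner_eq0.
    rewrite /total tr big_seq big1 // => x /flattenP[b bbs xb].
    by have [a ab <-] := tb b bbs; exact: tc bbs xb ab.
  exists z; apply: funext => x; rewrite /join_map.
  have E := reduced_prop (ltW r0) zt.
  have -> : total (c z) = r.
    by rewrite /total E -mulr_sumr -/(total t) t1V mulr1.
  by rewrite E tr mulrC mulKf // gt_eqF.
Qed.

Lemma minl_mono (y y' : T -> R) b b' : b != [::] ->
  (forall u, u \in b -> exists2 v, v \in b' & y' v = y u) -> minl y' b' <= minl y b.
Proof.
move=> b0 bb'; have [u ub ->] := minl_attained y b0.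
by have [v vb' <-] := bb' u ub; exact: minl_le.
Qed.

Lemma join_map_covariant (s : T -> T) z z' : injective s ->
  (forall x, (s x \in flatten bs) = (x \in flatten bs)) ->
  (forall b, b \in bs -> exists2 b', b' \in bs & b' =i map s b) ->
  (forall x, x \in flatten bs -> c z' x = c z (s x)) ->
  join_map z' = join_map z \o s.
Proof.
move=> sI sV sb czs.
have E x : reduced (c z') x = reduced (c z) (s x).
  have [/flattenP[b bbs xb]|xV] := boolP (x \in flatten bs); last first.
    by rewrite !reduced_out // sV.
  have [b' b'bs bb'] := sb b bbs.
  have sxb' : s x \in b' by rewrite bb' map_f.
  have V w : w \in b -> w \in flatten bs by move=> wb; apply/flattenP; exists b.
  rewrite (reducedE _ bbs xb) (reducedE _ b'bs sxb') czs ?V //; congr (_ - _).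
  have b0 : b != [::] by case: b xb {bbs bb' V}.
  have b'0 : b' != [::] by case: b' sxb' {b'bs bb'}.
  apply/eqP; rewrite eq_le; apply/andP; split; apply: minl_mono => // u ub.
    by move: ub; rewrite bb' => /mapP[w wb ->]; exists w; rewrite // czs // V.
  by exists (s u); rewrite ?czs ?V // bb' map_f.
apply: funext => x; rewrite /join_map /= E; congr (_ / _).
rewrite /total; under eq_bigr do rewrite E.
rewrite -(big_map s xpredT (reduced (c z))); apply: perm_big.
have U : uniq (map s (flatten bs)) by rewrite map_inj_uniq.
apply: uniq_perm => //.
have sub_s : {subset map s (flatten bs) <= flatten bs}.
  by move=> _ /mapP[w wV ->]; rewrite sV.
by have [|_] := uniq_min_size U sub_s; rewrite ?size_map.
Qed.

End JoinParam.

(** * Spheres as joins *)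

Section LinearJoin.
Variables (R : realType) (T : choiceType) (S : topologicalType) (d : nat).
Variables (q : S -> 'I_d -> R) (M : 'I_d -> T -> R) (bs : seq (seq T)).
Hypothesis q_cont : forall i, continuous (fun z => q z i).
Hypothesis q_unit : forall z, \sum_i q z i ^+ 2 = 1.
Hypothesis q_inj : forall z z', q z =1 q z' -> z = z'.
Hypothesis q_onto : forall u : 'I_d -> R, \sum_i u i ^+ 2 = 1 -> exists z, q z =1 u.

Definition lin (u : 'I_d -> R) : T -> R := fun x => \sum_i u i * M i x.

Hypothesis ubs : uniq (flatten bs).
Hypothesis bs0 : all (fun b => b != [::]) bs.
Hypothesis M_inj : forall u, block_const bs (lin u) -> forall i, u i = 0.
Hypothesis M_onto : forall y : T -> R, exists u, forall b, b \in bs -> exists m,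
  forall x, x \in b -> lin u x = y x + m.

(** A linear isomorphism from [R^d] to the classes modulo the blocks maps the unit
    sphere bijectively to the rays. *)
Lemma linear_join_param : param (join bs) (join_map bs (fun z => lin (q z))).
Proof.
apply: join_param => //.
- by move=> x; apply: cont_sum => i; apply: cont_mul => //; exact: cont_cst.
- move=> z /M_inj z0; have := q_unit z; rewrite big1 ?(eqP _) // => [|i _].
    by move/eqP; rewrite eq_sym oner_eq0.
  by rewrite z0 expr0n.
- move=> z z' r r0 zz'.
  have E i : q z i = r * q z' i.
    apply/eqP; rewrite -subr_eq0; apply/eqP; move: i.
    apply: M_inj => b u v bbs ub vb.
    have lE x : lin (fun i => q z i - r * q z' i) x = lin (q z) x - r * lin (q z') x.
      rewrite /lin mulr_sumr -sumrB; apply: eq_bigr => i _; ring.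
    by rewrite !lE; have := zz' b u v bbs ub vb; lra.
  have r1 : r = 1.
    have := q_unit z; under eq_bigr do rewrite E exprMn.
    rewrite -mulr_sumr q_unit mulr1 => /eqP; rewrite sqrf_eq1 => /orP[/eqP //|/eqP rE].
    by move: r0; rewrite rE; lra.
  by apply: q_inj => i; rewrite E r1 mul1r.
- move=> y yN; have [u uy] := M_onto y.
  have u0 : 0 < \sum_i u i ^+ 2.
    rewrite lt_def sumr_ge0 ?andbT; last by move=> i _; exact: sqr_ge0.
    apply/eqP => /eqP; rewrite psumr_eq0; last by move=> i _; exact: sqr_ge0.
    move=> /allP u0; apply: yN => b v w bbs vb wb.
    have [m um] := uy b bbs.
    have l0 x : lin u x = 0.
      rewrite /lin big1 // => i _; have /eqP := u0 i (mem_index_enum _).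
      by move=> /eqP; rewrite sqrf_eq0 => /eqP ->; rewrite mul0r.
    by have := um v vb; have := um w wb; rewrite !l0; lra.
  set N := Num.sqrt (\sum_i u i ^+ 2).
  have N0 : 0 < N by rewrite sqrtr_gt0.
  have [|z zu] := @q_onto (fun i => N^-1 * u i).
    under eq_bigr do rewrite exprMn.
    by rewrite -mulr_sumr -(sqr_sqrtr (ltW u0)) -/N exprVn mulVf // expf_neq0 // gt_eqF.
  exists z, N^-1; first by rewrite invr_gt0.
  move=> b v w bbs vb wb; have [m um] := uy b bbs.
  have lE x : lin (q z) x = N^-1 * lin u x.
    rewrite /lin mulr_sumr; apply: eq_bigr => i _; by rewrite zu mulrA.
  by rewrite !lE (um v) // (um w) //; ring.
Qed.

End LinearJoin.

Section Sphere.
Variables (R : realType) (n : nat).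

Lemma sphere_set_compact : compact (@sphere_set R n).
Proof.
apply: bounded_closed_compact.
  exists 1; split => // r r1 x; rewrite /sphere_set /= => x1.
  rewrite [leLHS]/Num.norm /= mx_normrE; apply/bigmax_leP; split.
    by apply: ltW; apply: lt_trans r1; exact: ltr01.
  move=> [i j] _ /=; rewrite (ord1 i); apply: ltW; apply: le_lt_trans r1.
  rewrite -[leRHS]expr1 -(@ler_pXn2r _ 2) ?nnegrE //.
  rewrite expr1 expr1n real_normK ?num_real // -x1 (bigD1 j) //= lerDl.
  by apply: sumr_ge0 => k _; exact: sqr_ge0.
have -> : @sphere_set R n = (fun x : 'rV[R]_n.+1 => \sum_i x 0 i ^+ 2) @^-1` [set 1].
  by [].
apply: closed_comp; last exact: closed_eq.
move=> x _; apply: (@cont_sum R 'rV[R]_n.+1 _ _ (fun i (x : 'rV[R]_n.+1) => x 0 i ^+ 2)) => i.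
by apply: cont_mul => y; exact: coord_continuous.
Qed.

Lemma sphere_compact : compact [set: sphere R n].
Proof. exact: compact_subtype sphere_set_compact. Qed.

Definition coords (z : sphere R n) : 'I_n.+1 -> R := fun i => val z 0 i.

Lemma coords_cont i : continuous (fun z => coords z i).
Proof.
move=> z; apply: (@continuous_comp (sphere R n) 'rV[R]_n.+1 R val (fun x => x 0 i)).
  exact: continuous_val.
exact: coord_continuous.
Qed.

Lemma coords_unit z : \sum_i coords z i ^+ 2 = 1.
Proof. exact: (set_valP z). Qed.

Lemma coords_inj z z' : coords z =1 coords z' -> z = z'.
Proof. by move=> zz'; apply: val_inj; apply/rowP => i; exact: zz'. Qed.

Lemma coords_onto (u : 'I_n.+1 -> R) : \sum_i u i ^+ 2 = 1 -> exists z, coords z =1 u.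
Proof.
move=> u1; have uP : (\row_i u i) \in @sphere_set R n.
  by apply/mem_set; rewrite /sphere_set /= -u1; apply: eq_bigr => i _; rewrite mxE.
by exists (SigSub uP) => i; rewrite /coords /= mxE.
Qed.

(** The last vertex gets the linear form 0, the others the coordinate forms: these
    are independent modulo constants. *)
Lemma simplex_boundary_param (T : choiceType) (vs : seq T) : uniq vs -> size vs = n.+2 ->
  exists h : sphere R n -> {ptws T -> R}, param (join [:: vs]) h.
Proof.
move=> uvs svs.
have x0 : T by case: vs svs {uvs}.
pose M (i : 'I_n.+1) (x : T) : R := (index x vs == i)%:R.
have linE u x : x \in vs -> lin M u x = if insub (index x vs) is Some i then u i else 0.
  move=> xvs; rewrite /lin /M; case: insubP => [i _ iE|].
    rewrite (bigD1 i) //= -iE eqxx mulr1 big1 ?addr0 // => j ji.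
    by move: ji; rewrite -val_eqE /= eq_sym => /negPf ->; rewrite mulr0.
  rewrite -leqNgt => xn; rewrite big1 // => i _.
  by rewrite gtn_eqF ?mulr0 // (leq_trans (ltn_ord i)).
have vi k : (k < n.+2)%N -> nth x0 vs k \in vs by move=> ?; rewrite mem_nth ?svs.
exists (join_map [:: vs] (fun z => lin M (coords z))).
apply: linear_join_param => //.
- exact: coords_cont.
- exact: coords_unit.
- exact: coords_inj.
- exact: coords_onto.
- by rewrite /= cats0.
- by rewrite /= andbT; case: vs svs {uvs linE vi M}.
- move=> u uc i.
  have vi' : nth x0 vs i \in vs by apply: vi; exact: ltnW (ltn_ord i).
  have vn : nth x0 vs n.+1 \in vs by apply: vi.
  have := uc vs _ _ (mem_head _ _) vi' vn; rewrite !linE //.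
  rewrite !index_uniq ?svs //; last exact: ltnW (ltn_ord i).
  by rewrite valK insubN // -leqNgt.
- move=> y; exists (fun i => y (nth x0 vs i) - y (nth x0 vs n.+1)) => b.
  rewrite inE => /eqP ->; exists (- y (nth x0 vs n.+1)) => x xvs.
  rewrite linE //; case: insubP => [i _ iE|]; first by rewrite iE nth_index.
  rewrite -leqNgt => xn; have : (index x vs < n.+2)%N by rewrite -svs index_mem.
  rewrite ltnS => xn'; have {xn xn'} E : index x vs = n.+1.
    by apply/eqP; rewrite eqn_leq xn xn'.
  by rewrite -E nth_index // subrr.
Qed.

End Sphere.

(** * The projective space as a quotient of a triangulated sphere *)

Definition iotaN (n : nat) : seq N := [seq N.of_nat i | i <- iota 0 n].

Lemma mem_iotaN n x : (x \in iotaN n) = (x <? N.of_nat n)%num.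
Proof.
apply/mapP/idP => [[j]|/N.ltb_lt xn].
  rewrite mem_iota add0n => /= /ssrnat.ltP j_n ->; apply/N.ltb_lt; lia.
exists (N.to_nat x); last by rewrite Nnat.N2Nat.id.
rewrite mem_iota add0n /=; apply/ssrnat.ltP; lia.
Qed.

(** The join of the blocks is invariant under the rotation, and its vertices are
    those over [0, ..., m - 1]. *)
Definition spin_blocks (p m : nat) (bs : seq (seq N)) :=
  [&& uniq (flatten bs), all (fun b => b != [::]) bs,
    all (mem (flatten bs)) (iotaN (p * m)), all (mem (iotaN (p * m))) (flatten bs) &
    all (fun i => all (fun b => has (fun b' =>
      sub b' (map (spin p i) b) && sub (map (spin p i) b) b') bs) bs) (iota 0 p)].

Section SpinJoin.
Variables (R : realType) (S : topologicalType) (p m : nat) (bs : seq (seq N)).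
Hypotheses (p0 : (0 < p)%N) (bsP : spin_blocks p m bs).

Lemma mem_spin_blocks x : (x \in flatten bs) = (x / N.of_nat p <? N.of_nat m)%num.
Proof.
have P0 : N.of_nat p <> 0%num by case: p p0.
have -> : (x \in flatten bs) = (x \in iotaN (p * m)).
  by case/and5P: bsP => _ _ /allP a /allP b _; apply/idP/idP => [/b|/a].
rewrite mem_iotaN; apply/idP/idP => /N.ltb_lt h; apply/N.ltb_lt.
  apply: N.Div0.div_lt_upper_bound.
  by rewrite -Nnat.Nat2N.inj_mul.
have e := N.div_mod x _ P0; have l := N.mod_lt x _ P0.
rewrite e -multE Nnat.Nat2N.inj_mul; nia.
Qed.

Lemma spin_join_covariant (c : S -> N -> R) i z z' :
  (forall x, x \in flatten bs -> c z' x = c z (spin p i x)) ->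
  join_map bs c z' = join_map bs c z \o spin p i.
Proof.
move=> czz'; case/and5P: (bsP) => ubs _ _ _ /allP sb.
apply: join_map_covariant => //; first exact: spin_inj.
  by move=> x; rewrite !mem_spin_blocks spin_div.
move=> b bbs; have im : (i %% p)%N \in iota 0 p by rewrite mem_iota add0n ltn_mod.
have /allP/(_ b bbs)/hasP[b' b'bs /andP[/subP bb' /subP b'b]] := sb _ im.
exists b' => // x.
have E : map (spin p (i %% p)) b = map (spin p i) b.
  by apply: eq_map => y; rewrite spin_modn.
by rewrite -E; apply/idP/idP => [/bb'|/b'b].
Qed.

(** The reduction of the covering complex to the join is undone equivariantly, and
    the resulting parametrization descends to the orbits of [g]. *)
Lemma spin_quotient (c : S -> N -> R) (e : equiv_rel S) (g : nat -> S -> S)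
    (L : seq (seq N)) ms :
  compact [set: S] -> param (join bs) (join_map bs c) ->
  (forall z z', e z z' <-> exists i, z' = g i z) ->
  (forall i z x, x \in flatten bs -> c (g i z) x = c z (spin p i x)) ->
  covering p L -> reduces (spin_orbit p) ms (spin_cover p L) (join bs) ->
  homeomorphic (@geom R N (spin_base p L)) (quotient_topology {eq_quot e}%qT).
Proof.
move=> cS jp eg cg Lc red.
have [h hL cov] := reduces_param p0 red jp.
apply: (quotient_homeo p0 Lc cS hL) => z z'.
have [_ hI _ _] := jp.
rewrite eg; split=> -[j].
  by move=> ->; exists j; apply/cov; apply: spin_join_covariant => x; exact: cg.
move/cov => E; exists j; apply: hI; rewrite E; apply/esym.
by apply: spin_join_covariant => x; exact: cg.
Qed.

End SpinJoin.

Lemma ord4P (P : 'I_4 -> Prop) : P (inord 0) -> P (inord 1) -> P (inord 2) -> P (inord 3) ->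
  forall i, P i.
Proof.
move=> P0 P1 P2 P3 i; rewrite -(inord_val i).
by case: i => [[|[|[|[|//]]]]] ?.
Qed.

Lemma sum4 (V : nmodType) (F : 'I_4 -> V) :
  \sum_i F i = F (inord 0) + F (inord 1) + F (inord 2) + F (inord 3).
Proof.
rewrite !big_ord_recl big_ord0 addr0 !addrA; do !congr (_ + _);
  by congr F; apply: val_inj; rewrite /= ?inordK.
Qed.

Section Projective.
Variable R : realType.

(** The vertices [2 i] and [2 i + 1] are the two ends of the axis [i] of a cross
    polytope, whose boundary is the join of the four pairs. *)
Definition cross_blocks : seq (seq N) := [:: [:: 0; 1]; [:: 2; 3]; [:: 4; 5]; [:: 6; 7]]%num.

Definition cross_coord (i : 'I_4) (x : N) : R :=
  (-1) ^+ (N.odd x) * (N.to_nat (x / 2) == i)%:R.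

Let linE u x : (N.to_nat (x / 2) < 4)%N ->
  lin cross_coord u x = (-1) ^+ (N.odd x) * u (inord (N.to_nat (x / 2))).
Proof.
move=> x4; rewrite /lin (bigD1 (inord (N.to_nat (x / 2)))) //= big1 => [|i ix].
  by rewrite /cross_coord inordK // eqxx mulr1 addr0 mulrC.
rewrite /cross_coord; have [E|_] := eqVneq (N.to_nat (x / 2)) i; last by rewrite !mulr0.
by move: ix; rewrite E inord_val eqxx.
Qed.

Lemma cross_param : param (join cross_blocks)
  (join_map cross_blocks (fun z => lin cross_coord (@coords R 3 z))).
Proof.
apply: linear_join_param => //.
- exact: coords_cont.
- exact: coords_unit.
- exact: coords_inj.
- exact: coords_onto.
- move=> u uc; have E b := uc b (head 0%num b) (last 0%num b).
  apply: ord4P; [have := E [:: 0; 1]%num|have := E [:: 2; 3]%num|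
    have := E [:: 4; 5]%num|have := E [:: 6; 7]%num];
    by move/(_ isT isT isT); rewrite !linE //= expr0 expr1; lra.
- move=> y; exists (fun i : 'I_4 => (y (N.of_nat (2 * i)) - y (N.of_nat (2 * i + 1))) / 2) => b bb.
  exists (- (y (head 0%num b) + y (last 0%num b)) / 2) => x; move: bb.
  by rewrite !inE => /or4P[]/eqP ->; rewrite !inE => /orP[]/eqP ->; rewrite linE //= inordK //=; lra.
Qed.

Let opp_sphere (z : sphere R 3) : - val z \in @sphere_set R 3.
Proof.
apply/mem_set; apply: etrans (coords_unit z).
by apply: eq_bigr => i _; rewrite mxE sqrrN.
Qed.

Definition antipode (z : sphere R 3) : sphere R 3 := SigSub (opp_sphere z).

Definition sign_act (i : nat) (z : sphere R 3) := if odd i then antipode z else z.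

Lemma antipodal_act z z' : antipodal_equiv R 3 z z' <-> exists i, z' = sign_act i z.
Proof.
split=> [/orP[]/eqP E|[i ->]].
- by exists 0%N; apply: val_inj.
- by exists 1%N; apply: val_inj.
- rewrite /sign_act /= /antipodal; case: (odd i); by rewrite /= eqxx ?orbT.
Qed.

Lemma sign_act_coord i z x : x \in flatten cross_blocks ->
  lin cross_coord (coords (sign_act i z)) x = lin cross_coord (coords z) (spin 2 i x).
Proof.
rewrite (@mem_spin_blocks 2 4) // => /N.ltb_lt x4.
have x4' : (N.to_nat (x / 2) < 4)%N by apply/ssrnat.ltP; change (N.of_nat 2) with 2%num in x4; lia.
have d : (spin 2 i x / 2 = x / 2)%num by exact: (@spin_div 2).
rewrite !linE ?d //.
have -> : N.odd (spin 2 i x) = N.odd x (+) odd i.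
  have oddm c : N.odd (c mod 2) = N.odd c.
    by rewrite {2}(N.div_mod c 2) // N.add_comm N.odd_add_mul_2.
  have odd_nat k : N.odd (N.of_nat k) = odd k.
    elim: k => // k IH.
    by rewrite Nnat.Nat2N.inj_succ N.odd_succ -N.negb_odd IH.
  rewrite -oddm (@spin_mod 2) // oddm N.odd_add -odd_nat.
  by case: N.odd; case: N.odd.
rewrite signr_addb -mulrA; congr (_ * _).
rewrite /sign_act; case: (odd i); last by rewrite mul1r.
by rewrite /coords /= mxE expr1 mulN1r.
Qed.

Lemma projective_homeo L ms : covering 2 L ->
  reduces (spin_orbit 2) ms (spin_cover 2 L) (join cross_blocks) ->
  homeomorphic (@geom R N (spin_base 2 L)) (projective_space R 3).
Proof.
move=> Lc red; rewrite /projective_space.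
refine (@spin_quotient R (sphere R 3) 2 4 cross_blocks isT isT _
  (antipodal_equiv R 3) sign_act L ms (sphere_compact (R:=R) (n:=3)) cross_param antipodal_act _ Lc red).
exact: sign_act_coord.
Qed.

End Projective.

(** * The unit sphere of the complex plane *)

Section ComplexTopology.
Variable R : realType.
Local Notation Re := complex.Re.
Local Notation Im := complex.Im.

Lemma cont_Re : continuous (fun z : R[i]^o => Re z).
Proof.
move=> z U /nbhs_ballP[e /= e0 eU].
apply/nbhs_ballP; exists e%:C%C; first by rewrite /= ltcR.
move=> w; rewrite /ball /= => zw; apply: eU; rewrite /ball /= -ltcR.
apply: le_lt_trans zw; have := normc_ge_Re (z - w).
by case: (z) (w) => [a b] [c d].
Qed.

Lemma cont_Im : continuous (fun z : R[i]^o => Im z).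
Proof.
move=> z U /nbhs_ballP[e /= e0 eU].
apply/nbhs_ballP; exists e%:C%C; first by rewrite /= ltcR.
move=> w; rewrite /ball /= => zw; apply: eU; rewrite /ball /= -ltcR.
apply: le_lt_trans zw; have := normc_ge_Re ((z - w) * 'i%C).
rewrite normrM (_ : `|'i%C| = 1) ?mulr1.
  by rewrite ReiNIm normrN; case: (z) (w) => [a b] [c d].
by rewrite normc_def /= expr0n expr1n add0r sqrtr1.
Qed.

Lemma cont_complex (X : topologicalType) (f g : X -> R) : continuous f -> continuous g ->
  continuous (fun x => (f x +i* g x)%C : R[i]^o).
Proof.
move=> cf cg x U /nbhs_ballP[e /= e0 eU].
have eR : e = (Re e)%:C%C by rewrite RRe_real // ger0_real // ltW.
have e0' : 0 < Re e by rewrite -ltcR -eR.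
have e2 : 0 < Re e / 2 by lra.
have Nf : \forall y \near x, `|f x - f y| < Re e / 2.
  exact: (cf x _ (nbhsx_ballx (f x) _ e2)).
have Ng : \forall y \near x, `|g x - g y| < Re e / 2.
  exact: (cg x _ (nbhsx_ballx (g x) _ e2)).
suff H : \forall y \near x, U (f y +i* g y)%C by [].
near=> y; apply: eU; rewrite /ball /= eR.
have fy : `|f x - f y| < Re e / 2 by near: y.
have gy : `|g x - g y| < Re e / 2 by near: y.
have -> : (f x +i* g x)%C - (f y +i* g y)%C =
    (f x - f y)%:C%C + 'i%C * (g x - g y)%:C%C :> R[i].
  by rewrite [LHS]complexE /=.
apply: le_lt_trans (ler_normD _ _) _.
rewrite normrM !normc_def /= expr0n expr1n add0r sqrtr1 !addr0 !sqrtr_sqr.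
rewrite mul1r -rmorphD ltcR; lra.
Unshelve. all: by end_near.
Qed.

Definition coordsC2 (z : sphereC2 R) (k : 'I_4) : R :=
  nth 0 [:: Re (val z).1; Im (val z).1; Re (val z).2; Im (val z).2] k.

Lemma coordsC2_cont k : continuous (fun z => coordsC2 z k).
Proof.
have C (f : R[i]^o -> R) (g : (R[i]^o * R[i]^o)%type -> R[i]^o) :
    continuous f -> continuous g -> continuous (fun z : sphereC2 R => f (g (val z))).
  move=> cf cg z; apply: (@continuous_comp (sphereC2 R) R[i]^o R (fun z => g (val z)) f).
    apply: (@continuous_comp (sphereC2 R) (R[i]^o * R[i]^o)%type R[i]^o val g).
      exact: continuous_val.
    exact: cg.
  exact: cf.
have c1 : continuous (@fst R[i]^o R[i]^o) by move=> z; exact: cvg_fst.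
have c2 : continuous (@snd R[i]^o R[i]^o) by move=> z; exact: cvg_snd.
move: k; apply: ord4P; rewrite /coordsC2 inordK //=.
- exact: C cont_Re c1.
- exact: C cont_Im c1.
- exact: C cont_Re c2.
- exact: C cont_Im c2.
Qed.

Lemma sphereC2_setE (z : R[i]^o * R[i]^o) : sphereC2_set z <->
  Re z.1 ^+ 2 + Im z.1 ^+ 2 + Re z.2 ^+ 2 + Im z.2 ^+ 2 = 1.
Proof.
rewrite /sphereC2_set /= -!add_Re2_Im2 -rmorphD addrA.
by split=> [/complexI //|->].
Qed.

Lemma coordsC2_unit z : \sum_k coordsC2 z k ^+ 2 = 1.
Proof.
rewrite sum4 /coordsC2 !inordK //=.
by apply/sphereC2_setE; exact: (set_valP z).
Qed.

Lemma coordsC2_inj z z' : coordsC2 z =1 coordsC2 z' -> z = z'.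
Proof.
move=> E; apply: val_inj.
have := E (inord 0); have := E (inord 1); have := E (inord 2); have := E (inord 3).
rewrite /coordsC2 !inordK //=.
case: (val z) (val z') => [[a b] [c d]] [[a' b'] [c' d']] /= -> -> -> -> //.
Qed.

Lemma coordsC2_onto (u : 'I_4 -> R) : \sum_k u k ^+ 2 = 1 -> exists z, coordsC2 z =1 u.
Proof.
move=> u1.
have uP : (((u (inord 0) +i* u (inord 1))%C, (u (inord 2) +i* u (inord 3))%C) :
    (R[i]^o * R[i]^o)%type) \in @sphereC2_set R.
  by apply/mem_set/sphereC2_setE => /=; rewrite -u1 sum4.
exists (SigSub uP); apply: ord4P; by rewrite /coordsC2 inordK.
Qed.

Lemma sphereC2_compact : compact [set: sphereC2 R].
Proof.
have P (x : sphere R 3) : let u := coords x in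
  (((u (inord 0) +i* u (inord 1))%C, (u (inord 2) +i* u (inord 3))%C) :
    (R[i]^o * R[i]^o)%type) \in @sphereC2_set R.
  by apply/mem_set/sphereC2_setE => /=; rewrite -(coords_unit x) sum4.
apply: (@compact_image_space (sphere R 3) _ (fun x => SigSub (P x) : sphereC2 R)).
- exact: sphere_compact.
- apply: continuous_to_subtype => x.
  have c1 := cont_complex (@coords_cont R 3 (inord 0)) (@coords_cont R 3 (inord 1)) (x := x).
  have c2 := cont_complex (@coords_cont R 3 (inord 2)) (@coords_cont R 3 (inord 3)) (x := x).
  exact: (cvg_pair c1 c2).
- move=> z; have [x xz] := coords_onto (coordsC2_unit z).
  exists x; apply: coordsC2_inj; apply: ord4P; by rewrite -xz /coordsC2 inordK.
Qed.

End ComplexTopology.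

(** * Lens spaces as quotients of triangulated spheres *)

Section RootsOfUnity.
Variable R : realType.
Local Notation Re := complex.Re.
Local Notation Im := complex.Im.

Lemma expi_nat (t : R) (n : nat) : expi (t * n%:R) = expi t ^+ n.
Proof.
elim: n => [|n IH]; first by rewrite mulr0 /expi cos0 sin0 expr0.
rewrite exprS -IH -natr1 mulrDr mulr1 addrC /expi cosD sinD.
by apply/eqP; rewrite eq_complex /= eqxx /= addrC mulrC.
Qed.

Definition root1 (p : nat) : R[i] := expi (2 * pi / p%:R).

Lemma root1_expr p : (0 < p)%N -> root1 p ^+ p = 1.
Proof.
move=> p0; rewrite -expi_nat divfK ?pnatr_eq0 -?lt0n // /expi.
by rewrite mulrC -mulr_natr mul1r mulr_natr cos2pi sin2pi.
Qed.

Lemma norm_expi (t : R) : `|expi t| = 1 :> R[i].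
Proof. by rewrite normc_def /= cos2Dsin2 sqrtr1. Qed.

Lemma sqr_root1 p : Re (root1 p) ^+ 2 + Im (root1 p) ^+ 2 = 1.
Proof. exact: cos2Dsin2. Qed.

Lemma im_root1 p : (2 < p)%N -> 0 < Im (root1 p).
Proof.
move=> p2; apply: sin_gt0_pi; have p0 : (0 : R) < p%:R by rewrite ltr0n (ltn_trans _ p2).
have pi0 := pi_gt0 R.
rewrite divr_gt0 ?mulr_gt0 //= ltr_pdivrMr // mulrC ltr_pM2l //.
by rewrite ltr_nat.
Qed.

End RootsOfUnity.

Section Lens.
(** Over the base vertices in [A] the codes are placed at the roots of unity of the
    first coordinate axis, over those in [B] at those of the second one; a base
    vertex in both gives the orbit of [(1, 1)]. The linear form of a code is the
    real part of the bilinear product with its position, so that acting on the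
    sphere amounts to rotating the codes. *)
Variables (R : realType) (p q m : nat) (A B : N -> bool) (bs : seq (seq N)).
Hypotheses (p0 : (0 < p)%N) (bsP : spin_blocks p m bs).
Local Notation Re := complex.Re.
Local Notation Im := complex.Im.
Local Notation w := (root1 R p).

Definition lens_coef1 x : R[i] := (A (x / N.of_nat p))%:R * w ^+ N.to_nat x.
Definition lens_coef2 x : R[i] := (B (x / N.of_nat p))%:R * w ^+ (q * N.to_nat x).

(** The coordinate [Re (a z1 + b z2)] as a linear form in the four real
    coordinates of [(z1, z2)]. *)
Definition lens_coord (k : 'I_4) (x : N) : R :=
  let a := lens_coef1 x in let b := lens_coef2 x in
  nth 0 [:: Re a; - Im a; Re b; - Im b] k.

Lemma lens_lin u x : lin lens_coord u x =
  u (inord 0) * Re (lens_coef1 x) - u (inord 1) * Im (lens_coef1 x) +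
  u (inord 2) * Re (lens_coef2 x) - u (inord 3) * Im (lens_coef2 x).
Proof. by rewrite /lin sum4 /lens_coord !inordK //= !mulrN. Qed.

Lemma lens_lin_coords (z : sphereC2 R) x : lin lens_coord (coordsC2 z) x =
  Re (lens_coef1 x * (val z).1 + lens_coef2 x * (val z).2).
Proof.
rewrite lens_lin /coordsC2 !inordK //=.
case: (val z) (lens_coef1 x) (lens_coef2 x) => [[a b] [c d]] [e f] [g h] /=; ring.
Qed.

Let wP (a b : N) : w ^+ N.to_nat (a * N.of_nat p + b)%num = w ^+ N.to_nat b.
Proof.
rewrite Nnat.N2Nat.inj_add Nnat.N2Nat.inj_mul Nnat.Nat2N.id plusE multE exprD mulnC exprM.
by rewrite root1_expr // expr1n mul1r.
Qed.

Let w_spin i x : w ^+ N.to_nat (spin p i x) = w ^+ (N.to_nat x + i).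
Proof.
have P0 : N.of_nat p <> 0%num by case: p p0.
rewrite /spin wP.
have -> : (N.to_nat x + i)%N = N.to_nat (x + N.of_nat i)%num.
  by rewrite Nnat.N2Nat.inj_add Nnat.Nat2N.id.
by rewrite {2}(N.div_mod (x + N.of_nat i) _ P0) N.mul_comm wP.
Qed.

Let act_sphere k (z : sphereC2 R) :
  ((w ^+ k * (val z).1, w ^+ (q * k) * (val z).2) : (R[i]^o * R[i]^o)%type) \in @sphereC2_set R.
Proof.
apply/mem_set; rewrite /sphereC2_set /= !normrM !normrX !norm_expi !expr1n !mul1r.
exact: (set_valP z).
Qed.

Definition lens_act k (z : sphereC2 R) : sphereC2 R := SigSub (act_sphere k z).

Lemma lens_act_coord k z x :
  lin lens_coord (coordsC2 (lens_act k z)) x = lin lens_coord (coordsC2 z) (spin p k x).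
Proof.
rewrite !lens_lin_coords /= /lens_coef1 /lens_coef2 spin_div //.
rewrite !(mulnC q) !exprM w_spin !exprD !exprMn; congr Re; ring.
Qed.

Lemma lens_relP z z' : lens_equiv R p q z z' <-> exists k, z' = lens_act k z.
Proof.
have wq : expi (2 * pi * q%:R / p%:R) = w ^+ q :> R[i].
  by rewrite -expi_nat mulrAC.
split=> [/asboolP[k]|[k ->]]; last first.
  by apply/asboolP; exists k%:Z; rewrite /= wq exprM.
have [n nk] : exists n : nat, w ^ k = w ^+ n.
  case: k => n; first by exists n.
  exists (n.+1 * p.-1)%N; rewrite NegzE -exprnN.
  have wn : w ^+ n.+1 != 0 by rewrite expf_neq0 // expi_neq0.
  apply: (mulfI wn); rewrite divff // -exprD -mulnS prednK // mulnC exprM.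
  by rewrite root1_expr // expr1n.
have nk' : (w ^+ q) ^ k = w ^+ (q * n).
  by rewrite [w ^+ q]exprnP exprz_exp mulrC -exprz_exp nk -exprnP -exprM mulnC.
rewrite wq nk' -/w nk => -[z1 z2]; exists n; apply: val_inj.
apply: injective_projections; [exact: z1|exact: z2].
Qed.

Hypothesis M_inj : forall u, block_const bs (lin lens_coord u) -> forall i, u i = 0.
Hypothesis M_onto : forall y : N -> R, exists u, forall b, b \in bs -> exists m,
  forall x, x \in b -> lin lens_coord u x = y x + m.

Lemma lens_homeo L ms : covering p L ->
  reduces (spin_orbit p) ms (spin_cover p L) (join bs) ->
  homeomorphic (@geom R N (spin_base p L)) (lens_space R p q).
Proof.
move=> Lc red; rewrite /lens_space.
have jp : param (join bs) (join_map bs (fun z => lin lens_coord (@coordsC2 R z))).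
  case/and5P: (bsP) => ubs bs0 _ _ _; apply: linear_join_param => //.
  - exact: coordsC2_cont.
  - exact: coordsC2_unit.
  - exact: coordsC2_inj.
  - exact: coordsC2_onto.
refine (@spin_quotient R (sphereC2 R) p m bs p0 bsP _ (lens_equiv R p q) lens_act L ms
  (@sphereC2_compact R) jp lens_relP _ Lc red).
by move=> k z x _; exact: lens_act_coord.
Qed.

End Lens.

Section LensCases.
Variable R : realType.
Local Notation Re := complex.Re.
Local Notation Im := complex.Im.

Let mul_complex (a b c d : R) :
  (a +i* b)%C * (c +i* d)%C = ((a * c - b * d) +i* (a * d + b * c))%C.
Proof. by []. Qed.

Definition is0 (v : N) := v == 0%num.
Definition is1 (v : N) := v == 1%num.

(** [lens_coord] with the exponents reduced modulo [p]. *)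
Definition lens_form p (a b : bool) (n n' : nat) (u : 'I_4 -> R) : R :=
  a%:R * (u (inord 0) * Re (root1 R p ^+ n) - u (inord 1) * Im (root1 R p ^+ n)) +
  b%:R * (u (inord 2) * Re (root1 R p ^+ n') - u (inord 3) * Im (root1 R p ^+ n')).

Lemma lens_linE p q (A B : N -> bool) u x : (0 < p)%N ->
  lin (lens_coord R p q A B) u x =
  lens_form p (A (x / N.of_nat p)%num) (B (x / N.of_nat p)%num)
    (N.to_nat x %% p) ((q * N.to_nat x) %% p) u.
Proof.
move=> p0; rewrite lens_lin /lens_form /lens_coef1 /lens_coef2.
rewrite !(expr_mod _ (root1_expr R p0)).
have ReZ (c : bool) (z : R[i]) : Re (c%:R * z) = c%:R * Re z.
  by case: c; rewrite ?mul1r // !mul0r.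
have ImZ (c : bool) (z : R[i]) : Im (c%:R * z) = c%:R * Im z.
  by case: c; rewrite ?mul1r // !mul0r.
rewrite !ReZ !ImZ; ring.
Qed.

(** The joins used for [L(4,1)], [L(3,1)] and [L(5,2)]: two squares, each of which
    is the join of its diagonals; two triangles; and the boundary of the 4-simplex
    with vertices [(w ^ k, w ^ 2k)] for [k < 5] and [w ^ 5 = 1]. *)
Definition square_blocks : seq (seq N) := [:: [:: 0; 2]; [:: 1; 3]; [:: 4; 6]; [:: 5; 7]]%num.
Definition triangle_blocks : seq (seq N) := [:: [:: 0; 1; 2]; [:: 3; 4; 5]]%num.
Definition pentatope_blocks : seq (seq N) := [:: [:: 0; 1; 2; 3; 4]]%num.

Lemma root1_4 : root1 R 4 = 'i%C.
Proof.
rewrite /root1 /expi (_ : 2 * pi / 4 = pi / 2 :> R) ?cos_pihalf ?sin_pihalf //; lra.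
Qed.

Lemma lens41_homeo L ms : covering 4 L ->
  reduces (spin_orbit 4) ms (spin_cover 4 L) (join square_blocks) ->
  homeomorphic (@geom R N (spin_base 4 L)) (lens_space R 4 1).
Proof.
have w2 : root1 R 4 ^+ 2 = -1 by rewrite root1_4 sqr_i.
have w3 : root1 R 4 ^+ 3 = - 'i%C by rewrite exprS w2 mulrN1 root1_4.
pose l u x := lin (lens_coord R 4 1 is0 is1) u x.
have E u : [/\ l u 0%num = u (inord 0), l u 1%num = - u (inord 1), l u 2%num = - u (inord 0) &
      l u 3%num = u (inord 1)] /\
   [/\ l u 4%num = u (inord 2), l u 5%num = - u (inord 3), l u 6%num = - u (inord 2) &
      l u 7%num = u (inord 3)].
  rewrite /l !lens_linE // /lens_form; move: (root1 R 4) root1_4 w2 w3 => w wE w2 w3.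
  by split; split; rewrite /= ?expr0 ?expr1 ?w2 ?w3 ?wE /=; ring.
apply: (@lens_homeo R 4 1 2 is0 is1 square_blocks isT isT).
- move=> u uc; have [[e0 e1 e2 e3] [e4 e5 e6 e7]] := E u.
  have H b : b \in square_blocks -> l u (head 0%num b) = l u (last 0%num b).
    by move=> bb; apply: (uc b) => //; move: bb; rewrite !inE => /or4P[]/eqP ->.
  have h0 := H [:: 0; 2]%num isT; have h1 := H [:: 1; 3]%num isT.
  have h4 := H [:: 4; 6]%num isT; have h5 := H [:: 5; 7]%num isT.
  by apply: ord4P; move: h0 h1 h4 h5; rewrite /= e0 e1 e2 e3 e4 e5 e6 e7; lra.
- move=> y.
  pose u (i : 'I_4) := nth 0 [:: (y 0%num - y 2%num) / 2; (y 3%num - y 1%num) / 2;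
     (y 4%num - y 6%num) / 2; (y 7%num - y 5%num) / 2] i.
  have [[e0 e1 e2 e3] [e4 e5 e6 e7]] := E u.
  exists u => b bb; exists (- (y (head 0%num b) + y (last 0%num b)) / 2) => x; move: bb.
  by rewrite !inE => /or4P[]/eqP ->; rewrite !inE => /orP[]/eqP ->;
    rewrite -/(l u _) ?e0 ?e1 ?e2 ?e3 ?e4 ?e5 ?e6 ?e7 /u inordK //=; lra.
Qed.

Lemma root1_sum p : (2 < p)%N -> \sum_(k < p) root1 R p ^+ k = 0.
Proof.
move=> p2; have p0 : (0 < p)%N by exact: leq_trans p2.
have := subrX1 (root1 R p) p; rewrite root1_expr // subrr => /esym/eqP.
rewrite mulf_eq0 => /orP[|/eqP //]; rewrite subr_eq0 => /eqP E.
by have := im_root1 R p2; rewrite E ltxx.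
Qed.

Let conj_unit (a s : R) (z : R[i]) : a ^+ 2 + s ^+ 2 = 1 -> z * (a +i* s)%C = 1 -> z = (a -i* s)%C.
Proof.
move=> as1; have e : (a -i* s)%C * (a +i* s)%C = 1 :> R[i].
  rewrite -[RHS](_ : (1 +i* 0)%C = 1) // mul_complex; apply/eqP; rewrite eq_complex /=.
  by apply/andP; split; apply/eqP; rewrite -?as1; ring.
have n0 : (a +i* s)%C != 0 :> R[i] by apply/eqP => E; move/eqP: e; rewrite E mulr0 eq_sym oner_eq0.
by rewrite -e => /(mulIf n0).
Qed.

Lemma lens31_homeo L ms : covering 3 L ->
  reduces (spin_orbit 3) ms (spin_cover 3 L) (join triangle_blocks) ->
  homeomorphic (@geom R N (spin_base 3 L)) (lens_space R 3 1).
Proof.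
have := root1_sum (isT : (2 < 3)%N); rewrite !big_ord_recl big_ord0 /= /bump /= addr0 !addn0 ?add1n.
have := @root1_expr R 3 isT; have := sqr_root1 R 3; have := im_root1 R (isT : (2 < 3)%N).
case wE : (root1 R 3) => [a s] /= s0 as1 w3 w012.
have w2 : root1 R 3 ^+ 2 = (a -i* s)%C by apply: (conj_unit as1); rewrite -wE -exprSr wE.
have a12 : a = - 1 / 2.
  by move: w012; rewrite -wE w2 wE expr0 => /(congr1 (@complex.Re R)) /=; lra.
pose l u x := lin (lens_coord R 3 1 is0 is1) u x.
have E u : [/\ l u 0%num = u (inord 0), l u 1%num = - 1 / 2 * u (inord 0) - s * u (inord 1) &
      l u 2%num = - 1 / 2 * u (inord 0) + s * u (inord 1)] /\
   [/\ l u 3%num = u (inord 2), l u 4%num = - 1 / 2 * u (inord 2) - s * u (inord 3) &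
      l u 5%num = - 1 / 2 * u (inord 2) + s * u (inord 3)].
  rewrite /l !lens_linE // /lens_form; move: (root1 R 3) wE w2 => w wE' w2'.
  by split; split; rewrite /= ?expr0 ?expr1 ?w2' ?wE' /= ?a12; ring.
apply: (@lens_homeo R 3 1 2 is0 is1 triangle_blocks isT isT).
- move=> u uc; have [[e0 e1 e2] [e3 e4 e5]] := E u.
  have h01 : l u 0%num = l u 1%num by exact: (uc [:: 0; 1; 2]%num).
  have h12 : l u 1%num = l u 2%num by exact: (uc [:: 0; 1; 2]%num).
  have h34 : l u 3%num = l u 4%num by exact: (uc [:: 3; 4; 5]%num).
  have h45 : l u 4%num = l u 5%num by exact: (uc [:: 3; 4; 5]%num).
  rewrite ?e0 ?e1 ?e2 ?e3 ?e4 ?e5 in h01 h12 h34 h45.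
  have u1 : s * u (inord 1) = 0 by lra.
  have u3 : s * u (inord 3) = 0 by lra.
  apply: ord4P; [by lra| |by lra|].
    by move/eqP: u1; rewrite mulf_eq0 gt_eqF //= => /eqP.
  by move/eqP: u3; rewrite mulf_eq0 gt_eqF //= => /eqP.
- move=> y.
  have sK (c : R) : s * (s^-1 * c) = c by rewrite mulrA divff ?mul1r // gt_eqF.
  pose u (i : 'I_4) := nth 0 [:: (2 * y 0%num - y 1%num - y 2%num) / 3; s^-1 * ((y 2%num - y 1%num) / 2);
     (2 * y 3%num - y 4%num - y 5%num) / 3; s^-1 * ((y 5%num - y 4%num) / 2)] i.
  have [[e0 e1 e2] [e3 e4 e5]] := E u.
  exists u => b; rewrite !inE => /orP[]/eqP ->.
  + exists (- (y 0%num + y 1%num + y 2%num) / 3) => x; rewrite !inE => /or3P[]/eqP ->;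
      rewrite -/(l u _) ?e0 ?e1 ?e2 /u !inordK //= ?sK; lra.
  + exists (- (y 3%num + y 4%num + y 5%num) / 3) => x; rewrite !inE => /or3P[]/eqP ->;
      rewrite -/(l u _) ?e3 ?e4 ?e5 /u !inordK //= ?sK; lra.
Qed.

(** The values of the linear forms at the five vertices are a real Fourier series
    on Z_5 without constant term: it is constant only if it vanishes, and the
    coefficients [u] fitting a given [y] up to its mean are found by the inversion
    formula. *)
Lemma lens52_homeo L ms : covering 5 L ->
  reduces (spin_orbit 5) ms (spin_cover 5 L) (join pentatope_blocks) ->
  homeomorphic (@geom R N (spin_base 5 L)) (lens_space R 5 2).
Proof.
have := root1_sum (isT : (2 < 5)%N); rewrite !big_ord_recl big_ord0 /= /bump /= addr0 !addn0 ?add1n.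
have := @root1_expr R 5 isT; have := sqr_root1 R 5; have := im_root1 R (isT : (2 < 5)%N).
case wE : (root1 R 5) => [a s] /= s0 as1 w5 wsum.
pose b := a ^+ 2 - s ^+ 2; pose t := 2 * a * s.
have w2 : root1 R 5 ^+ 2 = (b +i* t)%C.
  have bE : a * a - s * s = b by rewrite /b; ring.
  have tE : a * s + s * a = t by rewrite /t; ring.
  by rewrite expr2 wE mul_complex bE tE.
have bt1 : b ^+ 2 + t ^+ 2 = 1.
  have -> : b ^+ 2 + t ^+ 2 = (a ^+ 2 + s ^+ 2) ^+ 2 by rewrite /b /t; ring.
  by rewrite as1 expr1n.
have w4 : root1 R 5 ^+ 4 = (a -i* s)%C by apply: (conj_unit as1); rewrite -wE -exprSr wE.
have w3 : root1 R 5 ^+ 3 = (b -i* t)%C by apply: (conj_unit bt1); rewrite -w2 -exprD wE.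
(* The real part of the vanishing sum of the fifth roots of unity. *)
have ab : a + b = - 1 / 2.
  move: wsum; rewrite -wE w2 w3 w4 wE expr0 => /(congr1 (@complex.Re R)) /=; lra.
have s2 : s ^+ 2 = 1 - a ^+ 2 by rewrite -as1; ring.
have a2 : a ^+ 2 = 1 / 4 - a / 2 by move: ab; rewrite /b s2; lra.
have bE : b = - 1 / 2 - a by lra.
have b2 : b ^+ 2 = (a + 1) / 2 by rewrite bE; lra.
have t2 : t ^+ 2 = (1 - a) / 2 by lra.
have ab2 : a * b = - 1 / 4 by rewrite bE; lra.
pose l u x := lin (lens_coord R 5 2 is0 is0) u x.
have E u : [/\ l u 0%num = u (inord 0) + u (inord 2),
    l u 1%num = a * u (inord 0) - s * u (inord 1) + b * u (inord 2) - t * u (inord 3),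
    l u 2%num = b * u (inord 0) - t * u (inord 1) + a * u (inord 2) + s * u (inord 3),
    l u 3%num = b * u (inord 0) + t * u (inord 1) + a * u (inord 2) - s * u (inord 3) &
    l u 4%num = a * u (inord 0) + s * u (inord 1) + b * u (inord 2) + t * u (inord 3)].
  rewrite /l !lens_linE // /lens_form; move: (root1 R 5) wE w2 w3 w4 => w wE' w2' w3' w4'.
  by split; rewrite /= ?expr0 ?expr1 ?w2' ?w3' ?w4' ?wE' /=; ring.
apply: (@lens_homeo R 5 2 1 is0 is0 pentatope_blocks isT isT).
- move=> u uc; have [e0 e1 e2 e3 e4] := E u.
  have h01 : l u 0%num = l u 1%num by exact: (uc [:: 0; 1; 2; 3; 4]%num).
  have h12 : l u 1%num = l u 2%num by exact: (uc [:: 0; 1; 2; 3; 4]%num).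
  have h23 : l u 2%num = l u 3%num by exact: (uc [:: 0; 1; 2; 3; 4]%num).
  have h14 : l u 1%num = l u 4%num by exact: (uc [:: 0; 1; 2; 3; 4]%num).
  rewrite ?e0 ?e1 ?e2 ?e3 ?e4 in h01 h12 h23 h14.
  move: {e0 e1 e2 e3 e4 uc E} h01 h12 h23 h14.
  set x1 := u (inord 0); set y1 := u (inord 1); set x2 := u (inord 2); set y2 := u (inord 3).
  move=> h01 h12 h23 h14.
  have e1 : s * y1 + t * y2 = 0 by lra.
  have e2 : t * y1 - s * y2 = 0 by lra.
  have st0 : s ^+ 2 + t ^+ 2 != 0.
    by rewrite gt_eqF // ltr_pwDl ?exprn_gt0 // sqr_ge0.
  have y10 : y1 = 0.
    apply: (mulfI st0); rewrite mulr0.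
    have -> : (s ^+ 2 + t ^+ 2) * y1 = s * (s * y1 + t * y2) + t * (t * y1 - s * y2) by ring.
    by rewrite e1 e2 !mulr0 addr0.
  have y20 : y2 = 0.
    apply: (mulfI st0); rewrite mulr0.
    have -> : (s ^+ 2 + t ^+ 2) * y2 = t * (s * y1 + t * y2) - s * (t * y1 - s * y2) by ring.
    by rewrite e1 e2 !mulr0 subr0.
  have abN : a - b != 0.
    apply/eqP => abE; have a4 : a = - 1 / 4 by lra.
    by move: a2; rewrite a4; lra.
  have x12 : x1 - x2 = 0.
    apply: (mulfI abN); rewrite mulr0; move: h12; rewrite y10 y20; lra.
  have x1E : x2 = x1 by lra.
  have x10 : x1 = 0.
    move: h01; rewrite y10 y20 x1E => h.
    have : x1 * 2 = (a + b) * x1 by lra.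
    by rewrite ab; lra.
  by apply: ord4P; rewrite -/x1 -/x2 -/y1 -/y2 ?x1E.
- move=> y.
  pose y0 := y 0%num; pose y1 := y 1%num; pose y2 := y 2%num; pose y3 := y 3%num; pose y4 := y 4%num.
  pose u (i : 'I_4) := nth 0 [:: 2 / 5 * (y0 + a * (y1 + y4) + b * (y2 + y3));
    - 2 / 5 * (s * (y1 - y4) + t * (y2 - y3));
    2 / 5 * (y0 + b * (y1 + y4) + a * (y2 + y3));
    - 2 / 5 * (t * (y1 - y4) - s * (y2 - y3))] i.
  have [e0 e1 e2 e3 e4] := E u.
  (* The products of sines and cosines in the inversion formula, in terms of [a]. *)
  have K z : b * z = - 1 / 2 * z - a * z /\ [/\ a * a * z = z / 4 - a * z / 2,
      b * b * z = (a * z + z) / 2, a * b * z = - z / 4, s * s * z = 3 / 4 * z + a * z / 2 &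
      t * t * z = (z - a * z) / 2].
    by rewrite -!expr2 s2 t2 b2 a2 ab2 bE; split; [|split]; lra.
  have [k00 [k01 k02 k03 k04 k05]] := K y0; have [k10 [k11 k12 k13 k14 k15]] := K y1.
  have [k20 [k21 k22 k23 k24 k25]] := K y2; have [k30 [k31 k32 k33 k34 k35]] := K y3.
  have [k40 [k41 k42 k43 k44 k45]] := K y4.
  exists u => c; rewrite inE => /eqP ->.
  exists (- (y0 + y1 + y2 + y3 + y4) / 5) => x; rewrite !inE.
  by case/orP=> [/eqP ->|/or4P[]/eqP ->]; rewrite -/(l u _) ?e0 ?e1 ?e2 ?e3 ?e4 /u !inordK //=;
    rewrite -?/y0 -?/y1 -?/y2 -?/y3 -?/y4; lra.
Qed.

End LensCases.

(** * The product of the sphere with the circle *)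

Section Pushforward.
Variables (R : realType) (T T' : choiceType) (s : seq T) (phi : T -> T').

Definition pushforward (t : T -> R) : T' -> R := fun v => \sum_(c <- s | phi c == v) t c.

Lemma pushforward_simplex f t : uniq s -> {subset f <= s} -> in_simplex f t ->
  in_simplex (map phi f) (pushforward t).
Proof.
move=> us fs [t0 tf t1]; split.
- by move=> v; apply: sumr_ge0.
- move=> v vf; rewrite /pushforward big1 // => c /eqP cv; apply: tf.
  by apply: contra vf => cf; rewrite -cv map_f.
rewrite -t1 (@in_simplexP R T f s) // /pushforward.
rewrite (exchange_big_dep predT) //=; apply: eq_bigr => c _.
have [cf|cf] := boolP (c \in f); last first.
  by rewrite tf // big1.
rewrite (eq_bigl (pred1 (phi c))); last by move=> v; rewrite /= eq_sym.
by rewrite -big_filter filter_pred1_uniq ?undup_uniq ?mem_undup ?map_f // big_seq1.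
Qed.

End Pushforward.

Section Coupling.
Variable R : realType.
Implicit Types (P Q : nat -> R) (t : nat * nat -> R).

Definition cumul P (i : nat) := \sum_(0 <= k < i) P k.

Definition cmin P Q (i j : nat) := Num.min (cumul P i) (cumul Q j).

(** The monotone coupling of two mass distributions has the cumulative function
    [cmin P Q], so its value at [c] is the mixed second difference of [cmin P Q]. *)
Definition coupling P Q (c : nat * nat) : R :=
  cmin P Q c.1.+1 c.2.+1 - cmin P Q c.1 c.2.+1 - (cmin P Q c.1.+1 c.2 - cmin P Q c.1 c.2).

Lemma min_diff (a a' b b' : R) : a <= a' -> b <= b' ->
  Num.min a' b' - Num.min a b' - (Num.min a' b - Num.min a b) =
  Num.max 0 (Num.min a' b' - Num.max a b).
Proof.
move=> aa' bb'.
case: (lerP a b) => ab; case: (lerP a b') => ab'; case: (lerP a' b) => a'b;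
 case: (lerP a' b') => a'b'; rewrite ?(minElt, maxElt); do ?case: ifPn; rewrite -?leNgt; lra.
Qed.

Lemma cumulS P i : cumul P i.+1 = cumul P i + P i.
Proof. by rewrite /cumul big_nat_recr. Qed.

Lemma cumul0 P : cumul P 0 = 0.
Proof. by rewrite /cumul big_geq. Qed.

Section Distributions.
Variable P : nat -> R.
Hypothesis P0 : forall k, 0 <= P k.

Lemma cumul_ge0 i : 0 <= cumul P i.
Proof. by apply: sumr_ge0. Qed.

Lemma cumul_le i j : (i <= j)%N -> cumul P i <= cumul P j.
Proof.
move=> /subnK <-; elim: (j - i)%N => // n IH.
by rewrite addSn cumulS; apply: (le_trans IH); rewrite lerDl.
Qed.

End Distributions.

Section CouplingFacts.
Variables (P Q : nat -> R).
Hypotheses (P0 : forall k, 0 <= P k) (Q0 : forall k, 0 <= Q k).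

(** Lay the masses of [P] and of [Q] end to end along the line: the coupling of
    [(i, j)] is the length common to the [i]-th and the [j]-th interval. *)
Lemma couplingE c : coupling P Q c = Num.max 0
  (Num.min (cumul P c.1.+1) (cumul Q c.2.+1) - Num.max (cumul P c.1) (cumul Q c.2)).
Proof. by apply: min_diff; exact: cumul_le. Qed.

Lemma coupling_ge0 c : 0 <= coupling P Q c.
Proof. by rewrite couplingE le_max lexx. Qed.

Lemma coupling_gt0 c : coupling P Q c != 0 ->
  [/\ cumul P c.1 < cumul Q c.2.+1, cumul Q c.2 < cumul P c.1.+1, P c.1 != 0 & Q c.2 != 0].
Proof.
move=> c0; have : 0 < coupling P Q c by rewrite lt_def c0 coupling_ge0.
rewrite couplingE lt_max ltxx /= subr_gt0 lt_min !gt_max => /andP[/andP[a b] /andP[d e]].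
split=> //; apply/eqP => E.
  by move: a; rewrite cumulS E addr0 ltxx.
by move: e; rewrite cumulS E addr0 ltxx.
Qed.

Lemma coupling_chain c c' : coupling P Q c != 0 -> coupling P Q c' != 0 ->
  (c.1 < c'.1)%N -> (c.2 <= c'.2)%N.
Proof.
move=> /coupling_gt0[_ a _ _] /coupling_gt0[b _ _ _] cc'; rewrite leqNgt; apply/negP => c'c.
have := cumul_le P0 cc'; have := cumul_le Q0 c'c; lra.
Qed.

Lemma coupling_row i b : cumul P i.+1 <= cumul Q b ->
  \sum_(0 <= j < b) coupling P Q (i, j) = P i.
Proof.
move=> ib.
rewrite (eq_bigr (fun j => (fun j => cmin P Q i.+1 j - cmin P Q i j) j.+1 -
   (fun j => cmin P Q i.+1 j - cmin P Q i j) j)); last by move=> j _; rewrite /coupling /=; ring.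
rewrite telescope_sumr // /cmin cumul0.
have le1 := cumul_le P0 (leqnSn i); have ge0 := cumul_ge0 P0.
rewrite (min_idPl ib) (min_idPl (le_trans le1 ib)) !(min_idPr _) //.
by rewrite cumulS; ring.
Qed.

Lemma coupling_col j a : cumul Q j.+1 <= cumul P a ->
  \sum_(0 <= i < a) coupling P Q (i, j) = Q j.
Proof.
move=> ja.
rewrite (eq_bigr (fun i => (fun i => cmin P Q i j.+1 - cmin P Q i j) i.+1 -
   (fun i => cmin P Q i j.+1 - cmin P Q i j) i)); last by move=> i _; rewrite /coupling /=; ring.
rewrite telescope_sumr // /cmin cumul0.
have le1 := cumul_le Q0 (leqnSn j); have ge0 := cumul_ge0 Q0.
rewrite (min_idPr ja) (min_idPr (le_trans le1 ja)) !(min_idPl _) //.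
by rewrite cumulS; ring.
Qed.

End CouplingFacts.
End Coupling.

Definition grid (a b : nat) : seq (nat * nat) := [seq (i, j) | i <- iota 0 a, j <- iota 0 b].

Lemma mem_grid a b i j : ((i, j) \in grid a b) = (i < a)%N && (j < b)%N.
Proof.
rewrite /grid; apply/allpairsP/andP => [[[i' j'] /= []]|[ia jb]].
  by rewrite !mem_iota !add0n /= => ? ? [-> ->].
by exists (i, j); rewrite !mem_iota !add0n.
Qed.

(** The prism over a triangle [r] and an edge [c] is cut into three tetrahedra:
    a monotone path climbs from the first to the second end of [c] at one of the
    vertices of [r]. *)
Definition staircase (r c : seq nat) (k : nat) : seq (nat * nat) :=
  [seq (x, head 0%N c) | x <- take k.+1 r] ++ [seq (x, last 0%N c) | x <- drop k r].

(** The staircase triangulation of the product of the boundary of the tetrahedron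
    [0123] and the boundary of the triangle [012]. *)
Definition product_facets : seq (seq (nat * nat)) :=
  flatten [seq [seq staircase r c k | c <- [:: [:: 0; 1]; [:: 0; 2]; [:: 1; 2]]%N, k <- iota 0 3]
  | r <- [:: [:: 0; 1; 2]; [:: 0; 1; 3]; [:: 0; 2; 3]; [:: 1; 2; 3]]%N].

Fixpoint bitseqs (n : nat) : seq bitseq :=
  if n is n'.+1 then [seq b :: l | b <- [:: false; true], l <- bitseqs n'] else [:: [::]].

Lemma mem_bitseqs l : l \in bitseqs (size l).
Proof.
elim: l => [//|b l IH].
have -> : bitseqs (size (b :: l)) = [seq c :: l' | c <- [:: false; true], l' <- bitseqs (size l)] by [].
apply/allpairsP; exists (b, l); split=> //=.
by case: b.
Qed.

(** The support of a point of the product: it misses a row and a column, since the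
    factors are boundaries of simplices, and it is a chain of the product order. *)
Definition chain_mask (u : nat * nat -> bool) :=
  [&& has (fun i => all (fun j => ~~ u (i, j)) (iota 0 3)) (iota 0 4),
      has (fun j => all (fun i => ~~ u (i, j)) (iota 0 4)) (iota 0 3) &
      all (fun c => all (fun c' => [&& u c, u c' & (c.1 < c'.1)%N] ==> (c.2 <= c'.2)%N)
        (grid 4 3)) (grid 4 3)].

Definition mask_in_facet (u : nat * nat -> bool) :=
  has (fun f => all (fun c => u c ==> (c \in f)) (grid 4 3)) product_facets.

Lemma chain_masks : all (fun l => let u c := nth false l (3 * c.1 + c.2) in
  chain_mask u ==> mask_in_facet u) (bitseqs 12).
Proof. by vm_compute. Qed.

Lemma chain_in_facet (u : nat * nat -> bool) : chain_mask u -> mask_in_facet u.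
Proof.
pose l := [seq u c | c <- grid 4 3]; pose v (c : nat * nat) := nth false l (3 * c.1 + c.2).
have C : chain_mask v ==> mask_in_facet v := allP chain_masks l (mem_bitseqs l).
move=> cu; have -> : mask_in_facet u = mask_in_facet v by [].
by apply: (implyP C); have <- : chain_mask u = chain_mask v by [].
Qed.

Section Product.
Variable R : realType.

Definition join4 := join [:: iota 0 4].
Definition join3 := join [:: iota 0 3].

Lemma simplex_massP n (P : nat -> R) : geom (join [:: iota 0 n]) P ->
  [/\ forall k, 0 <= P k, forall k, (n <= k)%N -> P k = 0, cumul P n = 1 &
   exists2 k, (k < n)%N & P k = 0].
Proof.
move=> [f fj [P0 Pf P1]]; have fs := join_sub fj.
rewrite /= cats0 in fs.
split=> //.
- by move=> k nk; apply: Pf; apply/negP => /fs; rewrite mem_iota add0n /= ltnNge nk.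
- rewrite /cumul -P1 (@in_simplexP _ _ f (iota 0 n)) ?iota_uniq //.
  by rewrite /index_iota subn0.
- have [|k] := @join_miss _ [:: iota 0 n] f (iota 0 n) _ fj (mem_head _ _).
    by rewrite /= cats0 iota_uniq.
  by rewrite mem_iota add0n => /= kn /Pf; exists k.
Qed.

Definition couple (P Q : nat -> R) (c : nat * nat) : R :=
  if c \in grid 4 3 then coupling P Q c else 0.

Lemma big_grid (F : nat * nat -> R) :
  \sum_(c <- grid 4 3) F c = \sum_(0 <= i < 4) \sum_(0 <= j < 3) F (i, j).
Proof. by rewrite /grid big_allpairs. Qed.

Section Couple.
Variables P Q : nat -> R.
Hypotheses (hP : geom join4 P) (hQ : geom join3 Q).

Lemma couple_row i : pushforward (grid 4 3) fst (couple P Q) i = P i.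
Proof.
have [P0 Pn P1 _] := simplex_massP hP; have [Q0 Qn Q1 _] := simplex_massP hQ.
rewrite /pushforward big_mkcond big_grid /=.
have [i4|i4] := ltnP i 4; last first.
  rewrite Pn // big_nat big1 // => k /andP[_ k4].
  by rewrite big1 // => j _; rewrite ltn_eqF // (leq_trans k4).
rewrite (bigD1_seq i) ?mem_index_iota ?iota_uniq //= [X in _ + X]big1 ?addr0; last first.
  by move=> k ki; rewrite big1 // => j _; rewrite (negPf ki).
rewrite -[RHS](@coupling_row R P Q P0 i 3); last first.
  by rewrite Q1 -P1; apply: cumul_le.
rewrite !big_nat; apply: eq_bigr => j /andP[_ j3].
by rewrite eqxx /couple mem_grid i4 j3.
Qed.

Lemma couple_col j : pushforward (grid 4 3) snd (couple P Q) j = Q j.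
Proof.
have [P0 Pn P1 _] := simplex_massP hP; have [Q0 Qn Q1 _] := simplex_massP hQ.
rewrite /pushforward big_mkcond big_grid /= exchange_big /=.
have [j3|j3] := ltnP j 3; last first.
  rewrite Qn // big_nat big1 // => k /andP[_ k3].
  by rewrite big1 // => i _; rewrite ltn_eqF // (leq_trans k3).
rewrite (bigD1_seq j) ?mem_index_iota ?iota_uniq //= [X in _ + X]big1 ?addr0; last first.
  by move=> k kj; rewrite big1 // => i _; rewrite (negPf kj).
rewrite -[RHS](@coupling_col R P Q Q0 j 4); last first.
  by rewrite P1 -Q1; apply: cumul_le.
rewrite !big_nat; apply: eq_bigr => i /andP[_ i4].
by rewrite eqxx /couple mem_grid i4 j3.
Qed.

Lemma couple_geom : geom product_facets (couple P Q).
Proof.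
have [P0 Pn P1 [kP kP4 kP0]] := simplex_massP hP.
have [Q0 Qn Q1 [kQ kQ3 kQ0]] := simplex_massP hQ.
have C0 c : 0 <= couple P Q c.
  by rewrite /couple; case: ifP => // _; exact: coupling_ge0.
have Cg c : couple P Q c != 0 -> coupling P Q c != 0.
  by rewrite /couple; case: ifP => //; rewrite eqxx.
have /hasP[f fX /allP fu] : mask_in_facet (fun c => couple P Q c != 0).
  apply: chain_in_facet; apply/and3P; split.
  - apply/hasP; exists kP; first by rewrite mem_iota.
    apply/allP => j _; apply/negP => /Cg /(coupling_gt0 P0 Q0)[_ _ /= /eqP []].
    by rewrite kP0.
  - apply/hasP; exists kQ; first by rewrite mem_iota.
    apply/allP => i _; apply/negP => /Cg /(coupling_gt0 P0 Q0)[_ _ _ /= /eqP []].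
    by rewrite kQ0.
  - apply/allP => c _; apply/allP => c' _; apply/implyP => /and3P[/Cg cn /Cg c'n].
    exact: coupling_chain P0 Q0 _ _ cn c'n.
have Cf c : c \notin f -> couple P Q c = 0.
  move=> cf; have [cg|cg] := boolP (c \in grid 4 3); last by rewrite /couple (negPf cg).
  by apply/eqP; move: (fu c cg); rewrite (negPf cf) implybF negbK.
exists f => //; split=> //.
rewrite (@sum_supp _ _ _ (grid 4 3)) ?undup_uniq //; last 2 first.
- by move=> c; rewrite mem_undup; exact: Cf.
- by move=> c cg; rewrite /couple (negPf cg).
rewrite big_grid -P1 /cumul; apply: eq_big_nat => i i4.
rewrite -[RHS]couple_row /pushforward [RHS]big_mkcond big_grid /=.
rewrite [RHS](bigD1_seq i) ?mem_index_iota ?iota_uniq //= [X in _ + X]big1 ?addr0; last first.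
  by move=> k ki; rewrite big1 // => j _; rewrite (negPf ki).
by apply: eq_bigr => j _; rewrite eqxx.
Qed.

End Couple.

(** A point of the product complex is supported on a chain. Hence, of the mass in
    the first [i] rows and the mass in the first [j] columns, one is contained in
    the other, and the cumulative function is the minimum of the marginal ones. *)
Lemma couple_marginals t : geom product_facets t ->
  let P := pushforward (grid 4 3) fst t in let Q := pushforward (grid 4 3) snd t in
  [/\ geom join4 P, geom join3 Q & couple P Q = t].
Proof.
move=> [f fX ft] P Q; have [t0 tf t1] := ft.
have fg : {subset f <= grid 4 3}.
  have /allP/(_ f fX)/allP : all (all (mem (grid 4 3))) product_facets by vm_compute.
  exact.
have hP : geom join4 P.
  have /allP/(_ f fX)/hasP[g gj /subP fg'] : all (fun f => has (sub (map fst f)) join4) product_facets.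
    by vm_compute.
  by exists g => //; apply: in_simplex_sub fg' _; exact: pushforward_simplex.
have hQ : geom join3 Q.
  have /allP/(_ f fX)/hasP[g gj /subP fg'] : all (fun f => has (sub (map snd f)) join3) product_facets.
    by vm_compute.
  by exists g => //; apply: in_simplex_sub fg' _; exact: pushforward_simplex.
split=> //.
have [P0 Pn P1 _] := simplex_massP hP; have [Q0 Qn Q1 _] := simplex_massP hQ.
pose H i j := \sum_(c <- grid 4 3 | (c.1 < i)%N && (c.2 < j)%N) t c.
have cP i : cumul P i = \sum_(c <- grid 4 3 | (c.1 < i)%N) t c.
  rewrite /cumul /P /pushforward (exchange_big_dep predT) //= [RHS]big_mkcond /=.
  apply: eq_bigr => c _; case: ifPn => ci.
    rewrite (eq_bigl (pred1 c.1)) => [|k]; last by rewrite /= eq_sym.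
    by rewrite -big_filter filter_pred1_uniq ?iota_uniq ?mem_index_iota // big_seq1.
  rewrite big_nat_cond big1 // => k /andP[/andP[_ ki] /eqP E].
  by rewrite E ki in ci.
have cQ j : cumul Q j = \sum_(c <- grid 4 3 | (c.2 < j)%N) t c.
  rewrite /cumul /Q /pushforward (exchange_big_dep predT) //= [RHS]big_mkcond /=.
  apply: eq_bigr => c _; case: ifPn => cj.
    rewrite (eq_bigl (pred1 c.2)) => [|k]; last by rewrite /= eq_sym.
    by rewrite -big_filter filter_pred1_uniq ?iota_uniq ?mem_index_iota // big_seq1.
  rewrite big_nat_cond big1 // => k /andP[/andP[_ kj] /eqP E].
  by rewrite E kj in cj.
have sum_le (p q : pred (nat * nat)) : (forall c, q c -> p c) ->
    \sum_(c <- grid 4 3 | q c) t c <= \sum_(c <- grid 4 3 | p c) t c.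
  move=> qp; rewrite big_mkcond [leRHS]big_mkcond; apply: ler_sum => c _.
  by case: ifP => [/qp ->|_] //; case: ifP.
have sum_eq (p q : pred (nat * nat)) : (forall c, c \in f -> p c = q c) ->
    \sum_(c <- grid 4 3 | q c) t c = \sum_(c <- grid 4 3 | p c) t c.
  move=> pq; rewrite big_mkcond [RHS]big_mkcond; apply: eq_bigr => c _.
  have [cf|cf] := boolP (c \in f); first by rewrite pq.
  by rewrite tf //; case: ifP; case: ifP.
have chk : all (fun i => all (fun j => all (fun f =>
     all (fun c => (c.1 < i)%N ==> (c.2 < j)%N) f || all (fun c => (c.2 < j)%N ==> (c.1 < i)%N) f)
     product_facets) (iota 0 4)) (iota 0 5) by vm_compute.
have HE i j : (i < 5)%N -> (j < 4)%N -> cmin P Q i j = H i j.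
  move=> i5 j4; rewrite /cmin cP cQ.
  have ii : i \in iota 0 5 by rewrite mem_iota.
  have jj : j \in iota 0 4 by rewrite mem_iota.
  case/orP: (allP (allP (allP chk i ii) j jj) f fX) => /allP ok.
    rewrite (@sum_eq (fun c => (c.1 < i)%N && (c.2 < j)%N) (fun c => (c.1 < i)%N)); last first.
      by move=> c /ok /implyP; case: (_ < i)%N => //= ->.
    by apply/min_idPl; apply: sum_le => c /andP[].
  rewrite (@sum_eq (fun c => (c.1 < i)%N && (c.2 < j)%N) (fun c => (c.2 < j)%N)); last first.
    by move=> c /ok /implyP; case: (_ < j)%N => //= [->|_] //; rewrite andbF.
  by apply/min_idPr; apply: sum_le => c /andP[].
apply: funext => -[i j]; rewrite /couple.
have [ij|ij] := boolP ((i, j) \in grid 4 3); last first.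
  by rewrite tf //; apply: contra ij; exact: fg.
have /andP[i4 j3] : (i < 4)%N && (j < 3)%N by rewrite -mem_grid.
rewrite /coupling /= !HE // ?(ltnW i4) ?(ltnW j3) // ?ltnS ?(ltnW i4) ?(ltnW j3) //.
have HS (p : pred (nat * nat)) : \sum_(c <- grid 4 3 | p c) t c =
    \sum_(c <- grid 4 3) (p c)%:R * t c.
  by rewrite big_mkcond; apply: eq_bigr => c _; case: (p c); rewrite ?mul1r ?mul0r.
rewrite /H !HS -!sumrB (eq_bigr (fun c => (c == (i, j))%:R * t c)); last first.
  move=> [k l] _; rewrite -!mulrBl; congr (_ * _).
  rewrite -[_ == _]/((k == i) && (l == j)) /= !ltnS.
  by case: (ltngtP k i) => _; case: (ltngtP l j) => _ /=; ring.
have c0 c : c \in grid 4 3 -> c != (i, j) -> (c == (i, j))%:R * t c = 0.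
  by move=> _ /negPf ->; rewrite mul0r.
have ug : uniq (grid 4 3) by [].
by rewrite (big_only ij ug c0) eqxx mul1r.
Qed.

(** The coupling and the pair of marginals are inverse to each other. *)
Lemma product_param : exists h : (sphere R 2 * sphere R 1)%type -> {ptws (nat * nat)%type -> R},
  param product_facets h.
Proof.
have [h2 [c2 i2 g2 s2]] := @simplex_boundary_param R 2 nat (iota 0 4) isT erefl.
have [h1 [c1 i1 g1 s1]] := @simplex_boundary_param R 1 nat (iota 0 3) isT erefl.
exists (fun z => couple (h2 z.1) (h1 z.2)); split.
- apply: continuous_ptws => c; rewrite /couple; case: (c \in grid 4 3); last exact: cont_cst.
  have cu2 k : continuous (fun z : (sphere R 2 * sphere R 1)%type => cumul (h2 z.1) k).
    apply: cont_sum => l z.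
    apply: (@continuous_comp _ (sphere R 2) R fst (fun z => h2 z l)); first exact: cvg_fst.
    exact: (@continuous_comp _ {ptws nat -> R} R h2 (fun t => t l) _ (c2 z.1) (@continuous_coord R nat l _)).
  have cu1 k : continuous (fun z : (sphere R 2 * sphere R 1)%type => cumul (h1 z.2) k).
    apply: cont_sum => l z.
    apply: (@continuous_comp _ (sphere R 1) R snd (fun z => h1 z l)); first exact: cvg_snd.
    exact: (@continuous_comp _ {ptws nat -> R} R h1 (fun t => t l) _ (c1 z.2) (@continuous_coord R nat l _)).
  have cm i j : continuous (fun z : (sphere R 2 * sphere R 1)%type => cmin (h2 z.1) (h1 z.2) i j).
    exact: cont_min.
  by apply: cont_add; [apply: cont_add|apply: cont_opp; apply: cont_add] => //; exact: cont_opp.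
- move=> [z w] [z' w'] /= E; congr pair.
    apply: i2; apply: funext => k.
    by rewrite -(couple_row (g2 z) (g1 w)) E couple_row.
  apply: i1; apply: funext => k.
  by rewrite -(couple_col (g2 z) (g1 w)) E couple_col.
- by move=> z; apply: couple_geom; [exact: g2|exact: g1].
- move=> t /couple_marginals[hP hQ tE].
  have [z zP] := s2 _ hP; have [w wQ] := s1 _ hQ.
  by exists (z, w); rewrite /= zP wQ.
Qed.

Lemma product_homeo : homeomorphic (@geom R (nat * nat)%type product_facets)
  (sphere R 2 * sphere R 1)%type.
Proof.
have [h hp] := product_param; apply: param_homeo hp.
rewrite -setXTT; apply: compact_setX; exact: sphere_compact.
Qed.

End Product.

(** * Gluing along the torus with seven vertices *)

Ltac mod_lia := Zify.zify; Z.to_euclidean_division_equations; lia.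

(** The codes below 7 are the vertices of the common boundary torus, and those from
    7 to 19 label the interior vertices of a solid torus; [up] moves the latter out
    of the way before a second solid torus is glued to a first one. *)
Definition affine7 (k s c : N) : N := (if c <? 7 then (k * c + s) mod 7 else c)%num.
Definition up (c : N) : N := (if c <? 7 then c else c + 20)%num.

Definition affine (k s : N) (X : seq (seq N)) := map (map (affine7 k s)) X.
Definition amalgam (X Y : seq (seq N)) := X ++ map (map up) Y.
Definition small (X : seq (seq N)) := all (all (fun c => c <? 20)%num) X.

(** The multiplications by the squares modulo 7 are, with the translations, the
    symmetries of the torus which occur; [k'] is the inverse of [k]. *)
Definition square7 (k k' : N) := (k, k') \in [:: (1, 1); (2, 4); (4, 2)]%num.

Lemma ltbT a b : (a < b)%num -> (a <? b)%num = true. Proof. by move/N.ltb_lt. Qed.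
Lemma ltbF a b : (b <= a)%num -> (a <? b)%num = false. Proof. by move/N.ltb_ge. Qed.

Lemma mod7_lt x : (x mod 7 < 7)%num.
Proof. exact: N.mod_lt. Qed.

Lemma mod7_ltb x : (x mod 7 <? 7)%num.
Proof. exact/N.ltb_lt/mod7_lt. Qed.

Lemma affine7K k k' s : square7 k k' -> cancel (affine7 k s) (affine7 k' (6 * k' * s)).
Proof.
rewrite /square7 /affine7 !inE => kk' c; case: (N.ltb_spec c 7) => c7; last first.
  by rewrite (ltbF c7).
rewrite mod7_ltb.
case/or3P: kk' => /eqP[-> ->]; mod_lia.
Qed.

Lemma affine7_comp k s l t c : affine7 k s (affine7 l t c) = affine7 (k * l) (k * t + s) c.
Proof.
rewrite /affine7; case: (N.ltb_spec c 7) => c7; last first.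
  by rewrite (ltbF c7).
rewrite mod7_ltb.
rewrite N.Div0.add_mod N.Div0.mul_mod_idemp_r -N.Div0.add_mod.
by congr (_ mod 7)%num; lia.
Qed.

Lemma affine7_mod k s l t c : (k mod 7 = l mod 7)%num -> (s mod 7 = t mod 7)%num ->
  affine7 k s c = affine7 l t c.
Proof.
move=> kl st; rewrite /affine7; case: ifP => // _.
by rewrite N.Div0.add_mod N.Div0.mul_mod kl st -N.Div0.mul_mod -N.Div0.add_mod.
Qed.

Lemma affine7_up k s c : up (affine7 k s c) = affine7 k s (up c).
Proof.
rewrite /affine7 /up; case: (N.ltb_spec c 7) => c7.
  by rewrite mod7_ltb (ltbT c7).
rewrite (ltbF c7) ltbF //; lia.
Qed.

Lemma eq_affine k s l t X : (k mod 7 = l mod 7)%num -> (s mod 7 = t mod 7)%num ->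
  affine k s X = affine l t X.
Proof. by move=> kl st; apply: eq_map => f; apply: eq_map => c; exact: affine7_mod. Qed.

Lemma affine_comp k s l t X : affine k s (affine l t X) = affine (k * l) (k * t + s) X.
Proof.
rewrite /affine -map_comp; apply: eq_map => f /=; rewrite -map_comp.
by apply: eq_map => c /=; exact: affine7_comp.
Qed.

Lemma affine_id X : affine 1 0 X = X.
Proof.
rewrite /affine map_id_in // => f _; rewrite map_id_in // => c _.
rewrite /affine7; case: (N.ltb_spec c 7) => // c7; rewrite N.mul_1_l N.add_0_r.
exact: N.mod_small.
Qed.

Lemma affineK k k' s X : square7 k k' -> affine k' (6 * k' * s) (affine k s X) = X.
Proof.
move=> kk'; rewrite /affine -map_comp map_id_in // => f _ /=.
by rewrite -map_comp map_id_in // => c _ /=; rewrite affine7K.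
Qed.

Lemma affineKV k k' s X : square7 k k' -> affine k s (affine k' (6 * k' * s) X) = X.
Proof.
move=> kk'; rewrite affine_comp -[RHS]affine_id; apply: eq_affine; move: kk';
  rewrite /square7 !inE => /or3P[]/eqP[-> ->]; mod_lia.
Qed.

Lemma small_affine k s X : small (affine k s X) = small X.
Proof.
rewrite /small /affine all_map; apply: eq_all => f /=; rewrite all_map; apply: eq_all => c /=.
rewrite /affine7; case: (N.ltb_spec c 7) => // c7.
have h := mod7_lt (k * c + s).
by rewrite !ltbT //; lia.
Qed.

Lemma amalgam_affine k s X Y : amalgam (affine k s X) (affine k s Y) = affine k s (amalgam X Y).
Proof.
rewrite /amalgam /affine map_cat; congr (_ ++ _).
rewrite -!map_comp; apply: eq_map => f /=; rewrite -!map_comp; apply: eq_map => c /=.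
exact: affine7_up.
Qed.

Section Gluing.
Variable R : realType.

Definition equihomeo (X Y : seq (seq N)) := homeomorphic (@geom R N X) (@geom R N Y).
Local Notation "X ~ Y" := (equihomeo X Y) (at level 70).

Lemma affine_homeo k k' s X : square7 k k' -> affine k s X ~ X.
Proof.
move=> kk'; apply: homeo_sym.
apply: (@relabel_homeo R N N (affine7 k s) (affine7 k' (6 * k' * s))).
by move=> f x _ _; exact: affine7K.
Qed.

Lemma amalgam_sym X Y : small X -> small Y -> amalgam X Y ~ amalgam Y X.
Proof.
move=> sX sY.
pose sw (c : N) : N := (if c <? 7 then c else if c <? 27 then c + 20 else c - 20)%num.
have sw_small Z : small Z -> map (map sw) Z = map (map up) Z.
  move=> /allP sZ; apply/eq_in_map => f /sZ /allP sf; apply/eq_in_map => c /sf /N.ltb_lt c20.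
  rewrite /sw /up; case: (N.ltb_spec c 7) => // c7.
  by rewrite ltbT //; lia.
have sw_up Z : small Z -> map (map sw) (map (map up) Z) = Z.
  move=> /allP sZ; rewrite -map_comp map_id_in // => f /sZ /allP sf /=.
  rewrite -map_comp map_id_in // => c /sf /N.ltb_lt c20 /=.
  rewrite /sw /up; case: (N.ltb_spec c 7) => c7; first by rewrite ltbT.
  rewrite ltbF; last lia.
  rewrite ltbF; lia.
rewrite /equihomeo (_ : @geom R N (amalgam Y X) = geom (map (map sw) (amalgam X Y))); last first.
  rewrite /amalgam map_cat sw_up // sw_small //.
  by rewrite !geomU setUC.
apply: (@relabel_homeo R N N sw sw) => f c; rewrite /amalgam mem_cat => /orP[fX|fX] cf.
  have /N.ltb_lt c20 : (c <? 20)%num by exact: allP (allP sX f fX) c cf.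
  rewrite /sw; case: (N.ltb_spec c 7) => c7; first by rewrite ltbT.
  rewrite (@ltbT c 27); last lia.
  rewrite ltbF; last lia.
  rewrite ltbF; lia.
case/mapP: fX => g gY fE; move: cf; rewrite fE => /mapP[d dg ->].
have /N.ltb_lt d20 : (d <? 20)%num by exact: allP (allP sY g gY) d dg.
rewrite /up; case: (N.ltb_spec d 7) => d7.
  by rewrite /sw ltbT // ltbT.
rewrite /sw (@ltbF (d + 20) 7); last lia.
rewrite (@ltbF (d + 20) 27); last lia.
rewrite N.add_sub ltbF // ltbT //; lia.
Qed.

(** A substitute for a homeomorphism from [X] to [X'] relative to the boundary
    torus, stated by its effect on all gluings. *)
Definition exchangeable (X X' : seq (seq N)) :=
  forall Y, small Y -> amalgam X Y ~ amalgam X' Y.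

Lemma exchangeable_trans X Y Z : exchangeable X Y -> exchangeable Y Z -> exchangeable X Z.
Proof. by move=> XY YZ W sW; exact: homeo_trans (XY W sW) (YZ W sW). Qed.

Lemma exchangeable_sym X Y : exchangeable X Y -> exchangeable Y X.
Proof. by move=> XY W sW; exact: homeo_sym (XY W sW). Qed.

Lemma exchangeable_affine k k' s X X' : square7 k k' -> exchangeable X X' ->
  exchangeable (affine k s X) (affine k s X').
Proof.
move=> kk' XX' Y sY; rewrite -(affineKV s Y kk') !amalgam_affine.
apply: homeo_trans (affine_homeo _ _ kk') _.
apply: homeo_trans (homeo_sym (affine_homeo _ _ kk')).
by apply: XX'; rewrite small_affine.
Qed.

Definition inner_label (c : N) : bool := (7 <=? c)%num && (c <? 20)%num.

(** If both sides of a move have an interior vertex, neither of them is a face of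
    the complex glued on the other side of the torus. *)
Lemma exchangeable_reduces ms X X' :
  all (fun m => has inner_label m.1 && has inner_label m.2) ms ->
  reduces (@single_move N) ms X X' -> exchangeable X X'.
Proof.
move=> /allP int red Y /allP sY; apply: reduces_homeo (reduces_cat _ red).
apply/allP => _ /mapP[g gY ->]; apply/allP => m /int /andP[i1 i2].
have up_ext c : c \in map up g -> ~~ inner_label c.
  move=> /mapP[d dg ->]; have /N.ltb_lt d20 : (d <? 20)%num by exact: allP (sY g gY) d dg.
  rewrite /up /inner_label; case: (N.ltb_spec d 7) => d7.
    by rewrite (proj2 (N.leb_gt _ _)).
  by rewrite negb_and (@ltbF (d + 20) 20) ?orbT //; lia.
by apply/andP; split; apply/negP => /subP mg; [case/hasP: i1|case/hasP: i2] => c /mg /up_ext /negP.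
Qed.

(** The renaming extends by the identity to what is glued on the other side. *)
Lemma exchangeable_rename (h g : N -> N) X X' :
  all (fun x => (g (h x) == x) && (((x <? 7) || (20 <=? x))%num ==> (h x == x))) (iotaN 40) ->
  small X -> same (map (map h) X) X' -> exchangeable X X'.
Proof.
move=> /allP hg /allP sX /same_geom hX Y /allP sY.
have hgP x : (x < 40)%num -> g (h x) = x /\ ((x < 7)%num \/ (20 <= x)%num -> h x = x).
  move=> x40; have /hg/andP[/eqP gh /implyP hx] : x \in iotaN 40.
    by rewrite mem_iotaN; apply/N.ltb_lt.
  split=> // x7; apply/eqP/hx.
  by case: x7 => [/N.ltb_lt ->//|/N.leb_le ->]; rewrite orbT.
have upE f c : f \in Y -> c \in map up f -> (c < 40)%num /\ ((c < 7)%num \/ (20 <= c)%num).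
  move=> fY /mapP[d df ->]; have /N.ltb_lt d20 : (d <? 20)%num by exact: allP (sY f fY) d df.
  by rewrite /up; case: (N.ltb_spec d 7) => d7; split; lia.
have -> : amalgam X' Y = X' ++ map (map h) (map (map up) Y).
  rewrite /amalgam; congr (_ ++ _); apply/esym; rewrite map_id_in // => _ /mapP[f fY ->].
  by rewrite map_id_in // => c /(upE f c fY)[c40 /(proj2 (hgP c c40))].
rewrite /equihomeo (geomU R X') -(hX R) -geomU -map_cat.
apply: (@relabel_homeo R N N h g) => f c; rewrite mem_cat => /orP[fX|/mapP[f' f'Y ->]] cf.
  have /N.ltb_lt c20 : (c <? 20)%num by exact: allP (sX f fX) c cf.
  by apply: (proj1 (hgP c _)); lia.
by apply: (proj1 (hgP c _)); case: (upE f' c f'Y cf).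
Qed.

End Gluing.

(** * The solid tori and the reductions *)

(** In the complexes below 7, 8, 9 are the codes of [u], [v], [w], and those from 10
    on are the codes of the [q_i], or of [a], [b], [c]. In an amalgam the interior
    vertices of the second complex are increased by 20. A move [<A|B>] exchanges
    [A] for [B]; in the lists of moves of coverings it stands for its orbit. *)
Local Notation "< a .. b >" := (cons a .. (cons b nil) ..) (a at level 0, b at level 0).
Local Notation "< a .. b | c .. d >" :=
  (cons a .. (cons b nil) .., cons c .. (cons d nil) ..)
  (a at level 0, b at level 0, c at level 0, d at level 0).

Definition cyclic_torus : seq (seq N) := [::
  <0 1 2 3>; <1 2 3 4>; <2 3 4 5>; <3 4 5 6>; <0 4 5 6>; <0 1 5 6>; <0 1 2 6> ]%num.

Definition torus_uv : seq (seq N) := [::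
  <7 0 1 2>; <7 0 1 3>; <7 0 2 3>; <7 1 2 4>; <7 1 3 4>; <7 2 3 5>; <7 2 4 5>; <8 3 4 6>;
  <8 3 5 6>; <8 0 4 5>; <8 0 4 6>; <8 0 1 5>; <8 1 5 6>; <8 0 1 2>; <8 0 2 6>; <8 1 2 6>;
  <7 8 3 4>; <7 8 3 5>; <7 8 4 5> ]%num.

Definition torus_uvw : seq (seq N) :=
  [seq f <- torus_uv | f \notin [:: <7 0 1 2>; <8 0 1 2> ]%num] ++
  [:: <7 9 0 1>; <7 9 0 2>; <7 9 1 2>; <8 9 0 1>; <8 9 0 2>; <8 9 1 2> ]%num.

Definition torus_abc : seq (seq N) := [::
  <7 9 0 1>; <7 9 1 2>; <7 9 2 3>; <7 9 3 4>; <7 9 0 4>; <9 11 0 1>; <9 12 1 2>; <9 2 3 5>;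
  <9 3 4 6>; <9 0 4 6>; <9 10 11 0>; <9 11 12 1>; <9 12 2 5>; <9 3 5 6>; <9 10 0 6>; <8 9 10 11>;
  <8 9 11 12>; <8 9 12 5>; <8 9 5 6>; <8 9 10 6>; <8 10 2 3>; <8 11 3 4>; <8 0 4 5>; <8 0 1 5>;
  <8 1 2 6>; <8 10 11 3>; <8 11 12 4>; <8 12 4 5>; <8 1 5 6>; <8 10 2 6>; <7 8 0 1>; <7 8 1 2>;
  <7 8 2 3>; <7 8 3 4>; <7 8 0 4>; <10 11 0 3>; <11 12 1 4>; <10 0 2 3>; <10 0 2 6>; <11 0 1 3>;
  <11 1 3 4>; <12 1 2 4>; <12 2 4 5> ]%num.

(** What [abc_moves] leave of [torus_abc]: the vertices [u] and [c] are gone. *)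
Definition reduced_abc : seq (seq N) := [::
  <3 5 6 9>; <2 3 8 10>; <1 2 6 8>; <3 8 10 11>; <2 6 8 10>; <0 1 5 8>; <1 2 8 9>; <2 4 5 11>;
  <0 6 9 11>; <3 4 6 9>; <1 5 6 8>; <5 6 9 11>; <0 4 6 9>; <0 3 10 11>; <0 4 8 9>; <0 1 9 11>;
  <3 4 8 11>; <0 6 10 11>; <0 1 8 9>; <5 6 8 11>; <1 2 9 11>; <1 2 4 11>; <1 3 4 11>; <3 4 8 9>;
  <2 5 9 11>; <6 8 10 11>; <2 3 8 9>; <4 5 8 11>; <0 1 3 11>; <0 2 6 10>; <0 4 5 8>; <0 2 3 10>;
  <2 3 5 9> ]%num.

Definition abc_moves := [::
  <8 9 12|5 11>; <1 9 11|0 12>; <5 9 12|2 11>; <0 9 10|6 11>; <8 9 11|5 10>; <0 12|1 9 11>;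
  <8 12|4 5 11>; <5 10|8 9 11>; <9 12|1 2 11>; <9 10|6 8 11>; <8 9|5 6 11>; <1 12|2 4 11>;
  <12|2 4 5 11>; <2 3 7|8 9>; <2 7|1 8 9>; <1 7|0 8 9>; <0 7|4 8 9>; <7|3 4 8 9> ]%num.

Definition reduced_abc_shift_moves := [::
  <6 8 11|5 10>; <5 8 11|4 10>; <2 3 8|9 10>; <2 6 8|1 10>; <2 8|1 9 10>; <8 11|3 4 10>;
  <3 8|4 9 10>; <6 8|1 5 10> ]%num.

Definition uvw_moves := [::
  <7 9|0 1 2>; <9|0 1 2 8> ]%num.

Definition uv_moves := [::
  <7 8|3 4 5>; <2 8|0 1 6>; <1 8|0 5 6>; <3 8|4 5 6>; <8|0 4 5 6>; <0 7|1 2 3>; <5 7|2 3 4>;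
  <7|1 2 3 4> ]%num.

Definition cyclic_abc1_moves := [::
  <3 6|4 5 29>; <1 4|2 3 31>; <1 5|0 6 28>; <4 6|0 5 29>; <1 3|0 2 31>; <0 3|2 30 31>;
  <6 29|0 5 31>; <2 4|3 5 31>; <4 31|3 5 28>; <3 4|5 28 29>; <4|0 5 28 29>; <1 6|0 2 28>;
  <1 28|0 2 29>; <1|0 2 29 31>; <2 6|0 28 30>; <2 5|3 29 31>; <3 5|28 29 31>; <5 6|0 28 31>;
  <6|0 28 30 31>; <5|0 28 29 31>; <3 30|2 28 31>; <3|2 28 29 31>; <29|0 2 28 31> ]%num.

Definition cyclic_abc2_moves := [::
  <2 5|3 4 28>; <0 3|1 2 28>; <0 28|1 2 29>; <3 6|4 5 29>; <3 29|4 5 31>; <2 3|1 4 28>;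
  <1 5|0 6 29>; <1 3|4 28 31>; <3|4 5 28 31>; <2 28|1 4 29>; <5 28|4 30 31>; <0 4|5 6 30>;
  <28 29|1 4 6>; <0 1|2 6 29>; <28 30|4 6 31>; <28|1 4 6 31>; <1 29|2 4 6>; <1|2 4 6 31>;
  <2 4|6 29 31>; <2|0 6 29 31>; <0 29|5 6 31>; <0|5 6 30 31>; <29|4 5 6 31> ]%num.

Definition q_abc1_moves := [::
  <3 8 12|4 11>; <2 3 28|29 30>; <4 9 15|3 16>; <2 5 14|3 13>; <3 9 15|14 16>; <4 5 9|7 16>;
  <3 6 15|4 14>; <5 9 16|7 10>; <5 9|6 7 10>; <29 30|2 3 28>; <4 14|3 6 15>; <3 13|2 5 14>;
  <4 9|3 7 16>; <14 16|3 9 15>; <4 11|3 8 12>; <0 1 9|7 12>; <3 4 15|6 16>; <2 3 5|14 29>;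
  <4 15|0 6 16>; <3 5|6 14 29>; <0 15|6 8 16>; <7 12|0 1 9>; <2 5 29|14 31>; <4 7 16|3 5>;
  <14 31|2 5 29>; <3 5|4 7 16>; <8 9 15|14 16>; <8 12 13|4 9>; <6 7 9|0 10>; <3 4 6|16 29>;
  <8 9 12|4 11>; <1 5 6|10 28>; <8 15|6 14 16>; <8 12|3 4 11>; <1 6|2 10 28>; <9 15|3 14 16>;
  <15|3 6 14 16>; <0 10|6 7 9>; <4 6|0 16 29>; <12 13|1 4 9>; <1 13|2 4 9>; <3 6|14 16 29>;
  <6 28 31|5 30>; <0 4 29|16 28>; <2 13 14|5 9>; <5 6 14|8 29>; <5 30|6 28 31>; <0 4|5 16 28>;
  <6 14|8 16 29>; <6 16|0 8 29>; <5 9|2 13 14>; <0 5|1 16 28>; <1 5|10 16 28>; <4 29|3 16 28>;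
  <0 28|1 16 29>; <0 16|1 8 29>; <2 6 28|10 30>; <2 4 9|1 13>; <2 10 28|1 30>; <3 14 16|9 29>;
  <3 7 9|2 16>; <4 8 13|5 9>; <3 14|2 9 29>; <5 9|4 8 13>; <3 9|2 16 29>; <1 13|2 4 9>;
  <1 30|2 10 28>; <14 16|8 9 29>; <10 30|2 6 28>; <3 29|2 16 28>; <28 29|1 2 16>; <1 28|2 10 16>;
  <1 10|2 8 16>; <1 16|2 8 29>; <16 29|2 8 9>; <9 29|2 8 14>; <9 14|2 8 13>; <9 13|2 4 8>;
  <8 16|2 9 10>; <14 29|2 5 8>; <14|2 5 8 13>; <13|2 4 5 8>; <8 10|2 9 11>; <9 16|2 7 10>;
  <8 9|2 4 11>; <10 11|2 6 9>; <9 10|2 6 7>; <6 11|0 2 9>; <8 11|2 3 4>; <6 9|0 2 7>; <7 9|0 1 2>;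
  <1 7|0 2 8>; <0 7|2 6 8>; <3 8|2 4 7>; <3 7|2 4 16>; <3 16|2 4 28>; <4 8|2 5 7>; <4 7|2 5 16>;
  <7 8|2 5 6>; <1 8|0 2 29>; <1 29|0 2 31>; <4 16|2 5 28>; <16 28|2 5 10>; <16|2 5 7 10>;
  <7|2 5 6 10>; <10|2 5 6 28>; <0 8|2 6 29>; <8|2 5 6 29>; <4 5|2 28 31>; <4 28|2 3 31>;
  <0 29|2 6 31>; <29|2 5 6 31>; <5|2 6 28 31>; <0 6|2 30 31>; <6|2 28 30 31>; <28|2 3 30 31>;
  <30|0 2 3 31>; <4 31|1 2 3>; <31|0 1 2 3>; <1 9 12|0 4>; <2 4 11|3 9>; <0 2 9|1 11>;
  <0 1 3|2 12>; <9 12|0 4 11>; <0 9|1 4 11>; <2 12|0 1 3>; <11 12|0 3 4>; <12|0 1 3 4>;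
  <0 2|1 3 11>; <0|1 3 4 11>; <2 4|1 3 9>; <4|1 3 9 11> ]%num.

(** A list of labels renumbers the vertices of an amalgam so that those which
    survive in the final join come first; the lifts are the facets of the covering
    in terms of these numbers. *)
Definition cyclic_abc4_labels : seq N := [::
  3; 5; 6; 29; 0; 1; 2; 4; 28; 30; 31]%num.

Definition cyclic_abc4_lifts := [::
  <2 7 10 17>; <0 6 8 20>; <4 7 10 21>; <0 3 6 12>; <0 6 8 12>; <0 3 5 6>; <6 8 14 20>;
  <0 3 5 15>; <6 8 12 16>; <2 4 8 14>; <7 10 15 17>; <0 10 15 17>; <0 5 15 17>; <2 8 14 20>;
  <10 12 15 21>; <0 17 18 20>; <2 8 10 18>; <6 8 14 16>; <2 4 8 10>; <4 10 12 21>; <0 5 17 20>;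
  <0 10 17 18>; <2 8 18 20>; <0 3 12 15>; <0 10 12 15>; <4 12 16 21>; <2 17 18 20>; <0 8 10 18>;
  <4 8 14 16>; <7 10 15 21>; <4 8 12 16>; <2 10 17 18>; <0 8 18 20>; <3 6 12 16>; <2 4 7 10>;
  <4 8 10 12>; <0 8 10 12>; <3 12 16 21>; <0 5 6 20>; <3 12 15 21> ]%num.

Definition cyclic_abc4_moves := [::
  <1 19 21|9 16>; <9 15 21|3 7>; <9 15 17|5 7>; <2 4 14|1 8>; <0 10 15|12 17>; <0 18|8 10 17>;
  <8 16|4 6 12>; <10 18|2 8 17>; <18|2 8 17 20>; <2 6|8 14 20>; <12 17|0 10 15>; <1 8|2 4 14>;
  <9 11 16|1 3>; <12 16 21|3 4>; <11 14 16|1 6>; <0 5 6|3 20>; <11 13 20|5 14>; <9 15 21|3 7>;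
  <9 11 13|1 5>; <12 21|3 4 15>; <9 15|3 5 7>; <11 13|1 5 14>; <9 13|1 5 7>; <8 10|0 2 4>;
  <2 21|1 4 7>; <8 17|0 2 20>; <10 17|0 2 7>; <16 21|1 3 4>; <9 21|1 3 7>; <9|1 3 5 7>;
  <11 20|5 6 14>; <15 17|0 5 7>; <13 14|1 2 5>; <5 15|0 3 7>; <14 20|2 5 6>; <21|1 3 4 7>;
  <13 17|2 5 7>; <13|1 2 5 7>; <17|0 2 5 7>; <11 14|1 5 6>; <11|1 3 5 6>; <15|0 3 4 7> ]%num.

Definition abc_abc2_labels : seq N := [::
  0; 6; 1; 2; 3; 4; 5; 8; 9; 10; 11; 28; 29; 30; 31]%num.

Definition abc_abc2_lifts := [::
  <5 12 19 26>; <9 12 23 27>; <4 6 10 21>; <12 23 27 30>; <3 9 23 27>; <0 6 18 21>; <12 19 37 43>;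
  <0 6 33 36>; <15 18 35 39>; <6 10 21 24>; <4 6 33 36>; <9 16 19 32>; <0 18 36 42>; <3 35 39 42>;
  <0 9 33 36>; <5 12 17 26>; <5 12 17 37>; <6 10 17 43>; <12 17 37 43>; <0 6 24 30>; <4 6 10 43>;
  <0 18 39 42>; <0 3 9 42>; <18 35 39 42>; <0 3 27 30>; <0 6 21 24>; <9 16 36 42>; <6 12 17 43>;
  <4 18 21 31>; <6 10 24 30>; <6 12 17 30>; <12 17 23 26>; <9 19 26 32>; <3 23 27 30>;
  <15 18 21 31>; <4 6 18 36>; <0 15 18 21>; <9 12 19 26>; <0 3 39 42>; <0 15 18 39>; <0 6 12 33>;
  <0 9 36 42>; <5 12 19 37>; <0 3 24 30>; <6 12 33 43>; <4 6 33 43>; <4 6 18 21>; <4 18 25 31>;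
  <3 15 35 39>; <9 12 19 33>; <3 15 35 38>; <0 3 15 24>; <0 12 27 30>; <0 15 21 24>; <0 6 18 36>;
  <9 16 33 36>; <12 17 23 30>; <0 9 12 33>; <12 19 33 43>; <9 16 19 33>; <6 10 17 30>;
  <9 12 23 26>; <0 6 12 30>; <0 3 9 27>; <0 3 15 39>; <0 9 12 27> ]%num.

Definition abc_abc2_moves := [::
  <8 35 38|2 3>; <2 35 38|3 11>; <0 12 27|9 30>; <7 37|1 5 19>; <1 28|4 10 31>; <13 28|10 21 31>;
  <28|4 10 21 31>; <34 37|5 10 17>; <7 19|1 5 22>; <9 23 26|8 12>; <15 21 24|0 13>;
  <23 26|2 8 12>; <16 25|1 4 14>; <3 24 30|0 20>; <8 9 23|3 12>; <1 7 31|13 25>; <9 23|3 12 30>;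
  <8 23|2 3 12>; <2 19|5 26 32>; <12 24|0 6 30>; <9 30|0 3 12>; <1 19 22|5 16>; <20 23|3 17 30>;
  <23 30|3 12 17>; <23|2 3 12 17>; <5 11 14|2 7>; <2 7|5 11 14>; <3 20 24|13 30>; <12 19 37|5 43>;
  <11 18 31|15 25>; <15 25|11 18 31>; <5 26|2 12 32>; <20 24|10 13 30>; <18 36|0 4 42>;
  <1 37|5 10 43>; <10 24|6 13 30>; <25|1 7 14 31>; <12 37|5 17 43>; <36|4 9 16 42>;
  <6 12 33|0 43>; <3 15 39|0 35>; <2 42|8 14 35>; <1 33|4 16 40>; <3 39 42|0 35>; <7 15 31|11 13>;
  <2 34|5 41 44>; <7 15|11 13 44>; <16 42|4 9 14>; <5 17 41|2 34>; <5 10 43|1 12>; <2 11 44|5 13>;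
  <10 43|4 6 12>; <1 33|4 16 40>; <7 44|5 13 34>; <4 42|0 14 18>; <8 35|2 3 14>; <1 34|5 10 13>;
  <0 18 39|15 42>; <10 12 30|6 17>; <7 15|11 13 31>; <20 41|17 34 44>; <35 39|3 15 42>;
  <41|2 5 17 44>; <3 20 30|13 17>; <1 7 14|5 31>; <3 20|2 13 17>; <7 14|5 11 31>; <2 20|13 17 44>;
  <2 8|3 14 32>; <8|3 9 14 32>; <19 32|9 12 16>; <10 20|13 17 34>; <19|12 16 33 43>;
  <1 43|4 12 16>; <42|3 14 15 35>; <34|5 10 13 17>; <4 13 31|1 15>; <3 13 17|2 30>;
  <12 16 32|1 9>; <2 16|5 14 32>; <13 17|2 5 10>; <5 16|1 14 32>; <16 32|1 9 14>; <16|1 4 9 14>;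
  <0 4 30|12 13>; <5 10 13|1 2>; <1 10 13|2 4>; <13 14|1 5 31>; <4 9|0 1 14>; <1 10|2 4 12>;
  <11 13|0 5 31>; <10|2 4 13 30>; <3 13|0 2 30>; <3 30|0 2 12>; <14 32|1 2 3>; <31|0 1 5 14>;
  <0 1 14|3 5>; <0 1 3|5 12>; <4 14|0 2 5>; <1 12|0 3 4>; <13|0 1 4 5> ]%num.

Definition q_abc2_labels : seq N := [::
  3; 6; 0; 1; 2; 4; 5; 7; 8; 9; 10; 11; 12; 13; 14; 15; 16; 28; 29; 30; 31]%num.

Definition q_abc2_lifts := [::
  <0 39 56 62>; <8 36 44 48>; <5 24 29 33>; <32 37 40 64>; <0 22 31 35>; <0 25 73 81>;
  <8 12 68 72>; <20 24 71 76>; <16 35 43 44>; <5 12 24 40>; <5 12 68 72>; <4 16 43 44>;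
  <8 24 72 80>; <4 71 76 80>; <0 22 31 39>; <0 16 31 35>; <8 16 68 72>; <16 21 25 55>;
  <32 37 49 53>; <8 32 60 64>; <8 20 24 64>; <0 6 22 73>; <12 17 22 81>; <0 8 16 44>;
  <24 33 54 59>; <0 22 73 81>; <16 39 55 56>; <0 16 31 39>; <12 22 48 52>; <0 8 12 48>;
  <5 12 17 81>; <8 24 76 80>; <20 37 60 64>; <4 8 28 32>; <0 6 25 56>; <4 8 16 80>; <0 6 22 62>;
  <4 32 58 60>; <12 32 40 64>; <24 71 76 80>; <12 17 28 32>; <16 21 72 80>; <0 12 22 81>;
  <0 35 44 48>; <12 17 32 40>; <8 20 60 64>; <5 24 37 40>; <4 8 28 36>; <8 12 32 64>;
  <5 12 24 72>; <12 17 36 52>; <20 24 37 64>; <20 24 29 33>; <32 37 60 64>; <4 8 32 60>;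
  <0 22 35 48>; <4 8 76 80>; <0 12 22 48>; <5 24 33 59>; <8 20 24 76>; <5 24 29 37>;
  <32 37 53 58>; <0 8 44 48>; <12 24 40 64>; <0 8 12 68>; <8 16 72 80>; <8 12 24 64>; <0 6 25 73>;
  <8 12 28 36>; <5 12 17 40>; <4 8 36 44>; <0 12 68 81>; <4 8 16 44>; <5 12 68 81>; <4 8 20 60>;
  <32 37 40 45>; <0 6 56 62>; <4 20 71 76>; <8 12 28 32>; <0 16 35 44>; <0 16 25 68>;
  <4 20 71 75>; <32 37 45 49>; <12 36 48 52>; <20 24 29 37>; <8 12 24 72>; <16 21 68 72>;
  <32 37 58 60>; <0 16 25 56>; <12 17 28 36>; <20 33 50 54>; <0 8 16 68>; <24 37 40 64>;
  <20 24 33 54>; <0 25 68 81>; <0 16 39 56>; <16 21 25 68>; <4 36 43 44>; <8 12 36 48>;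
  <4 8 20 76>; <12 17 22 52>; <16 25 55 56>; <0 22 39 62> ]%num.

Definition q_abc2_moves := [::
  <34 56 62|6 39>; <3 11 51|15 47>; <56 62|0 6 39>; <3 61|5 21 38>; <9 49|13 37 45>;
  <5 21 61|9 38>; <35 44 48|0 36>; <23 27 79|11 70>; <10 69|22 26 78>; <46 50|2 14 38>;
  <15 47|3 11 39>; <23 63|11 36 67>; <22 66|10 26 39>; <63 67|11 35 36>; <61|5 9 33 38>;
  <7 11 23|36 79>; <19 38 59|3 54>; <19 59|3 24 54>; <39 78|6 10 22>; <3 38 59|5 54>;
  <1 57|7 26 52>; <38 59|5 33 54>; <59|5 24 33 54>; <9 25 73|13 81>; <10 38 46|2 6>;
  <14 82|10 26 74>; <9 45|1 5 17>; <3 15 21|51 80>; <7 39 47|3 42>; <38 46|2 33 41>;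
  <6 46|2 18 41>; <44|0 16 35 43>; <51 80|3 15 21>; <33 38 41|2 65>; <6 10 82|18 78>;
  <12 40 64|24 32>; <13 65|9 25 33>; <17 77|5 9 81>; <0 67|35 36 43>; <43 67|27 35 36>;
  <67|11 27 35 36>; <2 10 70|14 18>; <15 21 80|3 16>; <8 20 37|4 24>; <20 83|2 19 75>;
  <8 68|12 16 72>; <10 22|6 26 78>; <8 37|4 24 32>; <21 77|5 25 68>; <11 79|7 27 83>;
  <78|6 26 69 82>; <20 24 54|19 33>; <17 35|22 26 52>; <0 22 48|12 35>; <12 35|0 22 48>;
  <23 70 74|7 18>; <9 73 81|17 25>; <73 81|0 17 25>; <9 73|13 17 25>; <22 73|0 6 17>;
  <3 72|5 16 24>; <24 72|5 12 16>; <72|5 12 16 68>; <9 81|5 17 25>; <22 69|6 17 26>;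
  <3 5 54|24 38>; <1 52|17 26 36>; <5 54|24 33 38>; <2 10 18|6 14>; <1 13 23|18 49>;
  <5 21 38|3 25>; <3 11|7 15 39>; <15 21|16 51 55>; <3 25|5 21 38>; <8 36|4 12 28>;
  <9 17|5 13 25>; <12 52|17 36 48>; <14 50|2 19 38>; <9 25|5 13 33>; <10|6 14 30 34>;
  <13 17 69|1 6>; <18 70|2 7 27>; <13 69|1 6 82>; <69|1 6 26 82>; <12 81|0 5 17>; <82|1 6 18 26>;
  <13 18 41|6 33>; <5 12 17|0 32>; <7 18 26|1 14>; <0 32|5 12 17>; <5 32|12 17 40>;
  <2 15|4 19 27>; <35 36 48|0 52>; <6 25 41|13 38>; <13 38|6 25 41>; <36 48|0 17 52>;
  <32 49|1 23 53>; <49|1 18 23 53>; <25 30 34|6 21>; <2 6 38|14 41>; <5 12 16|0 24>;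
  <2 26|7 14 18>; <12 43|0 4 36>; <27 28|4 23 36>; <20 24 33|5 54>; <26 35|7 36 52>;
  <12 24 40|5 32>; <15 43|4 16 35>; <24 40|5 32 37>; <17 40|1 5 32>; <43|0 4 35 36>;
  <6 25 39|0 55>; <12 16 24|4 5>; <0 4 12|16 36>; <18 38|2 6 14>; <18 26|1 6 7>; <27 37|2 18 53>;
  <14 26|6 7 34>; <24 32|4 5 37>; <25 38|5 6 21>; <15 19|3 4 7>; <23 28 32|1 4>; <1 4|23 28 32>;
  <5 12 17|0 32>; <20 29 33|2 5>; <15 31 35|7 16>; <20 33|2 5 54>; <3 35|4 15 16>; <34 55|3 6 39>;
  <29 33|2 5 18>; <14 34|6 7 19>; <7 14|2 6 19>; <20 29|2 5 37>; <35 36|0 4 7>; <34|3 6 7 19>;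
  <1 28|4 17 36>; <29|5 13 18 37>; <13|1 5 18 37>; <22 39|0 6 7>; <3 6 55|21 39>; <3 6 21|5 39>;
  <4 38|2 5 20>; <22 36|0 7 52>; <2 5 6|18 38>; <18 38|2 5 6>; <0 36 52|7 17>; <4 7 19|2 3>;
  <6 18|1 2 5>; <3 39|6 7 16>; <7 39|0 6 16>; <39|0 6 16 55>; <5 18|1 2 4>; <3 54|5 19 24>;
  <24 54|5 19 20>; <53|1 4 18 23>; <1 23|4 7 18>; <22|6 7 17 26>; <24|3 4 5 19>; <18|1 2 4 7> ]%num.

Definition q_abc4_labels : seq N := [::
  1; 0; 2; 3; 4; 5; 6; 7; 8; 9; 10; 11; 12; 13; 14; 15; 16; 28; 29; 30; 31]%num.

Definition q_abc4_lifts := [::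
  <15 49 70 78>; <0 31 93 103>; <5 45 55 60>; <25 31 36 41>; <40 46 50 80>; <15 23 39 44>;
  <5 10 15 90>; <10 44 54 55>; <0 25 31 50>; <5 20 90 100>; <10 30 54 55>; <15 23 39 49>;
  <10 15 39 44>; <5 10 85 90>; <10 22 27 69>; <40 46 61 66>; <5 40 75 80>; <5 20 25 80>;
  <0 15 23 88>; <15 23 33 88>; <5 20 25 100>; <0 11 23 103>; <5 10 15 55>; <25 41 67 73>;
  <10 49 69 70>; <5 20 85 90>; <0 23 60 65>; <0 5 15 60>; <0 11 31 103>; <0 15 88 95>;
  <5 25 95 100>; <10 15 39 49>; <15 27 33 70>; <20 46 75 80>; <15 33 88 100>; <5 30 35 40>;
  <15 23 33 78>; <30 40 72 75>; <10 30 85 102>; <0 40 50 80>; <25 88 95 100>; <0 11 35 40>;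
  <0 5 15 95>; <5 20 30 85>; <15 44 55 60>; <0 11 40 50>; <5 20 75 80>; <25 31 46 50>;
  <5 30 35 45>; <10 27 85 90>; <0 5 40 80>; <0 25 31 93>; <0 11 45 65>; <20 25 46 80>;
  <15 33 90 100>; <20 25 36 41>; <10 22 27 102>; <40 46 75 80>; <5 30 40 75>; <15 23 44 60>;
  <0 15 23 60>; <25 31 41 73>; <10 15 27 90>; <5 15 90 100>; <0 25 88 93>; <25 31 36 46>;
  <40 46 66 72>; <5 15 55 60>; <0 25 50 80>; <0 5 25 80>; <15 27 33 90>; <0 5 35 45>;
  <0 11 31 50>; <5 30 45 55>; <5 10 30 55>; <5 20 30 75>; <40 46 50 56>; <15 33 70 78>;
  <0 23 88 93>; <0 5 35 40>; <10 15 44 55>; <40 46 56 61>; <15 88 95 100>; <0 5 25 95>;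
  <0 45 60 65>; <20 25 36 46>; <40 46 72 75>; <10 15 27 70>; <0 11 35 45>; <20 41 62 67>;
  <25 46 50 80>; <0 23 93 103>; <20 25 41 67>; <5 10 30 85>; <0 25 88 95>; <5 15 95 100>;
  <10 15 49 70>; <30 45 54 55>; <0 5 45 60>; <0 11 23 65>; <10 27 85 102>; <10 27 69 70>;
  <15 23 49 78> ]%num.

Definition q_abc4_moves := [::
  <7 17 97|2 102>; <14 53 59|34 43>; <7 17 57|12 62>; <48 68 74|14 42>; <68 74|14 26 42>;
  <15 95|0 88 100>; <7 97|2 27 102>; <95|0 25 88 100>; <29 66|12 24 40>; <50 56|31 40 46>;
  <15 55|10 44 60>; <12 51|1 32 41>; <1 6 41|36 81>; <12 29 72|17 40>; <0 25 93|31 88>;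
  <10 39 49|4 15>; <33 43 78|8 70>; <8 13 58|33 63>; <16 44|11 28 71>; <32 62|7 12 57>;
  <32 89|1 26 94>; <38 83|3 8 43>; <7 74|32 42 77>; <11 35|0 16 40>; <44 54 84|4 45>;
  <42 52|2 33 48>; <32 51|1 26 47>; <54|4 29 45 84>; <41 57 62|12 47>; <4 39 49|9 15>;
  <13 33 58|8 42>; <11 46|40 56 61>; <14 59|9 43 64>; <56 61|6 40 46>; <57|7 32 41 47>;
  <12 62|7 17 41>; <1 36|6 17 41>; <10 30 44|4 5>; <20 25 36|41 46>; <15 27 70|10 33>;
  <4 9 84|29 44>; <8 23 78|33 83>; <43 78 83|8 49>; <3 28 34|49 91>; <9 45|44 79 84>;
  <31 40|0 6 46>; <40 45|24 29 35>; <18 25|13 31 93>; <46 93|0 25 31>; <14 43|3 9 19>;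
  <7 77|32 42 82>; <26 74|14 32 42>; <28 43|3 8 83>; <40 61 66|24 46>; <22 38 48|19 27>;
  <7 17 62|2 41>; <9 64|4 43 49>; <18 63|3 21 42>; <17 25|20 36 46>; <40 66|12 24 46>;
  <62 67|2 20 47>; <60|0 23 44 45>; <66|1 12 24 46>; <23 45|0 11 44>; <14 19 74|32 48>;
  <13 73|31 41 47>; <19 74|32 48 77>; <71|34 44 45 79>; <17 75|20 30 46>; <42 77|32 48 82>;
  <78|23 33 49 83>; <32 48 82|22 42>; <26 89 101|1 14>; <34 91 101|3 16>; <7 32 42|37 82>;
  <27 85|2 10 90>; <4 17|30 92 102>; <22 42|32 48 82>; <36 81|6 31 41>; <27 90|2 10 33>;
  <5 30 35|40 45>; <18 31 47|13 21>; <11 16 91|6 34>; <11 44 45|0 34>; <8 28 83|3 23>;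
  <32 37|26 42 47>; <6 34|11 16 91>; <1 21|6 26 81>; <27 38|22 43 48>; <7 37|18 42 47>;
  <38|19 22 43 48>; <3 32|14 42 48>; <5 16|0 40 45>; <11 24|16 34 45>; <11 23 103|0 28>;
  <8 23 88|33 93>; <17 20 41|2 46>; <11 44 45|0 34>; <31 47 81|21 41>; <20 30 46|17 40>;
  <34 94|9 24 89>; <4 27|10 22 102>; <19 42|22 32 48>; <2 46|17 20 41>; <33 83|8 23 43>;
  <3 32|14 42 48>; <23 93 103|0 8>; <4 12 92|30 87>; <10 30 85|5 102>; <32 89|1 14 94>;
  <20 90|2 5 85>; <87 92|4 7 12>; <14 89|1 9 101>; <11 31|0 6 103>; <28 34 44|11 49>;
  <5 15 44|0 4>; <9 94 104|1 19>; <4 10 43|22 49>; <44 45 84|4 24>; <3 9 19|4 14>;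
  <94 104|1 19 32>; <5 44|0 4 45>; <14 47|26 32 42>; <41 81|1 6 21>; <7 92|4 12 17>;
  <92|4 12 17 30>; <9 84|4 24 29>; <81|1 21 26 47>; <7 27|2 22 102>; <27 102|2 10 22>;
  <4 14|3 9 19>; <22 49|4 10 43>; <12 17 30|4 46>; <7 22 87|4 32>; <7 87|4 32 104>;
  <1 48|14 19 32>; <24 89|1 16 34>; <89|1 16 34 101>; <2 13 20|41 100>; <25 31 46|0 41>;
  <3 14 42|48 101>; <15 23 44|0 49>; <16 40|0 1 45>; <32 47|1 7 42>; <17 20|2 30 46>;
  <8 48|2 3 43>; <45 103|0 11 44>; <41 100|2 13 20>; <25 31|0 13 41>; <14 26|1 21 42>;
  <26|1 21 42 47>; <10 22 102|2 4>; <11 34 44|3 45>; <2 5 15|10 100>; <2 8 43|3 33>;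
  <13 20|0 2 41>; <10 33|2 15 49>; <6 41|1 21 31>; <20 41|0 2 46>; <11 103|0 3 6>; <21 101|1 3 6>;
  <40 45|0 1 4>; <7 104|1 4 32>; <13 41|0 2 47>; <20 40|0 30 46>; <5 20|0 2 30>; <20|0 2 30 46>;
  <12 46|1 4 17>; <4 43|2 3 49>; <40|0 4 30 46>; <32 104|1 4 19>; <10 100|2 5 15>; <11|0 3 6 16>;
  <104|1 4 9 19>; <7 17|1 2 4>; <8|0 2 3 33>; <19 32|1 4 48>; <16|0 1 3 45>; <31|0 1 3 47>;
  <45|0 1 3 4> ]%num.

Definition abc_abc_moves := [::
  <2 4 5|11 31>; <2 3 5|9 29>; <2 3 9|8 29>; <2 5 11|9 31>; <0 6 11|9 10>; <9 10|0 6 11>;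
  <8 29|2 3 9>; <2 4|1 11 31>; <9 31|2 5 11>; <3 5|6 9 29>; <3 6|4 9 29>; <4 6|0 9 29>;
  <1 4|3 11 31>; <1 3|0 11 31>; <5 28 31|4 6>; <0 6 29|9 31>; <6 8 11|5 10>; <0 2 6|10 30>;
  <28 30 31|3 6>; <3 4 11|8 31>; <28 31|3 4 6>; <28 30|2 3 6>; <5 10|6 8 11>; <8 31|3 4 11>;
  <6 29|5 9 31>; <5 29|2 9 31>; <30 31|0 3 6>; <3 30|0 2 6>; <30|0 2 6 10>; <0 2|3 6 10>;
  <2 5|9 11 31>; <2 11|1 9 31>; <5 9|6 11 31>; <5 31|4 6 11>; <2 31|1 9 29>; <0 10|3 6 11>;
  <2 10|3 6 8>; <10|3 6 8 11>; <5 11|4 6 8>; <2 3 6|8 28>; <2 3 8|9 28>; <0 5 28|1 4>;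
  <2 28 29|1 3>; <0 28|1 4 29>; <1 3|2 28 29>; <5 28|1 4 6>; <2 6|1 8 28>; <2 3|9 28 29>;
  <2 29|1 9 28>; <2|1 8 9 28>; <5 6|1 4 8>; <5|0 1 4 8>; <3 29|4 9 28>; <1 6|4 8 28>;
  <28 29|1 4 9>; <3 4 8 9|50>; <3 8 9|28 50>; <3 9|4 28 50>; <0 1 4|8 29>; <4 8 9|0 50>;
  <8 9 50|0 28>; <8 29|0 1 4>; <1 28|4 8 9>; <9 50|0 4 28> ]%num.

Definition abc_abc_labels : seq N := [::
  0; 3; 50; 9; 6; 28; 1; 11; 8; 29; 31; 4]%num.

Definition q_torus : seq (seq N) := flatten
  [seq (let z k := (i + k) mod 7 in let q k := 10 + (i + k) mod 7 in
    [:: [:: 9; 7; z 0; z 1]; [:: 9; z 0; z 1; q 2]; [:: 9; z 6; q 0; q 1]; [:: 8; 9; q 0; q 1];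
        [:: 8; q 0; z 1; z 2]; [:: 8; q 0; q 1; z 2]; [:: 7; 8; z 0; z 1];
        [:: z 6; q 0; q 1; z 2]; [:: z 5; z 6; q 0; z 1]; [:: z 6; q 0; z 1; z 2]])
  | i <- iotaN 7]%num.

Definition relabel_by (tbl : seq N) (c : N) : N := N.of_nat (index c tbl).
Definition relabeled_as (tbl : seq N) X Y :=
  all (all (mem tbl)) X && same (map (map (relabel_by tbl)) X) Y.

Section Runs.
Local Notation interior_run ms X X' :=
  (all (fun m => has inner_label m.1 && has inner_label m.2) ms && reduces (@single_move N) ms X X').

Lemma abc_run : interior_run abc_moves torus_abc reduced_abc.
Proof. by vm_compute. Qed.

Definition abc_rename (c : N) : N := nth c [:: 0; 1; 2; 3; 4; 5; 6; 7; 10; 8; 11; 9]%num (N.to_nat c).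
Definition abc_rename_inv (c : N) : N := nth c [:: 0; 1; 2; 3; 4; 5; 6; 7; 9; 11; 8; 10]%num (N.to_nat c).

(** A reduced torus is exchanged for its translate by 5, up to the names of the
    interior vertices; as 5 generates the group of translations, all translates are
    interchangeable. *)
Lemma abc_shift_run : interior_run reduced_abc_shift_moves reduced_abc
  (map (map abc_rename_inv) (affine 1 5 reduced_abc)).
Proof. by vm_compute. Qed.

(** Removing the interior vertices of the complexes with [u], [v] and [w] uses moves
    one side of which may have all its vertices on the boundary torus; they remain
    valid in the gluings because that side is a face of the other solid torus for
    none of the multipliers. *)
Lemma uvw_run : all (fun k => let Z := map (map up) (affine k 0 reduced_abc) in
  avoids uvw_moves Z && avoids uv_moves Z) [:: 1; 2; 4]%num &&
  reduces (@single_move N) uvw_moves torus_uvw torus_uv &&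
  reduces (@single_move N) uv_moves torus_uv cyclic_torus.
Proof. by vm_compute. Qed.

Lemma cyclic_abc1_run : reduces (@single_move N) cyclic_abc1_moves
  (amalgam cyclic_torus (affine 1 0 reduced_abc)) (join [:: [:: 0; 2; 28; 30; 31]%num]).
Proof. by vm_compute. Qed.

Lemma cyclic_abc2_run : reduces (@single_move N) cyclic_abc2_moves
  (amalgam cyclic_torus (affine 2 0 reduced_abc)) (join [:: [:: 4; 5; 6; 30; 31]%num]).
Proof. by vm_compute. Qed.

Lemma q_abc1_run : reduces (@single_move N) q_abc1_moves
  (amalgam q_torus (affine 1 0 reduced_abc)) (join [:: [:: 1; 2; 3; 9; 11]%num]).
Proof. by vm_compute. Qed.

Lemma cyclic_abc4_run :
  [&& relabeled_as cyclic_abc4_labels (amalgam cyclic_torus (affine 4 0 reduced_abc))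
        (spin_base 2 cyclic_abc4_lifts), covering 2 cyclic_abc4_lifts &
   reduces (spin_orbit 2) cyclic_abc4_moves (spin_cover 2 cyclic_abc4_lifts) (join cross_blocks)].
Proof. by vm_compute. Qed.

Lemma abc_abc2_run :
  [&& relabeled_as abc_abc2_labels (amalgam reduced_abc (affine 2 0 reduced_abc))
        (spin_base 3 abc_abc2_lifts), covering 3 abc_abc2_lifts &
   reduces (spin_orbit 3) abc_abc2_moves (spin_cover 3 abc_abc2_lifts) (join triangle_blocks)].
Proof. by vm_compute. Qed.

Lemma q_abc2_run :
  [&& relabeled_as q_abc2_labels (amalgam q_torus (affine 2 0 reduced_abc))
        (spin_base 4 q_abc2_lifts), covering 4 q_abc2_lifts &
   reduces (spin_orbit 4) q_abc2_moves (spin_cover 4 q_abc2_lifts) (join square_blocks)].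
Proof. by vm_compute. Qed.

Lemma q_abc4_run :
  [&& relabeled_as q_abc4_labels (amalgam q_torus (affine 4 0 reduced_abc))
        (spin_base 5 q_abc4_lifts), covering 5 q_abc4_lifts &
   reduces (spin_orbit 5) q_abc4_moves (spin_cover 5 q_abc4_lifts) (join pentatope_blocks)].
Proof. by vm_compute. Qed.

(** The labels identify the final complex with the staircase triangulation of a
    product. *)
Lemma abc_abc_run : reduces (@single_move N) abc_abc_moves
  (amalgam reduced_abc (affine 1 0 reduced_abc))
  (map (map (fun c => nth 0%num abc_abc_labels (3 * c.1 + c.2))) product_facets).
Proof. by vm_compute. Qed.
End Runs.

(** * From coded complexes to complexes of finite sets *)

Section FsetComplexes.
Local Open Scope fset_scope.
Variable V : choiceType.

Definition fset_complex (s : seq (seq V)) : pure_complex V := [fset f in [seq [fset x in l] | l <- s]].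

Lemma fset_complexP (s : seq (seq V)) f : reflect (exists2 l, l \in s & f = [fset x in l]) (f \in fset_complex s).
Proof. by rewrite in_fset; exact: mapP. Qed.

Lemma fset_complex_cat (s s' : seq (seq V)) : fset_complex (s ++ s') = fset_complex s `|` fset_complex s'.
Proof. by apply/fsetP => f; rewrite in_fsetU !in_fset map_cat mem_cat. Qed.

Lemma fset_mem_map (V' : choiceType) (h : V -> V') (l : seq V) :
  h @` [fset x in l] = [fset x in map h l].
Proof.
apply/fsetP => y; rewrite in_fset; apply/imfsetP/mapP => [[x /=]|[x xl ->]].
  by rewrite in_fset => xl ->; exists x.
by exists x; rewrite //= in_fset.
Qed.

(** A point lies in the open simplex of its support, and in the closed simplices of
    the facets that contain its support. *)
Lemma realization_set_geom (R : realType) (s : seq (seq V)) :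
  @realization_set V R (fset_complex s) = @geom R V s.
Proof.
have sum_fset (l : seq V) (t : V -> R) : (forall x, x \notin l -> t x = 0) ->
    forall f : {fset V}, (forall x, x \notin f -> t x = 0) -> \sum_(x <- f) t x = \sum_(x <- undup l) t x.
  move=> tl f tf; apply: sum_supp; rewrite ?undup_uniq ?fset_uniq // => x.
  by rewrite mem_undup; exact: tl.
apply/seteqP; split=> t.
  move=> [f [[f0 [_ /fset_complexP[l ls ->] /fsubsetP fl]] tpos tzero t1]].
  have tl x : x \notin l -> t x = 0.
    by move=> xl; apply: tzero; apply: contra xl => /fl; rewrite in_fset.
  exists l => //; split=> //; last by rewrite -(sum_fset l t tl f tzero).
  by move=> x; have [/tpos /ltW //|/tzero ->] := boolP (x \in f).
move=> [l ls [t0 tl t1]].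
pose f := [fset x in [seq x <- l | 0 < t x]].
have tf x : x \notin f -> t x = 0.
  rewrite in_fset mem_filter negb_and => /orP[|/tl //].
  by rewrite -leNgt => tx; apply/eqP; rewrite eq_le tx t0.
have f1 : \sum_(x <- f) t x = 1 by rewrite (sum_fset l t tl f tf).
exists f; split=> //; last by move=> x; rewrite in_fset mem_filter => /andP[].
split.
  by apply/eqP => fE; move: f1; rewrite fE big_seq_fset0 => /eqP; rewrite eq_sym oner_eq0.
exists [fset x in l]; first by apply/fset_complexP; exists l.
by apply/fsubsetP => x; rewrite !in_fset mem_filter => /andP[].
Qed.

End FsetComplexes.

Definition vertex_of (j n : nat) (c : N) : vertex :=
  let i := N.to_nat c in
  if (i < 7)%N then Z7 (inZp i) else
  match i with
  | 7 => Vu j n | 8 => Vv j n | 9 => Vw j n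
  | _ => match j with
    | 4 => Vq n (inZp (i - 10)) | 5 => Vr n (inZp (i - 10)) | 6 => Vs n (inZp (i - 10))
    | 7 => Va n (i - 9) | 8 => Vb n (i - 9) | _ => Vc n (i - 9)
    end
  end%N.

(** Up to names, the complexes of the family [j] are the images of one shape under
    the affine maps [x |-> multiplier j * x + torus_shift j n]. *)
Definition multiplier (j : nat) : N := nth 1%num [:: 1; 1; 2; 4; 1; 2; 4; 1; 2; 4]%num j.

Definition torus_shape (j n : nat) : seq (seq N) :=
  if (j <= 3)%N then (if (n <= 6)%N then torus_uv else torus_uvw)
  else if (j <= 6)%N then q_torus else torus_abc.

Definition torus_shift (j n : nat) : N :=
  match j with 4 | 7 => 0%num | _ => N.of_nat n end.

Definition piece (j n : nat) := affine (multiplier j) (torus_shift j n) (torus_shape j n).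

Lemma relabel_complex (V V' : choiceType) (h : V -> V') (s : seq (seq V)) :
  relabel h (fset_complex s) = fset_complex (map (map h) s).
Proof.
apply/fsetP => f; apply/imfsetP/fset_complexP => [[_ /fset_complexP[l ls ->] ->]|].
  by exists (map h l); [exact: map_f|rewrite /= fset_mem_map].
move=> [_ /mapP[l ls ->] ->]; exists [fset x in l]%fset; last by rewrite fset_mem_map.
by apply/fset_complexP; exists l.
Qed.

Lemma simplexE a b c d : simplex a b c d = [fset x in [:: a; b; c; d]]%fset.
Proof. by apply/fsetP => x; rewrite !inE orbF -!orbA. Qed.

Lemma complex_ofE s : complex_of [seq [fset x in l]%fset | l <- s] = fset_complex s.
Proof. by []. Qed.

Lemma T_1E : T_1 = fset_complex (map (map (vertex_of 1 0)) cyclic_torus).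
Proof. by rewrite /T_1 !simplexE -complex_ofE. Qed.

Lemma T10E : T10 = fset_complex (map (map (vertex_of 1 0)) torus_uv).
Proof. by rewrite /T10 !simplexE -complex_ofE. Qed.

Lemma T7E n : T7 n = fset_complex (map (map (vertex_of 7 n)) torus_abc).
Proof. by rewrite /T7 !simplexE -complex_ofE. Qed.

Lemma fset_complex_diff (s s' : seq (seq vertex)) : (fset_complex s `\` fset_complex s')%fset =
  fset_complex [seq l <- s | ~~ has (fun l' => sub l l' && sub l' l) s'].
Proof.
apply/fsetP => f; rewrite in_fsetD.
have eqF (l l' : seq vertex) : ([fset x in l] == [fset x in l'])%fset = sub l l' && sub l' l.
  apply/eqP/andP => [E|[/subP ll' /subP l'l]].
    have E' x : (x \in l) = (x \in l') by have /fsetP/(_ x) := E; rewrite !in_fset.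
    by split; apply/subP => x; rewrite E'.
  by apply/fsetP => x; rewrite !in_fset; apply/idP/idP => [/ll'|/l'l].
apply/andP/fset_complexP => [[fs' /fset_complexP[l ls fl]]|[l]].
  exists l => //; rewrite mem_filter ls andbT; apply: contra fs' => /hasP[l' l's' ll'].
  by apply/fset_complexP; exists l' => //; rewrite fl; apply/eqP; rewrite eqF.
rewrite mem_filter => /andP[ls' ls] ->; split; last by apply/fset_complexP; exists l.
apply: contra ls' => /fset_complexP[l' l's' /eqP]; rewrite eqF => ll'.
by apply/hasP; exists l'.
Qed.

Lemma T10'E : T10' = fset_complex (map (map (vertex_of 1 0)) torus_uvw).
Proof.
rewrite /T10' T10E !simplexE -!/(complex_of [seq [fset x in l]%fset | l <- _]).
rewrite (_ : complex_of [:: _; _] = fset_complex [:: [:: Vu 1 0; 0%N : vertex; 1%N : vertex; 2%N : vertex];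
  [:: Vv 1 0; 0%N : vertex; 1%N : vertex; 2%N : vertex]]) //.
rewrite fset_complex_diff.
rewrite [X in fset_complex X](_ : _ = map (map (vertex_of 1 0)) (take 17 torus_uvw)); last by vm_compute.
rewrite -[in RHS](cat_take_drop 17 torus_uvw) map_cat fset_complex_cat.
by congr (_ `|` _)%fset; rewrite -complex_ofE.
Qed.

Lemma enum_Z7 : enum 'Z_7 = [seq inZp i | i <- iota 0 7].
Proof.
apply: (inj_map val_inj); rewrite val_enum_ord -map_comp.
by [].
Qed.

Lemma vertex_encode_inj : injective vertex_encode.
Proof. exact: can_inj vertex_encodeK. Qed.

Lemma T4E n : T4 n = fset_complex (map (map (vertex_of 4 n)) q_torus).
Proof.
pose H (i : 'Z_7) : seq (seq vertex) :=
  let z (k : 'Z_7) := Z7 (i + k)%R in let q (k : 'Z_7) := Vq n (i + k)%R in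
  let u := Vu 4 n in let v := Vv 4 n in let w := Vw 4 n in
  [:: [:: w; u; z 0; z 1]; [:: w; z 0; z 1; q (1 + 1)]; [:: w; z (- 1); q 0; q 1]; [:: v; w; q 0; q 1];
      [:: v; q 0; z 1; z (1 + 1)]; [:: v; q 0; q 1; z (1 + 1)]; [:: u; v; z 0; z 1];
      [:: z (- 1); q 0; q 1; z (1 + 1)]; [:: z (- (1 + 1)); z (- 1); q 0; z 1];
      [:: z (- 1); q 0; z 1; z (1 + 1)]].
have -> : T4 n = fset_complex (flatten [seq H i | i <- enum 'Z_7]).
  rewrite /T4 -complex_ofE map_flatten -[in RHS]map_comp; congr (complex_of (flatten _)).
  by apply: eq_map => i; rewrite /= !simplexE.
(* The encoding forgets the bounds carried by the elements of Z_7. *)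
congr fset_complex; apply: (inj_map (inj_map vertex_encode_inj)).
rewrite enum_Z7; reflexivity.
Qed.

Lemma to_nat_mod7 x : N.to_nat (x mod 7) = (N.to_nat x %% 7)%N.
Proof.
have e := N.Div0.div_mod x 7; have l : (N.to_nat (x mod 7) < 7)%N.
  by apply/ssrnat.ltP; have := mod7_lt x; lia.
rewrite {2}e Nnat.N2Nat.inj_add Nnat.N2Nat.inj_mul plusE multE.
by rewrite (_ : N.to_nat 7 = 7%N) // mulnC modnMDl modn_small.
Qed.

Lemma vertex_of_small j n c : (c < 7)%num -> vertex_of j n c = Z7 (inZp (N.to_nat c)).
Proof. by move=> c7; rewrite /vertex_of (_ : (_ < 7)%N) //; apply/ssrnat.ltP; lia. Qed.

Lemma relabeling_Z7 (k s c : N) j n h i m : (c < 7)%num -> s = N.of_nat n ->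
  relabeling (N.to_nat k)%:R j n h (vertex_of i m c) = vertex_of j n (affine7 k s c).
Proof.
move=> c7 ->; rewrite vertex_of_small // /affine7 (ltbT c7).
rewrite vertex_of_small; last exact: mod7_lt.
rewrite /relabeling; congr Z7.
have inZpE l : inZp l = l%:R :> 'Z_7 by rewrite Zp_nat.
rewrite inZpE -natrM -natrD to_nat_mod7 inZpE Nnat.N2Nat.inj_add Nnat.N2Nat.inj_mul plusE multE.
by rewrite Nnat.Nat2N.id -[RHS]inZpE -inZpE; apply: val_inj; rewrite /= modn_mod.
Qed.

Definition code_bound (j : nat) : N :=
  if (j <= 3)%N then 10%num else if (j <= 6)%N then 17%num else 13%num.

Lemma vertex_of10 (j n i : nat) : vertex_of j n (10 + N.of_nat i) = match j with
    | 4 => Vq n (inZp i) | 5 => Vr n (inZp i) | 6 => Vs n (inZp i)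
    | 7 => Va n i.+1 | 8 => Vb n i.+1 | _ => Vc n i.+1
    end%N.
Proof.
have e1 : (10 + i - 10 = i)%N by rewrite addKn.
have e2 : (10 + i - 9 = i.+1)%N by rewrite (_ : 10 + i = i.+1 + 9)%N ?addnK // addnC -addSnnS.
rewrite /vertex_of Nnat.N2Nat.inj_add Nnat.Nat2N.id plusE (_ : N.to_nat 10 = 10%N) // e1 e2.
by case: j => [|[|[|[|[|[|[|[|[|?]]]]]]]]].
Qed.

Lemma vertex_of_cases (j n : nat) (c : N) (Q : N -> vertex -> Prop) :
  (0 < j <= 9)%N -> (c < code_bound j)%num ->
  (forall i, (i < 7)%N -> Q (N.of_nat i) (Z7 (inZp i))) ->
  Q 7%num (Vu j n) -> Q 8%num (Vv j n) -> Q 9%num (Vw j n) ->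
  (forall i, (i < 7)%N -> j = 4 -> Q (10 + N.of_nat i)%num (Vq n (inZp i))) ->
  (forall i, (i < 7)%N -> j = 5 -> Q (10 + N.of_nat i)%num (Vr n (inZp i))) ->
  (forall i, (i < 7)%N -> j = 6 -> Q (10 + N.of_nat i)%num (Vs n (inZp i))) ->
  (forall i, (i < 3)%N -> j = 7 -> Q (10 + N.of_nat i)%num (Va n i.+1)) ->
  (forall i, (i < 3)%N -> j = 8 -> Q (10 + N.of_nat i)%num (Vb n i.+1)) ->
  (forall i, (i < 3)%N -> j = 9 -> Q (10 + N.of_nat i)%num (Vc n i.+1)) ->
  Q c (vertex_of j n c).
Proof.
move=> j9 cb H0 H7 H8 H9 Hq Hr Hs Ha Hb Hc.
have cE : c = N.of_nat (N.to_nat c) by rewrite Nnat.N2Nat.id.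
have [c7|c7] := ltnP (N.to_nat c) 7; first by rewrite /vertex_of c7 {1}cE; exact: H0.
have [c10|c10] := ltnP (N.to_nat c) 10.
  by move: c7 c10; rewrite cE /vertex_of Nnat.Nat2N.id; case: (N.to_nat c) => [|[|[|[|[|[|[|[|[|[|]]]]]]]]]].
pose i := (N.to_nat c - 10)%N.
have ci : N.to_nat c = (10 + i)%N by rewrite subnKC.
have {cE} cE : c = (10 + N.of_nat i)%num by rewrite cE ci; lia.
have ib : (N.of_nat i < code_bound j - 10)%num by move: cb; rewrite cE; lia.
have ib3 : (7 <= j)%N -> (i < 3)%N.
  move=> j7; apply/ssrnat.ltP; move: ib; rewrite /code_bound.
  rewrite leqNgt (leq_trans _ j7) // leqNgt (leq_trans _ j7) //=; lia.
have ib7 : (4 <= j <= 6)%N -> (i < 7)%N.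
  move=> /andP[j4 j6]; apply/ssrnat.ltP; move: ib; rewrite /code_bound.
  rewrite leqNgt j4 j6 /=; lia.
have j3 : (4 <= j)%N.
  rewrite ltnNge; apply/negP => j3; move: ib; rewrite /code_bound j3; lia.
rewrite {}cE vertex_of10 {ib cb ci c7 c10}.
move: Hq Hr Hs Ha Hb Hc ib3 ib7 j9 j3; clear.
case: j => [|[|[|[|[|[|[|[|[|[|//]]]]]]]]]] // Hq Hr Hs Ha Hb Hc ib3 ib7 _ _.
- by apply: Hq => //; exact: ib7.
- by apply: Hr => //; exact: ib7.
- by apply: Hs => //; exact: ib7.
- by apply: Ha => //; exact: ib3.
- by apply: Hb => //; exact: ib3.
- by apply: Hc => //; exact: ib3.
Qed.

Lemma map_decode_affine (k s : N) j n (g : vertex -> vertex) i m (Z : seq (seq N)) :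
  all (all (fun c => c <? code_bound i)%num) Z ->
  (forall c, (c < code_bound i)%num -> g (vertex_of i m c) = vertex_of j n (affine7 k s c)) ->
  map (map g) (map (map (vertex_of i m)) Z) = map (map (vertex_of j n)) (affine k s Z).
Proof.
move=> /allP Zb gE; rewrite /affine -!map_comp; apply/eq_in_map => f fZ /=.
rewrite -!map_comp; apply/eq_in_map => c cf /=; apply: gE.
by apply/N.ltb_lt; exact: allP (Zb f fZ) c cf.
Qed.

Lemma relabeling_decode (k : N) (kz : 'Z_7) j n h i : (0 < i <= 9)%N ->
  kz = (N.to_nat k)%:R ->
  (forall l, (l < 7)%N -> i = 4 -> h (Vq 0 (inZp l)) = vertex_of j n (10 + N.of_nat l)) ->
  (forall l, (l < 3)%N -> i = 7 -> h (Va 0 l.+1) = vertex_of j n (10 + N.of_nat l)) ->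
  i \in [:: 1; 4; 7]%N ->
  forall c, (c < code_bound i)%num ->
    relabeling kz j n h (vertex_of i 0 c) = vertex_of j n (affine7 k (N.of_nat n) c).
Proof.
move=> i9 -> hq ha i147 c cb.
have [c7|c7] := N.ltb_spec c 7; first exact: relabeling_Z7.
have -> : affine7 k (N.of_nat n) c = c by rewrite /affine7 (ltbF c7).
move: c7; apply: (@vertex_of_cases i 0 c (fun c x => (7 <= c)%num -> relabeling _ j n h x = vertex_of j n c)) => //.
- by move=> l /ssrnat.ltP l7 H; exfalso; lia.
- by move=> l l7 i4 _; rewrite -hq.
- by move=> l _ i5; rewrite i5 in i147.
- by move=> l _ i5; rewrite i5 in i147.
- by move=> l l7 i4 _; rewrite -ha.
- by move=> l _ i5; rewrite i5 in i147.
- by move=> l _ i5; rewrite i5 in i147.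
Qed.

Lemma Tfam_piece j n : (0 < j <= 9)%N ->
  Tfam j n = fset_complex (map (map (vertex_of j n)) (piece j n)).
Proof.
have uvE m : (if (m <= 6)%N then T10 else T10') =
    fset_complex (map (map (vertex_of 1 0)) (if (m <= 6)%N then torus_uv else torus_uvw)).
  by case: ifP => _; [exact: T10E|exact: T10'E].
have uvb m : all (all (fun c => c <? code_bound 1)%num) (if (m <= 6)%N then torus_uv else torus_uvw).
  by case: ifP => _; vm_compute.
have b4 : all (all (fun c => c <? code_bound 4)%num) q_torus by vm_compute.
have b7 : all (all (fun c => c <? code_bound 7)%num) torus_abc by vm_compute.
case: j => [|[|[|[|[|[|[|[|[|[|//]]]]]]]]]] // _; rewrite /Tfam.
1-3: rewrite uvE relabel_complex.
1: rewrite (@map_decode_affine 1 (N.of_nat n) 1 n) ?uvb //.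
2: rewrite (@map_decode_affine 2 (N.of_nat n) 2 n) ?uvb //.
3: rewrite (@map_decode_affine 4 (N.of_nat n) 3 n) ?uvb //.
1-3: by apply: relabeling_decode => //; apply: val_inj.
- by rewrite (_ : piece 4 n = q_torus) ?T4E.
- rewrite T4E relabel_complex (@map_decode_affine 2 (N.of_nat n) 5 n) //.
  by apply: relabeling_decode => // l l7 _; rewrite vertex_of10.
- rewrite T4E relabel_complex (@map_decode_affine 4 (N.of_nat n) 6 n) //.
  by apply: relabeling_decode => // l l7 _; rewrite vertex_of10.
- by rewrite (_ : piece 7 n = torus_abc) ?T7E.
- rewrite T7E relabel_complex (@map_decode_affine 2 (N.of_nat n) 8 n) //.
  by apply: relabeling_decode => // l l7 _; rewrite vertex_of10.
- rewrite T7E relabel_complex (@map_decode_affine 4 (N.of_nat n) 9 n) //.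
  by apply: relabeling_decode => // l l7 _; rewrite vertex_of10.
Qed.

(** [T_2] and [T_3] are listed independently of [T_1] but are its images under the
    multiplications by 2 and 4, up to the order of the facets. *)
Lemma Tbase_piece i : (0 < i <= 3)%N -> forall R : realType,
  geom (map (map (vertex_of i 0)) (affine (multiplier i) 0 cyclic_torus)) =
  @realization_set vertex R (Tbase i).
Proof.
move=> i3 R.
pose L2 : seq (seq N) := [:: <0 2 4 6>; <1 2 4 6>; <1 3 4 6>; <1 3 5 6>;
    <0 1 3 5>; <0 2 3 5>; <0 2 4 5> ]%num.
pose L3 : seq (seq N) := [:: <0 1 4 5>; <1 2 4 5>; <1 2 5 6>; <2 3 5 6>;
    <0 2 3 6>; <0 3 4 6>; <0 1 3 4> ]%num.
have T_2E : T_2 = fset_complex (map (map (vertex_of 2 0)) L2).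
  by rewrite /T_2 !simplexE -complex_ofE.
have T_3E : T_3 = fset_complex (map (map (vertex_of 3 0)) L3).
  by rewrite /T_3 !simplexE -complex_ofE.
case: i i3 => [|[|[|[|//]]]] // _.
- rewrite /Tbase T_1E realization_set_geom; apply: same_geom; by vm_compute.
- rewrite /Tbase T_2E realization_set_geom; apply: same_geom; by vm_compute.
- rewrite /Tbase T_3E realization_set_geom; apply: same_geom; by vm_compute.
Qed.

Definition vertex_of2 (i m j n : nat) (c : N) : vertex :=
  if (c <? 20)%num then vertex_of i m c else vertex_of j n (c - 20)%num.

Definition encode2 (i m : nat) (x : vertex) : N :=
  let off b : N := if b then 0%num else 20%num in
  match x with
  | Z7 z => N.of_nat z
  | Vu j n => 7 + off ((j, n) == (i, m)) | Vv j n => 8 + off ((j, n) == (i, m))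
  | Vw j n => 9 + off ((j, n) == (i, m))
  | Vq n z => 10 + N.of_nat z + off ((4%N, n) == (i, m))
  | Vr n z => 10 + N.of_nat z + off ((5%N, n) == (i, m))
  | Vs n z => 10 + N.of_nat z + off ((6%N, n) == (i, m))
  | Va n k => 9 + N.of_nat k + off ((7%N, n) == (i, m))
  | Vb n k => 9 + N.of_nat k + off ((8%N, n) == (i, m))
  | Vc n k => 9 + N.of_nat k + off ((9%N, n) == (i, m))
  end%num.

Definition coded (j : nat) (X : seq (seq N)) := all (all (fun c => c <? code_bound j)%num) X.

Lemma code_bound20 j c : (c < code_bound j)%num -> (c < 20)%num.
Proof. by rewrite /code_bound; case: ifP => _; [|case: ifP => _]; lia. Qed.

Lemma coded_small j X : coded j X -> small X.
Proof.
move=> /allP cX; apply/allP => f /cX /allP cf; apply/allP => c /cf /N.ltb_lt cb.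
by apply/N.ltb_lt; exact: code_bound20 cb.
Qed.

Lemma encode2_left i m c : (0 < i <= 9)%N -> (c < code_bound i)%num ->
  encode2 i m (vertex_of i m c) = c.
Proof.
move=> i9 cb; apply: (@vertex_of_cases i m c (fun c x => encode2 i m x = c)) => //;
  rewrite /encode2 ?eqxx //.
- by move=> l l7; rewrite /= modn_small.
all: try by move=> l l7 ->; rewrite eqxx /inZp /= modn_small // N.add_0_r.
all: by move=> l l7 ->; rewrite eqxx; lia.
Qed.

Lemma encode2_right i m j n c : (0 < j <= 9)%N -> (j, n) != (i, m) ->
  (c < code_bound j)%num -> encode2 i m (vertex_of j n c) = up c.
Proof.
move=> j9 /negPf ji cb.
have upE d : up (10 + d) = (10 + d + 20)%num.
  by rewrite /up ltbF //; lia.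
apply: (@vertex_of_cases j n c (fun c x => encode2 i m x = up c)) => //;
  rewrite /encode2 ?ji //.
- by move=> l l7; rewrite /= modn_small // /up ltbT //; move/ssrnat.ltP: l7; lia.
all: move=> l l7 jE; rewrite jE in ji; rewrite ji upE ?/inZp ?[val _]/= ?modn_small //; lia.
Qed.

Lemma realization_setU (V : choiceType) (R : realType) (K L : pure_complex V) :
  @realization_set V R (K `|` L)%fset = @realization_set V R K `|` @realization_set V R L.
Proof.
apply/seteqP; split=> t.
  move=> [s [[s0 [f]]]]; rewrite in_fsetU => /orP[fK|fL] sf tp tz t1; [left|right];
    by exists s; split=> //; split=> //; exists f.
by case=> -[s [[s0 [f fK sf]] tp tz t1]]; exists s; split=> //; split=> //; exists f => //;
  rewrite in_fsetU fK ?orbT.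
Qed.

(** The interior vertices of the two solid tori are distinct, so that the union
    realizes the amalgam of the coded complexes. *)
Lemma union_homeo (R : realType) i m j n X Y (K L : pure_complex vertex) :
  (0 < i <= 9)%N -> (0 < j <= 9)%N -> (j, n) != (i, m) -> coded i X -> coded j Y ->
  @realization_set vertex R K = geom (map (map (vertex_of i m)) X) ->
  @realization_set vertex R L = geom (map (map (vertex_of j n)) Y) ->
  homeomorphic (realization R (K `|` L)%fset) (@geom R N (amalgam X Y)).
Proof.
move=> i9 j9 ji /allP cX /allP cY KX LY.
have left_dec f c : f \in X -> c \in f -> vertex_of2 i m j n c = vertex_of i m c.
  move=> fX cf; have /N.ltb_lt cb : (c <? code_bound i)%num by exact: allP (cX f fX) c cf.
  by rewrite /vertex_of2 ltbT //; exact: code_bound20 cb.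
have right_dec f c : f \in Y -> c \in f -> vertex_of2 i m j n (up c) = vertex_of j n c.
  move=> fY cf; have /N.ltb_lt cb : (c <? code_bound j)%num by exact: allP (cY f fY) c cf.
  have c20 := code_bound20 cb.
  rewrite /vertex_of2 /up; case: (N.ltb_spec c 7) => c7.
    by rewrite ltbT // !vertex_of_small.
  rewrite ltbF; last lia.
  by rewrite N.add_sub.
have E : @realization_set vertex R (K `|` L)%fset =
    geom (map (map (vertex_of2 i m j n)) (amalgam X Y)).
  rewrite realization_setU KX LY /amalgam map_cat geomU; congr (geom _ `|` geom _).
    apply/eq_in_map => f fX; apply/eq_in_map => c cf; exact: (esym (left_dec f c fX cf)).
  rewrite -map_comp; apply/eq_in_map => f fY /=; rewrite -map_comp.
  by apply/eq_in_map => c cf /=; exact: (esym (right_dec f c fY cf)).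
rewrite /realization E; apply: homeo_sym.
apply: (@relabel_homeo R N vertex (vertex_of2 i m j n) (encode2 i m)) => f c.
rewrite /amalgam mem_cat => /orP[fX|/mapP[g gY ->]] cf.
  have /N.ltb_lt cb : (c <? code_bound i)%num by exact: allP (cX f fX) c cf.
  by rewrite (left_dec f) ?encode2_left.
case/mapP: cf => d dg ->.
have /N.ltb_lt db : (d <? code_bound j)%num by exact: allP (cY g gY) d dg.
by rewrite (right_dec g) ?encode2_right.
Qed.

Lemma coded_affine k s j X : coded j X -> coded j (affine k s X).
Proof.
move=> /allP cX; apply/allP => _ /mapP[f fX ->]; apply/allP => _ /mapP[c cf ->].
rewrite /affine7; case: (N.ltb_spec c 7) => _; last exact: allP (cX f fX) c cf.
apply/N.ltb_lt; have := mod7_lt (k * c + s).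
by rewrite /code_bound; case: ifP => _; [|case: ifP => _]; lia.
Qed.

Lemma coded_piece j n : (0 < j <= 9)%N -> coded j (piece j n).
Proof.
move=> j9; apply: coded_affine; rewrite /torus_shape.
by case: j j9 => [|[|[|[|[|[|[|[|[|[|//]]]]]]]]]] // _ /=; try case: ifP => _; vm_compute.
Qed.

(** * The gluings *)

Section Assembly.
Variable R : realType.
Local Notation "X ~ Y" := (equihomeo R X Y) (at level 70).
Local Notation exchangeable := (exchangeable R).

Lemma small_reduced : small reduced_abc. Proof. by []. Qed.

Lemma exchangeable_abc : exchangeable torus_abc reduced_abc.
Proof. by have /andP[int red] := abc_run; exact: exchangeable_reduces int red. Qed.

Lemma exchangeable_shift5 : exchangeable (affine 1 5 reduced_abc) reduced_abc.
Proof.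
have /andP[int red] := abc_shift_run; apply: exchangeable_sym.
apply: (exchangeable_trans (@exchangeable_reduces R _ _ _ int red)).
by apply: (@exchangeable_rename R abc_rename abc_rename_inv); vm_compute.
Qed.

(** [s = 5 (3 s)] modulo 7. *)
Lemma exchangeable_shift s : exchangeable (affine 1 s reduced_abc) reduced_abc.
Proof.
have H t : exchangeable (affine 1 (5 * t) reduced_abc) reduced_abc.
  elim/N.peano_ind: t => [|t IH]; first by rewrite affine_id => Y _; exact: homeo_refl.
  have -> : affine 1 (5 * N.succ t) reduced_abc = affine 1 (5 * t) (affine 1 5 reduced_abc).
    by rewrite affine_comp; apply: eq_affine; congr (_ mod _)%num; lia.
  apply: exchangeable_trans IH.
  exact: exchangeable_affine (isT : square7 1 1) exchangeable_shift5.
rewrite (@eq_affine 1 s 1 (5 * (3 * s))) //; mod_lia.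
Qed.

Lemma exchangeable_affine_reduced k k' s : square7 k k' ->
  exchangeable (affine k s reduced_abc) (affine k 0 reduced_abc).
Proof.
move=> kk'.
have -> : affine k s reduced_abc = affine k 0 (affine 1 (k' * s) reduced_abc).
  rewrite affine_comp; apply: eq_affine; move: kk'; rewrite /square7 !inE => /or3P[]/eqP[? ?]; subst; mod_lia.
exact: exchangeable_affine kk' (exchangeable_shift _).
Qed.

Lemma exchangeable_affine_abc k k' s : square7 k k' ->
  exchangeable (affine k s torus_abc) (affine k 0 reduced_abc).
Proof.
move=> kk'; apply: exchangeable_trans (exchangeable_affine_reduced s kk').
exact: exchangeable_affine kk' exchangeable_abc.
Qed.

Lemma exchangeable_right X Y Y' : small X -> small Y -> small Y' -> exchangeable Y Y' ->
  amalgam X Y ~ amalgam X Y'.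
Proof.
move=> sX sY sY' YY'; apply: homeo_trans (amalgam_sym R sX sY) _.
exact: homeo_trans (YY' X sX) (amalgam_sym R sY' sX).
Qed.

(** Pull the translation and the multiplier of the first solid torus out of the
    amalgam: the second one is left with the ratio [c] of the multipliers and some
    translation, which can be exchanged away. *)
Lemma amalgam_abc Z a a' b b' c c' m s : small Z ->
  square7 a a' -> square7 b b' -> square7 c c' -> ((a * c) mod 7 = b mod 7)%num ->
  amalgam (affine a m Z) (affine b s torus_abc) ~ amalgam Z (affine c 0 reduced_abc).
Proof.
move=> sZ aa' bb' cc' acb.
have sM := small_reduced.
apply: homeo_trans (exchangeable_right (Y' := affine b 0 reduced_abc) _ _ _ _) _;
  rewrite ?small_affine //; first exact: exchangeable_affine_abc bb'.
have -> : affine b 0 reduced_abc = affine a m (affine c (6 * a' * m) reduced_abc).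
  rewrite affine_comp; apply: eq_affine => //; move: aa'; rewrite /square7 !inE => /or3P[]/eqP[? ?]; subst; mod_lia.
rewrite amalgam_affine; apply: homeo_trans (affine_homeo R _ _ aa') _.
apply: exchangeable_right; rewrite ?small_affine //.
exact: exchangeable_affine_reduced cc'.
Qed.

Lemma relabeled_homeo tbl X Y : relabeled_as tbl X Y -> X ~ Y.
Proof.
move=> /andP[/allP Xt /(same_geom R) XY]; rewrite /equihomeo -XY.
apply: (@relabel_homeo R N N (relabel_by tbl) (fun c => nth 0%num tbl (N.to_nat c))) => f x fX xf.
by rewrite /relabel_by Nnat.Nat2N.id nth_index //; exact: allP (Xt f fX) x xf.
Qed.

Lemma simplex_boundary_homeo ms X vs : uniq vs -> size vs = 5 ->
  reduces (@single_move N) ms X (join [:: vs]) -> homeomorphic (@geom R N X) (sphere R 3).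
Proof.
move=> uvs svs red; apply: homeo_trans (reduces_homeo R red) _.
have [h hp] := @simplex_boundary_param R 3 N vs uvs svs.
exact: param_homeo (@sphere_compact R 3) hp.
Qed.

Lemma uv_cyclic k Z : k \in [:: 1; 2; 4]%num -> Z \in [:: cyclic_torus; torus_uv; torus_uvw] ->
  amalgam Z (affine k 0 reduced_abc) ~ amalgam cyclic_torus (affine k 0 reduced_abc).
Proof.
move=> k7; have /andP[/andP[/allP/(_ k k7)/andP[av1 av2] red1] red2] := uvw_run.
have h2 := reduces_homeo R (reduces_cat av2 red2).
have h1 := reduces_homeo R (reduces_cat av1 red1).
rewrite !inE => /or3P[]/eqP ->; first exact: homeo_refl.
  exact: h2.
exact: homeo_trans h1 h2.
Qed.

Lemma amalgam_S3_cyclic c Z : c \in [:: 1; 2]%num -> Z \in [:: cyclic_torus; torus_uv; torus_uvw] ->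
  homeomorphic (@geom R N (amalgam Z (affine c 0 reduced_abc))) (sphere R 3).
Proof.
move=> c12 ZZ; apply: homeo_trans (uv_cyclic _ ZZ) _.
  by move: c12; rewrite !inE => /orP[]/eqP ->.
move: c12; rewrite !inE => /orP[]/eqP ->.
  by apply: (simplex_boundary_homeo _ _ cyclic_abc1_run).
by apply: (simplex_boundary_homeo _ _ cyclic_abc2_run).
Qed.

Lemma amalgam_RP3 Z : Z \in [:: cyclic_torus; torus_uv; torus_uvw] ->
  homeomorphic (@geom R N (amalgam Z (affine 4 0 reduced_abc))) (projective_space R 3).
Proof.
move=> ZZ; apply: homeo_trans (uv_cyclic _ ZZ) _ => //.
have /and3P[rel cov red] := cyclic_abc4_run.
exact: homeo_trans (relabeled_homeo rel) (projective_homeo R cov red).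
Qed.

Lemma amalgam_S3_q : homeomorphic (@geom R N (amalgam q_torus (affine 1 0 reduced_abc))) (sphere R 3).
Proof. by apply: (simplex_boundary_homeo _ _ q_abc1_run). Qed.

Lemma amalgam_L41 : homeomorphic (@geom R N (amalgam q_torus (affine 2 0 reduced_abc))) (lens_space R 4 1).
Proof.
have /and3P[rel cov red] := q_abc2_run.
exact: homeo_trans (relabeled_homeo rel) (lens41_homeo R cov red).
Qed.

Lemma amalgam_L52 : homeomorphic (@geom R N (amalgam q_torus (affine 4 0 reduced_abc))) (lens_space R 5 2).
Proof.
have /and3P[rel cov red] := q_abc4_run.
exact: homeo_trans (relabeled_homeo rel) (lens52_homeo R cov red).
Qed.

Lemma amalgam_L31 : homeomorphic (@geom R N (amalgam torus_abc (affine 2 0 reduced_abc))) (lens_space R 3 1).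
Proof.
have /and3P[rel cov red] := abc_abc2_run.
apply: homeo_trans (exchangeable_abc _) _; first by [].
exact: homeo_trans (relabeled_homeo rel) (lens31_homeo R cov red).
Qed.

Lemma amalgam_S2S1 : homeomorphic (@geom R N (amalgam torus_abc (affine 1 0 reduced_abc)))
  (sphere R 2 * sphere R 1)%type.
Proof.
apply: homeo_trans (exchangeable_abc _) _; first by [].
apply: homeo_trans (reduces_homeo R abc_abc_run) _.
apply: homeo_trans (product_homeo R); apply: homeo_sym.
pose g c := let k := index c abc_abc_labels in (k %/ 3, k %% 3)%N.
have chk : all (all (fun c => g (nth 0%num abc_abc_labels (3 * c.1 + c.2)) == c)) product_facets.
  by vm_compute.
apply: (@relabel_homeo R _ N _ g) => f x fX xf.
exact/eqP/(allP (allP chk f fX)).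
Qed.

Lemma square7_multiplier j : (j <= 9)%N -> exists k', square7 (multiplier j) k'.
Proof.
by case: j => [|[|[|[|[|[|[|[|[|[|//]]]]]]]]]] _; do
  [by exists 1%num|by exists 4%num|by exists 2%num].
Qed.

Lemma torus_shape_abc j n : (7 <= j)%N -> torus_shape j n = torus_abc.
Proof. by case: j => [|[|[|[|[|[|[|j]]]]]]]. Qed.

Lemma union_abc i m j n (K : pure_complex vertex) (X : seq (seq N)) (c : N)
    (M : topologicalType) : (0 < i <= 9)%N -> (7 <= j <= 9)%N -> (j, n) != (i, m) ->
  coded i X -> (exists s, @realization_set vertex R K =
    geom (map (map (vertex_of i m)) (affine (multiplier i) s X))) ->
  c \in [:: 1; 2; 4]%num -> ((multiplier i * c) mod 7 = multiplier j mod 7)%num ->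
  homeomorphic (@geom R N (amalgam X (affine c 0 reduced_abc))) M ->
  triangulates R (K `|` Tfam j n)%fset M.
Proof.
move=> i9 j79 ji cX [s KX] c7 cE XM.
have j9 : (0 < j <= 9)%N by case/andP: j79 => /(leq_trans _) -> // ->.
have jX : @realization_set vertex R (Tfam j n) = geom (map (map (vertex_of j n)) (piece j n)).
  by rewrite Tfam_piece // realization_set_geom.
apply: homeo_trans (union_homeo i9 j9 ji (coded_affine _ _ cX) (coded_piece n j9) KX jX) _.
apply: homeo_trans XM.
have [a' aa'] := square7_multiplier (proj2 (andP i9)).
have [b' bb'] := square7_multiplier (proj2 (andP j9)).
have [c' cc'] : exists c', square7 c c'.
  by move: c7; rewrite !inE => /or3P[]/eqP ->; [exists 1%num|exists 4%num|exists 2%num].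
rewrite /piece torus_shape_abc; last by case/andP: j79.
exact: amalgam_abc (coded_small cX) aa' bb' cc' cE.
Qed.

Lemma fam_abc i m j n (c : N) (M : topologicalType) : (0 < i <= 9)%N -> (7 <= j <= 9)%N -> (j, n) != (i, m) ->
  c \in [:: 1; 2; 4]%num -> ((multiplier i * c) mod 7 = multiplier j mod 7)%num ->
  homeomorphic (@geom R N (amalgam (torus_shape i m) (affine c 0 reduced_abc))) M ->
  triangulates R (Tfam i m `|` Tfam j n)%fset M.
Proof.
move=> i9 j79 ji c7 cE; apply: (@union_abc i m j n) => //.
  have := coded_piece m i9; rewrite /piece => h.
  by have [a' aa'] := square7_multiplier (proj2 (andP i9)); have := coded_affine a' (6 * a' * torus_shift i m) h; rewrite affineK.
by exists (torus_shift i m); rewrite Tfam_piece // realization_set_geom.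
Qed.

Lemma base_abc i j n (c : N) (M : topologicalType) : (0 < i <= 3)%N -> (7 <= j <= 9)%N ->
  c \in [:: 1; 2; 4]%num -> ((multiplier i * c) mod 7 = multiplier j mod 7)%num ->
  homeomorphic (@geom R N (amalgam cyclic_torus (affine c 0 reduced_abc))) M ->
  triangulates R (Tbase i `|` Tfam j n)%fset M.
Proof.
move=> i3 j79 c7 cE.
have i9 : (0 < i <= 9)%N by case/andP: i3 => -> /leq_trans ->.
apply: (@union_abc i 0 j n) => //.
- apply/eqP => -[ji _]; move: i3 j79; rewrite ji => /andP[_ i3] /andP[/leq_trans/(_ i3)] //.
- by case: i i3 {i9 cE} => [|[|[|[|//]]]] // _; vm_compute.
- by exists 0%num; rewrite Tbase_piece.
Qed.

Lemma shape_uv i m : (i <= 3)%N -> torus_shape i m \in [:: cyclic_torus; torus_uv; torus_uvw].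
Proof. by move=> i3; rewrite /torus_shape i3; case: ifP => _; rewrite !inE eqxx ?orbT. Qed.

End Assembly.

Local Close Scope classical_set_scope.
Local Close Scope ring_scope.
Local Open Scope nat_scope.
Local Open Scope fset_scope.

Theorem corollary3p15 (R : realType) :
  ((forall m n i j : nat,
      (i, j) \in [:: (1, 7); (1, 8); (2, 8); (2, 9); (3, 7); (3, 9)] ->
      triangulates R (Tbase i `|` Tfam j n) (sphere R 3) /\
      triangulates R (Tfam i m `|` Tfam j n) (sphere R 3)) /\
   (forall m n k l : nat,
      (k, l) \in [:: (4, 7); (5, 8); (6, 9)] ->
      triangulates R (Tfam k m `|` Tfam l n) (sphere R 3))) /\
  (forall m n i j : nat,
     (i, j) \in [:: (1, 9); (2, 7); (3, 8)] ->
     triangulates R (Tbase i `|` Tfam j n) (projective_space R 3) /\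
     triangulates R (Tfam i m `|` Tfam j n) (projective_space R 3)) /\
  (forall m n : nat,
     [/\ triangulates R (Tfam 4 m `|` Tfam 8 n) (lens_space R 4 1),
         triangulates R (Tfam 5 m `|` Tfam 9 n) (lens_space R 4 1) &
         triangulates R (Tfam 6 m `|` Tfam 7 n) (lens_space R 4 1)]) /\
  (forall m n : nat,
     [/\ triangulates R (Tfam 4 m `|` Tfam 9 n) (lens_space R 5 2),
         triangulates R (Tfam 5 m `|` Tfam 7 n) (lens_space R 5 2) &
         triangulates R (Tfam 6 m `|` Tfam 8 n) (lens_space R 5 2)]) /\
  (forall m n : nat,
     [/\ triangulates R (Tfam 7 m `|` Tfam 8 n) (lens_space R 3 1),
         triangulates R (Tfam 8 m `|` Tfam 9 n) (lens_space R 3 1) &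
         triangulates R (Tfam 9 m `|` Tfam 7 n) (lens_space R 3 1)]) /\
  (forall j m n : nat,
     7 <= j <= 9 -> m <> n ->
     triangulates R (Tfam j m `|` Tfam j n) (sphere R 2 * sphere R 1)%type).
Proof.
split; [split|split; [|split; [|split; [|split]]]].
- have S3 i j m n c : 0 < i <= 3 -> 7 <= j <= 9 -> c \in [:: 1; 2]%num ->
      ((multiplier i * c) mod 7 = multiplier j mod 7)%num ->
      triangulates R (Tbase i `|` Tfam j n) (sphere R 3) /\
      triangulates R (Tfam i m `|` Tfam j n) (sphere R 3).
    move=> i3 j79 c12 cE.
    have c124 : c \in [:: 1; 2; 4]%num by move: c12; rewrite !inE => /orP[]->; rewrite ?orbT.
    case/andP: (i3) => i0 i3'.
    split; [apply: (base_abc n i3 j79 c124 cE)|apply: (@fam_abc R i m j n c) => //].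
    + exact: amalgam_S3_cyclic.
    + by rewrite i0 (leq_trans i3').
    + apply/eqP => -[ji _]; move: j79; rewrite ji => /andP[/leq_trans/(_ i3')] //.
    + by apply: amalgam_S3_cyclic => //; exact: shape_uv.
  (* The numerals are the ratios of the multipliers of [j] and [i]. *)
  move=> m n i j; rewrite !inE => /or4P[/eqP[-> ->]|/eqP[-> ->]|/eqP[-> ->]|/or3P[]/eqP[-> ->]].
  + exact: (S3 _ _ _ _ 1%num).
  + exact: (S3 _ _ _ _ 2%num).
  + exact: (S3 _ _ _ _ 1%num).
  + exact: (S3 _ _ _ _ 2%num).
  + exact: (S3 _ _ _ _ 2%num).
  + exact: (S3 _ _ _ _ 1%num).
- move=> m n k l; rewrite !inE => /or3P[]/eqP[-> ->];
    by apply: (@fam_abc R _ _ _ _ 1%num) => //; exact: amalgam_S3_q.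
- have RP3 i j m n : 0 < i <= 3 -> 7 <= j <= 9 ->
      ((multiplier i * 4) mod 7 = multiplier j mod 7)%num ->
      triangulates R (Tbase i `|` Tfam j n) (projective_space R 3) /\
      triangulates R (Tfam i m `|` Tfam j n) (projective_space R 3).
    move=> i3 j79 cE; case/andP: (i3) => i0 i3'.
    split; [apply: (@base_abc R i j n 4%num) => //|apply: (@fam_abc R i m j n 4%num) => //].
    + exact: amalgam_RP3.
    + by rewrite i0 (leq_trans i3').
    + apply/eqP => -[ji _]; move: j79; rewrite ji => /andP[/leq_trans/(_ i3')] //.
    + by apply: amalgam_RP3; exact: shape_uv.
  by move=> m n i j; rewrite !inE => /or3P[]/eqP[-> ->]; exact: RP3.
- by move=> m n; split; apply: (@fam_abc R _ _ _ _ 2%num) => //; exact: amalgam_L41.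
- by move=> m n; split; apply: (@fam_abc R _ _ _ _ 4%num) => //; exact: amalgam_L52.
- by move=> m n; split; apply: (@fam_abc R _ _ _ _ 2%num) => //; exact: amalgam_L31.
- move=> j m n j79 mn; apply: (@fam_abc R j m j n 1%num) => //.
  + by case/andP: j79 => /(leq_trans _) -> // ->.
  + by apply/eqP => -[nm]; apply: mn.
  + by rewrite N.mul_1_r.
  + rewrite torus_shape_abc; last by case/andP: j79.
    exact: amalgam_S2S1.
Qed.
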